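(* There exist $h_\star>0$ and $\epsilon>0$ such that the following holds for every $p$ with $2-\epsilon\le p<2$ and every $0<h\le h_\star$. Let $z\in\Omega$ and let $\mathbf f\in\mathbf L^2(\Omega)$ satisfy $\|\mathbf f\|_{\mathbf L^2(\Omega)}\le\tilde{\mathfrak C}\,\nu_-$, where $\tilde{\mathfrak C}=(2C_e\tilde C_\kappa)^{-1}$. Then there exists $(\mathbf u_h,\mathsf p_h,T_h)\in\mathbf X_h\times Q_h\times V_h$ such that $$\int_\Omega(\nu(T_h)\mathbf u_h\cdot\mathbf v_h-\mathsf p_h\,\mathrm{div}\,\mathbf v_h)\,d\mathbf x=\int_\Omega\mathbf f\cdot\mathbf v_h\,d\mathbf x\quad\forall\mathbf v_h\in\mathbf X_h,$$ $$\int_\Omega\mathsf q_h\,\mathrm{div}\,\mathbf u_h\,d\mathbf x=0\quad\forall\mathsf q_h\in Q_h,$$ $$\int_\Omega(\kappa(T_h)\nabla T_h\cdot\nabla S_h-T_h\mathbf u_h\cdot\nabla S_h)\,d\mathbf x=\langle\delta_z,S_h\rangle\quad\forall S_h\in V_h.$$ In addition, $T_h\in\mathfrak B_T^h$, i.e. $\|\nabla T_h\|_{\mathbf L^p(\Omega)}\le\tilde C_{1/2}\|\delta_z\|_{W^{-1,p}(\Omega)}$ with $\tilde C_{1/2}=2\tilde C_\kappa$.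
   Context: $\Omega\subset\mathbb R^2$ is an open bounded polygonal domain with Lipschitz boundary and unit outward normal $\mathbf n$. Bold letters denote vector-valued functions and spaces. $1/p+1/p'=1$; $W^{-1,p}(\Omega)=(W^{1,p'}_0(\Omega))'$ with the dual norm induced by $S\mapsto\|\nabla S\|_{\mathbf L^{p'}(\Omega)}$; $\langle\delta_z,S\rangle=S(z)$. $L^2_0(\Omega)$: zero-average functions of $L^2(\Omega)$. $\mathbf H(\mathrm{div},\Omega)=\{\mathbf v\in\mathbf L^2(\Omega):\mathrm{div}\,\mathbf v\in L^2(\Omega)\}$ and $\mathbf H_0(\mathrm{div},\Omega)$ is its subspace with $\mathbf v\cdot\mathbf n|_{\partial\Omega}=0$. Viscosity: $\nu:\mathbb R\to\mathbb R$ is Lipschitz and $0<\nu_-\le\nu(s)\le\nu_+$ for all $s$. Diffusivity: $\kappa:\mathbb R\to\mathbb R$ is Lipschitz and $0<\kappa_-\le\kappa(s)\le\kappa_+$ for all $s$. $\{\mathscr T_h\}_{h>0}$ is a family of conforming, shape regular meshes of $\bar\Omega$ into closed triangles $K$; $h=\max_K\mathrm{diam}(K)$. Spaces: $V_h=\{S_h\in C(\bar\Omega):S_h|_K\in\mathbb P_1(K)\ \forall K\in\mathscr T_h,\ S_h|_{\partial\Omega}=0\}$; $\mathbf X_h=\{\mathbf v_h\in\mathbf H_0(\mathrm{div},\Omega):\mathbf v_h|_K=a_K\mathbf x+\mathbf b_K,\ a_K\in\mathbb R,\ \mathbf b_K\in\mathbb R^2\ \forall K\}$ (lowest-order Raviart–Thomas);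 $Q_h=\{\mathsf q_h\in L^2_0(\Omega):\mathsf q_h|_K\in\mathbb P_0(K)\ \forall K\}$. $C_e$ is the best constant in $\|R\|_{L^{2p/(2-p)}(\Omega)}\le C_e\|\nabla R\|_{\mathbf L^p(\Omega)}$, $R\in W^{1,p}_0(\Omega)$. $\tilde C_\kappa>0$ is the constant, independent of $h$, in the discrete inf-sup inequality for the diffusion operator with coefficient $\kappa$, valid for all sufficiently small $h$ and all $p<2$ sufficiently close to $2$: for every $\theta_h\in V_h$, $$\|\nabla R_h\|_{\mathbf L^p(\Omega)}\le\tilde C_\kappa\sup_{0\ne S_h\in V_h}\frac{\int_\Omega\kappa(\theta_h)\nabla R_h\cdot\nabla S_h\,d\mathbf x}{\|\nabla S_h\|_{\mathbf L^{p'}(\Omega)}}\quad\forall R_h\in V_h.$$ $\mathfrak B_T^h=\{\theta_h\in V_h:\|\nabla\theta_h\|_{\mathbf L^p(\Omega)}\le\tilde C_{1/2}\|\delta_z\|_{W^{-1,p}(\Omega)}\}$, with $\tilde C_\alpha=\tilde C_\kappa/(1-\alpha)$. *)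

(* Defs.v *)
(* The plane is R * R, for an arbitrary R : realType. *)
From mathcomp Require Import all_boot all_order all_algebra.
From mathcomp Require Import all_classical all_reals all_analysis.

Set Implicit Arguments.
Unset Strict Implicit.
Unset Printing Implicit Defensive.

Import Order.TTheory GRing.Theory Num.Theory.
Import numFieldNormedType.Exports.

Local Open Scope classical_set_scope.
Local Open Scope ring_scope.

(* The library norm on R * R is the sup norm; it is only used for the
   topology, boundedness and differentiability.  Lengths are Euclidean. *)
Definition dot {R : realType} (x y : R * R) : R := x.1 * y.1 + x.2 * y.2.

Definition enorm {R : realType} (x : R * R) : R := Num.sqrt (dot x x).

Definition diam {R : realType} (A : set (R * R)) : R :=
  sup [set enorm (xy.1 - xy.2) | xy in A `*` A].

(* Diameter of the largest disc contained in A. *)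
Definition rho {R : realType} (A : set (R * R)) : R :=
  sup [set 2 * r | r in
        [set r : R | 0 <= r /\
           exists c : R * R, forall y, enorm (y - c) <= r -> A y]].

Definition bdry {R : realType} (A : set (R * R)) : set (R * R) :=
  closure A `\` interior A.

Definition leb2 (R : realType) :
    {measure set (measurableTypeR R * measurableTypeR R) -> \bar R} :=
  (@lebesgue_measure R \x @lebesgue_measure R)%E.

Definition int2 {R : realType} (Omega : set (R * R)) (f : R * R -> R) : R :=
  \int[leb2 R]_(x in Omega) f x.

(* L^p(Omega) norms; for vector fields, of the pointwise Euclidean norm. *)
Definition nrm {R : realType} (Omega : set (R * R)) (p : R)
    (f : R * R -> R) : \bar R :=
  'N[leb2 R]_(p%:E)[EFin \o (f \_ Omega)].

Definition nrmv {R : realType} (Omega : set (R * R)) (p : R)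
    (v : R * R -> R * R) : \bar R :=
  nrm Omega p (fun x => enorm (v x)).

Definition Lp {R : realType} (Omega : set (R * R)) (p : R)
    (f : R * R -> R) : Prop :=
  measurable_fun (Omega : set (measurableTypeR R * measurableTypeR R)) f /\
  (nrm Omega p f < +oo)%E.

Definition Lpv {R : realType} (Omega : set (R * R)) (p : R)
    (v : R * R -> R * R) : Prop :=
  Lp Omega p (fun x => (v x).1) /\ Lp Omega p (fun x => (v x).2).

(* Classical partial derivatives, gradient and divergence.  They are applied
   to smooth functions and to piecewise affine functions on a triangulation:
   in the latter case they are the elementwise derivatives (the edges form a
   null set), which agree a.e. with the distributional gradient of a member of
   V_h and the distributional divergence of a member of X_h. *)
Definition pd {R : realType} (i : bool) (f : R * R -> R) (x : R * R) : R :=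
  'D_((if i then (0, 1) else (1, 0)) : R * R) f x.

Definition grad {R : realType} (f : R * R -> R) (x : R * R) : R * R :=
  (pd false f x, pd true f x).

Definition div {R : realType} (v : R * R -> R * R) (x : R * R) : R :=
  pd false (fun y => (v y).1) x + pd true (fun y => (v y).2) x.

(* C^infinity: every iterated partial derivative is differentiable. *)
Definition smooth {R : realType} (f : R * R -> R) : Prop :=
  forall (s : seq bool) (x : R * R), differentiable (foldr pd f s) x.

Definition test_fun {R : realType} (Omega : set (R * R))
    (phi : R * R -> R) : Prop :=
  [/\ smooth phi, compact (closure [set x | phi x != 0]) &
      closure [set x | phi x != 0] `<=` Omega].

(* f belongs to W^{1,p}_0(Omega) and g is its weak gradient: (f, g) is the
   L^p-limit of pairs (phi, grad phi) with phi in C_c^infinity(Omega). *)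
Definition W10 {R : realType} (Omega : set (R * R)) (p : R)
    (f : R * R -> R) (g : R * R -> R * R) : Prop :=
  [/\ Lp Omega p f, Lpv Omega p g &
      exists phi : nat -> R * R -> R,
        [/\ forall n, test_fun Omega (phi n),
            (fun n => nrm Omega p (fun x => phi n x - f x)) @ \oo --> 0%E &
            (fun n => nrmv Omega p (fun x => grad (phi n) x - g x))
              @ \oo --> 0%E]].

(* f belongs to H^1(Omega) and g is its weak gradient. *)
Definition H1 {R : realType} (Omega : set (R * R))
    (f : R * R -> R) (g : R * R -> R * R) : Prop :=
  [/\ Lp Omega 2 f, Lpv Omega 2 g &
      forall phi, test_fun Omega phi ->
        int2 Omega (fun x => f x * pd false phi x) =
          - int2 Omega (fun x => (g x).1 * phi x) /\
        int2 Omega (fun x => f x * pd true phi x) =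
          - int2 Omega (fun x => (g x).2 * phi x)].

(* v belongs to H(div, Omega) and d is its weak divergence. *)
Definition Hdiv {R : realType} (Omega : set (R * R))
    (v : R * R -> R * R) (d : R * R -> R) : Prop :=
  [/\ Lpv Omega 2 v, Lp Omega 2 d &
      forall phi, test_fun Omega phi ->
        int2 Omega (fun x => dot (v x) (grad phi x)) =
          - int2 Omega (fun x => d x * phi x)].

(* The normal trace of v in H(div, Omega) is the functional on traces of
   H^1(Omega) given by Green's formula
     <v.n, f> = int_Omega (v . grad f + f div v);
   H_0(div, Omega) asks that it vanish. *)
Definition H0div {R : realType} (Omega : set (R * R))
    (v : R * R -> R * R) : Prop :=
  exists2 d : R * R -> R, Hdiv Omega v d &
    forall f g, H1 Omega f g ->
      int2 Omega (fun x => dot (v x) (g x) + d x * f x) = 0.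

Definition polygonal {R : realType} (Omega : set (R * R)) : Prop :=
  exists s : seq ((R * R) * (R * R)),
    bdry Omega = [set x | exists2 ab, ab \in s &
      exists2 t : R, 0 <= t <= 1 & x = (1 - t) *: ab.1 + t *: ab.2].

(* Near each boundary point, in a rotated orthonormal frame (e, e') centred
   there, Omega is the strict epigraph of a Lipschitz function. *)
Definition lipschitz_boundary {R : realType} (Omega : set (R * R)) : Prop :=
  forall x, bdry Omega x ->
    exists (e : R * R) (gamma : R -> R) (r s : R),
      [/\ enorm e = 1, lipschitz gamma, 0 < r, 0 < s &
          forall a b : R, `|a| < r -> `|b| < s ->
            Omega (x + a *: e + b *: ((- e.2, e.1) : R * R)) <-> gamma a < b].

Definition polygonal_domain {R : realType} (Omega : set (R * R)) : Prop :=
  [/\ open Omega, connected Omega /\ Omega !=set0, bounded_set Omega,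
      polygonal Omega & lipschitz_boundary Omega].

(* A triangle is given by its three vertices; face K A is the convex hull of
   the vertices with index in A, so face K set0 is empty. *)
Definition face {R : realType} (K : {ffun 'I_3 -> R * R}) (A : {set 'I_3}) :
    set (R * R) :=
  [set x | exists l : 'I_3 -> R,
     [/\ forall i, 0 <= l i, forall i, i \notin A -> l i = 0,
         \sum_i l i = 1 & x = \sum_i l i *: K i]].

Definition tri {R : realType} (K : {ffun 'I_3 -> R * R}) : set (R * R) :=
  face K [set: 'I_3]%SET.

Definition nondegenerate {R : realType} (K : {ffun 'I_3 -> R * R}) : Prop :=
  let a := K (inord 1) - K ord0 in
  let b := K (inord 2) - K ord0 in
  a.1 * b.2 - a.2 * b.1 != 0.

Definition conforming_mesh {R : realType} (Omega : set (R * R))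
    (T : seq {ffun 'I_3 -> R * R}) : Prop :=
  [/\ forall K, K \in T -> nondegenerate K,
      closure Omega = [set x | exists2 K, K \in T & tri K x] &
      forall K K', K \in T -> K' \in T ->
        exists A A', tri K `&` tri K' = face K A /\
                     tri K `&` tri K' = face K' A'].

Definition meshsize {R : realType} (T : seq {ffun 'I_3 -> R * R}) : R :=
  \big[Order.max/0]_(K <- T) diam (tri K).

(* The family {T_h}, with h running over a set H of positive mesh sizes. *)
Definition mesh_family {R : realType} (Omega : set (R * R)) (H : set R)
    (Th : R -> seq {ffun 'I_3 -> R * R}) : Prop :=
  (forall h, H h ->
     [/\ 0 < h, conforming_mesh Omega (Th h) & meshsize (Th h) = h]) /\
  (exists2 sigma : R, 0 < sigma &
     forall h, H h -> forall K, K \in Th h ->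
       diam (tri K) <= sigma * rho (tri K)).

Definition Vh {R : realType} (Omega : set (R * R))
    (T : seq {ffun 'I_3 -> R * R}) (S : R * R -> R) : Prop :=
  [/\ {within closure Omega, continuous S},
      forall K, K \in T -> exists (a : R * R) (b : R),
        forall x, tri K x -> S x = dot a x + b &
      forall x, bdry Omega x -> S x = 0].

(* Members of X_h and Q_h are L^2 classes, possibly discontinuous across
   edges, so the elementwise form is only imposed in the open triangles. *)
Definition Xh {R : realType} (Omega : set (R * R))
    (T : seq {ffun 'I_3 -> R * R}) (v : R * R -> R * R) : Prop :=
  H0div Omega v /\
  forall K, K \in T -> exists (a : R) (b : R * R),
    forall x, interior (tri K) x -> v x = a *: x + b.

Definition Qh {R : realType} (Omega : set (R * R))
    (T : seq {ffun 'I_3 -> R * R}) (q : R * R -> R) : Prop :=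
  [/\ Lp Omega 2 q, int2 Omega q = 0 &
      forall K, K \in T -> exists c : R,
        forall x, interior (tri K) x -> q x = c].

Definition conj_exp {R : realType} (p : R) : R := p / (p - 1).

(* Best constant in the embedding of W^{1,p}_0 into L^{2p/(2-p)}, p < 2. *)
Definition Ce {R : realType} (Omega : set (R * R)) (p : R) : R :=
  inf [set C : R | 0 <= C /\ forall f g, W10 Omega p f g ->
         (nrm Omega (2 * p / (2 - p)) f <= C%:E * nrmv Omega p g)%E].

Definition delta {R : realType} (z : R * R) (S : R * R -> R) : R := S z.

(* Norm of delta_z in the dual of W^{1,p'}_0(Omega).  For p < 2 one has
   p' > 2, every class has a unique continuous representative, and delta_z
   evaluates that representative. *)
Definition delta_norm {R : realType} (Omega : set (R * R)) (p : R)
    (z : R * R) : \bar R :=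
  ereal_sup [set r | exists S g,
    [/\ W10 Omega (conj_exp p) S g, {in Omega, continuous S},
        (0 < nrmv Omega (conj_exp p) g)%E &
        r = (`|delta z S| / fine (nrmv Omega (conj_exp p) g))%:E]].

Definition infsup_quotients {R : realType} (Omega : set (R * R))
    (T : seq {ffun 'I_3 -> R * R}) (kappa : R -> R) (p : R)
    (theta Rh : R * R -> R) : set (\bar R) :=
  [set (int2 Omega (fun x => kappa (theta x) * dot (grad Rh x) (grad S x))
        / fine (nrmv Omega (conj_exp p) (grad S)))%:E
   | S in [set S | Vh Omega T S /\ exists2 x, Omega x & S x != 0]].

Definition discrete_infsup {R : realType} (Omega : set (R * R))
    (T : seq {ffun 'I_3 -> R * R}) (kappa : R -> R) (p C : R) : Prop :=
  forall theta Rh, Vh Omega T theta -> Vh Omega T Rh ->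
    (nrmv Omega p (grad Rh) <=
     C%:E * ereal_sup (infsup_quotients Omega T kappa p theta Rh))%E.

Definition C_tilde {R : realType} (Ckappa alpha : R) : R :=
  Ckappa / (1 - alpha).

Definition B_T {R : realType} (Omega : set (R * R))
    (T : seq {ffun 'I_3 -> R * R}) (p Ckappa : R) (z : R * R)
    (theta : R * R -> R) : Prop :=
  Vh Omega T theta /\
  (nrmv Omega p (grad theta) <=
     (C_tilde Ckappa 2^-1)%:E * delta_norm Omega p z)%E.

(* Main.v *)
(** The velocity and the pressure are eliminated.  For a frozen temperature [theta] in V_h the form
    [int nu(theta) u . v] is coercive on the kernel Z_h of the discrete divergence, which gives a
    velocity [u(theta)] with [||u||_2 <= ||f||_2 / nu_min].  By Hoelder's inequality with exponents
    2p/(2-p), 2, p' and the Sobolev inequality, the smallness of [f] makes the convection term at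
    most half of what the discrete inf-sup inequality controls.  The linear heat equation with
    data [(theta, u(theta))] is therefore uniquely solvable in V_h, and its solution
    [Phi(theta)] satisfies [||grad Phi(theta)||_p <= 2 Ckappa ||delta_z||].  The map [Phi] is continuous and
    bounded on a finite-dimensional space, so Brouwer's theorem provides a fixed point; the
    pressure is then recovered by linear algebra, since the momentum residual vanishes on Z_h.

    The Sobolev constant and the norm of [delta_z] refer to W^{1,p}_0, so V_h must be embedded in
    it: a continuous piecewise affine function is a max-min of affine ones, and the positive part
    is approximated by [t exp(-e/t)]; subtracting a small threshold makes the supports compact. *)
Require Import Defs.
From HB Require Import structures.
From mathcomp Require Import all_boot all_order all_algebra.
From mathcomp Require Import ring lra.
From mathcomp Require Import all_classical all_reals all_analysis.
From mathcomp Require Import measurable_realfun.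

Set Implicit Arguments.
Unset Strict Implicit.
Unset Printing Implicit Defensive.

Import Order.TTheory GRing.Theory Num.Theory.
Import numFieldNormedType.Exports.

Local Open Scope classical_set_scope.
Local Open Scope ring_scope.

(** * Brouwer's fixed point theorem, from Kuhn's lemma modulo 2 *)

(** Elementwise derivatives have no controlled values on mesh edges. All integrals are therefore
    moved to the part of [Omega] covered by open triangles, an open set of full measure; bases are
    free and spanning up to equality on that set, and point values of V_h functions are recovered
    from it by density and continuity. Two conventions need care. The constant [Ce] is an infimum,
    equal to 0 when no admissible constant exists; then [0^-1 = 0] turns the smallness condition
    into a zero norm, and the convection estimate holds trivially. The supremum [delta_norm] may be
    infinite. The range of the fixed-point map is thus bounded by a constant from norm equivalence
    on V_h, and [delta_norm] enters only in the last estimate, split according to its finiteness.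
    Brouwer's theorem is reached by algebra modulo 2: labels on grid points are 0-cochains, the cup
    product of their coboundaries has total 1 over the grid, and a small cube on which it is nonzero
    carries both values of every label. *)

Section Kuhn.
Variable n : nat.
Implicit Types (A : {set 'I_n}) (v w : {ffun 'I_n -> nat}).

Lemma addrr_F2 (x : 'F_2) : x + x = 0.
Proof. by case: x => [[|[|//]] ?]; apply: val_inj. Qed.

(** The pairs [(j, k)] and [(k, j)] carry the same value and cancel in characteristic 2. *)
Lemma sum_symmetric_F2 A (F : 'I_n -> 'I_n -> 'F_2) :
  (forall j k, F j k = F k j) -> \sum_(j in A) \sum_(k in A :\ j) F j k = 0.
Proof.
move=> Fsym.
have -> : \sum_(j in A) \sum_(k in A :\ j) F j k =
    \sum_(j in A) \sum_(k in A) (if (j < k)%N then F j k else 0) +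
    \sum_(j in A) \sum_(k in A) (if (k < j)%N then F j k else 0).
  rewrite -big_split; apply: eq_bigr => j jA /=.
  rewrite -big_split /= [RHS](bigD1 j) //= !ltnn !add0r; apply: eq_big => k.
    by rewrite !inE andbC.
  by rewrite !inE => /andP[kj _]; case: ltngtP kj; rewrite ?addr0 ?add0r// => /val_inj->; rewrite eqxx.
rewrite [X in _ + X]exchange_big /=.
rewrite [X in _ + X](_ : _ = \sum_(j in A) \sum_(k in A)
    (if (j < k)%N then F j k else 0)) ?addrr_F2//.
by apply: eq_bigr => j _; apply: eq_bigr => k _; rewrite Fsym.
Qed.

Definition grid_shift (j : 'I_n) v : {ffun 'I_n -> nat} :=
  [ffun i => v i + (i == j)]%N.

Lemma grid_shiftC j k v : grid_shift j (grid_shift k v) = grid_shift k (grid_shift j v).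
Proof. by apply/ffunP => i; rewrite !ffunE addnAC. Qed.

Variable lab : nat -> {ffun 'I_n -> nat} -> 'F_2.

(* Sum, over the monotone lattice paths that leave [v] along [k] distinct directions of [A],
   of the products of the jumps of [lab k.-1, ..., lab 0]: a cup product of coboundaries. *)
Fixpoint cup (k : nat) A v : 'F_2 :=
  if k is k'.+1 then
    \sum_(j in A) (lab k' (grid_shift j v) + lab k' v) * cup k' (A :\ j) (grid_shift j v)
  else 1.

(** A cup product of coboundaries is a cocycle: over the cube spanned by [A] at [v], the facets away
    from [v] and the facets through [v] have the same total. After expanding the first step of the
    paths, the terms symmetric in the two removed directions cancel and the induction hypothesis
    matches the others. *)
Lemma cup_closed k A v :
  \sum_(j in A) cup k (A :\ j) (grid_shift j v) = \sum_(j in A) cup k (A :\ j) v.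
Proof.
elim: k A v => [//|k IH] A v /=.
have setDC j i : A :\ j :\ i = A :\ i :\ j by rewrite !finset.setDDl finset.setUC.
have swap (F : 'I_n -> 'I_n -> 'F_2) :
    \sum_(j in A) \sum_(i in A :\ j) F j i = \sum_(j in A) \sum_(i in A :\ j) F i j.
  rewrite (exchange_big_dep (mem A)) /=; last by move=> i j _; rewrite !inE => /andP[].
  apply: eq_bigr => j jA; apply: eq_bigl => i.
  by rewrite !inE jA andbT eq_sym andbC.
transitivity (\sum_(j in A) lab k (grid_shift j v) *
    \sum_(i in A :\ j) cup k (A :\ j :\ i) (grid_shift j v)).
  under eq_bigr => j _ do under eq_bigr => i _ do rewrite mulrDl.
  under eq_bigr => j _ do rewrite big_split /=.
  rewrite big_split /= sum_symmetric_F2 ?add0r; last first.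
    by move=> j i; rewrite grid_shiftC setDC.
  by apply: eq_bigr => j _; rewrite -IH mulr_sumr.
under [RHS]eq_bigr => j _ do under eq_bigr => i _ do rewrite mulrDl.
under [RHS]eq_bigr => j _ do rewrite big_split /=.
rewrite [RHS]big_split /= [X in _ = _ + X](_ : _ = 0) ?addr0; last first.
  under eq_bigr => j _ do rewrite -mulr_sumr IH.
  by rewrite -mulr_sumr sum_symmetric_F2 ?mulr0// => j i; rewrite setDC.
rewrite swap; apply: eq_bigr => j _; rewrite mulr_sumr.
by apply: eq_bigr => i _; rewrite setDC.
Qed.

(** Every path product contains a jump of [lab j], and that jump is [c + c = 0]. The predicate [P]
    is an invariant carried along the paths, relating the directions still available to the current
    grid point. *)
Lemma cup_const k A v j (c : 'F_2) (P : {set 'I_n} -> {ffun 'I_n -> nat} -> Prop) :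
  (j < k)%N -> P A v ->
  (forall (B : {set 'I_n}) w i, i \in B -> P B w -> P (B :\ i) (grid_shift i w)) ->
  (forall B w, P B w -> lab j w = c) -> cup k A v = 0.
Proof.
elim: k A v => [//|k IH] A v /=; rewrite ltnS leq_eqVlt => /predU1P[->|jk] PA PS Pc.
  apply: big1 => i iA; rewrite (Pc A v)// (Pc (A :\ i) (grid_shift i v)) ?addrr_F2 ?mul0r//.
  exact: PS.
by apply: big1 => i iA; rewrite IH ?mulr0//; apply: PS.
Qed.

Variable m : nat.

Definition grid_nat (x : {ffun 'I_n -> 'I_m.+1}) : {ffun 'I_n -> nat} :=
  [ffun i => nat_of_ord (x i)].

(** Discrete Stokes formula in direction [j]: the shift maps the layers below [m] onto the nonzero
    layers, so interior layers occur twice and only the two extreme ones survive. The condition [Q]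
    must not see coordinate [j]. *)
Lemma sum_telescope (j : 'I_n) (Q : pred {ffun 'I_n -> 'I_m.+1})
    (g : {ffun 'I_n -> nat} -> 'F_2) :
  (forall x y : {ffun 'I_n -> 'I_m.+1}, (forall i, i != j -> x i = y i) -> Q x = Q y) ->
  \sum_(x | Q x && (x j < m)%N) (g (grid_shift j (grid_nat x)) + g (grid_nat x)) =
  \sum_(x | Q x && (x j == m :> nat)) g (grid_nat x) +
  \sum_(x | Q x && (x j == 0 :> nat)) g (grid_nat x).
Proof.
move=> Qext; rewrite big_split /=.
pose inc (x : {ffun 'I_n -> 'I_m.+1}) : {ffun 'I_n -> 'I_m.+1} :=
  [ffun i => if i == j then inord (x i).+1 else x i].
pose dec (x : {ffun 'I_n -> 'I_m.+1}) : {ffun 'I_n -> 'I_m.+1} :=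
  [ffun i => if i == j then inord (x i).-1 else x i].
have -> : \sum_(x | Q x && (x j < m)%N) g (grid_shift j (grid_nat x)) =
    \sum_(x | Q x && (x j != 0 :> nat)) g (grid_nat x).
  rewrite [RHS](reindex_onto inc dec) /=; last first.
    move=> x /andP[_ vj]; apply/ffunP => i; rewrite !ffunE; case: eqP => // ->.
    by apply: val_inj; rewrite /= [LHS]inordK inordK ?prednK ?lt0n// ltnW ?ltn_ord.
  apply: eq_big => x; last first.
    move=> /andP[_ vj]; congr g; apply/ffunP => i; rewrite !ffunE.
    by case: eqP => [->|_]; rewrite ?addn0// inordK// addn1.
  rewrite (Qext (inc x) x); last by move=> i /negbTE ij; rewrite ffunE ij.
  rewrite !ffunE eqxx; case: (Q x) => //=.
  case: (ltnP (x j) m) => vjm.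
    rewrite inordK//=; apply/esym/eqP/ffunP => i; rewrite !ffunE.
    case: eqP => // ->; apply: val_inj; rewrite /=.
    by rewrite !inordK//= ltnS ltnW.
  apply/esym/negP => /andP[H /eqP E]; move: H.
  have := congr1 (fun f : {ffun _} => nat_of_ord (f j)) E; rewrite !ffunE eqxx.
  (* Here [x j] is [m], and [inord] sends the out-of-range value [m.+1] to its default [ord0], so
     such a point is outside the image of [inc]. *)
  have -> : (inord (x j).+1 : 'I_m.+1) = ord0.
    apply: val_inj; rewrite /inord /insubd insubN //= -leqNgt.
    by rewrite !ltnS.
  by move=> _ /=; rewrite ?eqxx ?andbF.
set S0 := \sum_(x | Q x && (x j == 0)) _.
set Sp := \sum_(x | Q x && (x j != 0)) _.
set Sl := \sum_(x | Q x && (x j < m)%N) _; set Sm := \sum_(x | Q x && (x j == m :> nat)) _.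
have e : Sm + Sl = S0 + Sp.
  transitivity (\sum_(x | Q x) g (grid_nat x)).
    rewrite [RHS](bigID (fun x : {ffun 'I_n -> 'I_m.+1} => (x j < m)%N)) addrC /=.
    congr (_ + _); apply: eq_bigl => x; congr andb.
    by rewrite -leqNgt eqn_leq -ltnS ltn_ord.
  by rewrite (bigID (fun x : {ffun 'I_n -> 'I_m.+1} => x j == 0 :> nat)).
have -> : Sp = S0 + (S0 + Sp) by rewrite addrA addrr_F2 add0r.
by rewrite -e addrA -[_ + Sl + Sl]addrA addrr_F2 addr0 addrC.
Qed.

Hypothesis lab0 : forall (j : 'I_n) w, w j = 0%N -> lab j w = 0.
Hypothesis lab1 : forall (j : 'I_n) w, (m <= w j)%N -> lab j w = 1.

(** Induction on the dimension of the face where the coordinates of index at least [k] equal [m]. By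
    the telescoping formula the total over a face is carried by its facets. The facets in directions
    [j < k] contribute 0 since [lab j] is constant there, and so does the facet of coordinate [k]
    equal to 0, where [lab k] is 0. The opposite facet has [lab k = 1] and reproduces the total one
    dimension lower. *)
Lemma sum_cup (k : nat) : (k <= n)%N ->
  \sum_(x : {ffun 'I_n -> 'I_m.+1} |
     [forall i : 'I_n, if (i < k)%N then (x i < m)%N else x i == m :> nat])
    cup k [set i : 'I_n | (i < k)%N]%SET (grid_nat x) = 1.
Proof.
elim: k => [_|k IH kn].
  rewrite (big_pred1 [ffun=> ord_max]) // => x /=; apply/forallP/eqP => [H|-> i].
    by apply/ffunP => i; rewrite ffunE; apply/val_inj/eqP; have := H i.
  by rewrite ffunE.
pose K := Ordinal kn; set A := [set i : 'I_n | (i < k.+1)%N]%SET.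
pose Q (j : 'I_n) (x : {ffun 'I_n -> 'I_m.+1}) := [forall i : 'I_n,
  (i != j) ==> if (i < k.+1)%N then (x i < m)%N else x i == m :> nat].
pose g (j : 'I_n) w := lab k w * cup k (A :\ j) w.
have Qext j (x y : {ffun 'I_n -> 'I_m.+1}) : (forall i, i != j -> x i = y i) -> Q j x = Q j y.
  by move=> e; apply: eq_forallb => i; case: eqP => //= /eqP /e->.
have QE j (x : {ffun 'I_n -> 'I_m.+1}) : j \in A -> [forall i : 'I_n,
    if (i < k.+1)%N then (x i < m)%N else x i == m :> nat] = Q j x && (x j < m)%N.
  rewrite inE => jA; apply/forallP/andP => [H|[/forallP H xj] i].
    by split; [apply/forallP => i; apply/implyP|have := H j; rewrite jA].
  by have := H i; case: eqP => //= ->; rewrite jA.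
(* On an extreme facet in direction [j], the remaining paths never move coordinate [j], so the
   boundary condition fixes [lab j] along them. *)
have Wconst (j : 'I_n) (x : {ffun 'I_n -> 'I_m.+1}) (j' : nat) : (j' < k)%N ->
    j = j' :> nat -> x j = 0%N :> nat \/ x j = m :> nat ->
    cup k (A :\ j) (grid_nat x) = 0.
  move=> j'k jj' xj.
  apply: (@cup_const _ _ _ j' (if x j == 0%N :> nat then 0 else 1)
     (fun (B : {set 'I_n}) w => j \notin B /\ w j = x j :> nat)) => //.
  - by rewrite !inE eqxx ffunE.
  - move=> B w i iB [jB wj]; split; first by rewrite !inE (negbTE jB) andbF.
    by rewrite ffunE wj; case: eqP jB iB => [->/negbTE->//|_ _ _]; rewrite addn0.
  - move=> B w [_ wj]; rewrite -jj'; case: eqP => x0; first by rewrite lab0// wj.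
    by rewrite lab1// wj; case: xj => [//|->].
rewrite /= -/A.
under eq_bigr => x _ do under eq_bigr => j _ do rewrite mulrDl.
(* [cup_closed] moves the second term back to the base point: [cup k.+1] becomes the sum over [j] of
   the increments of [g j] in direction [j]. *)
under eq_bigr => x _ do rewrite big_split /= -mulr_sumr cup_closed mulr_sumr -big_split /=.
rewrite exchange_big /= (bigD1 K) ?inE//= [X in _ + X]big1 ?addr0; last first.
  move=> j /andP[jA jK].
  rewrite (eq_bigl _ _ (fun x => QE j x jA)) (@sum_telescope j (Q j) (g j)); last exact: Qext.
  have jk : ((j : 'I_n) < k)%N.
    by move: jA; rewrite inE ltnS leq_eqVlt => /predU1P[e|//]; move: jK; rewrite -val_eqE /= e eqxx.
  by rewrite !big1 ?addr0// => x /andP[_ /eqP xj]; rewrite /g (Wconst _ _ j) ?mulr0//; [left|right].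
have KA : K \in A by rewrite inE.
rewrite (eq_bigl _ _ (fun x => QE K x KA)) (@sum_telescope K (Q K) (g K)); last exact: Qext.
rewrite [X in _ + X]big1 ?addr0; last first.
  by move=> x /andP[_ /eqP xK]; rewrite /g (lab0 (j := K)) ?mul0r// ffunE.
rewrite -[RHS]IH 1?ltnW//; apply: eq_big => [x|x /andP[_ /eqP xK]].
  apply/andP/forallP => [[/forallP H xK] i|H].
    have := H i; rewrite ltnS leq_eqVlt -val_eqE /=.
    by case: ltngtP => //= ik _; move: xK; rewrite (_ : K = i)//; apply/val_inj.
  split; last by have := H K; rewrite /= ltnn.
  apply/forallP => i; apply/implyP; rewrite -val_eqE /= ltnS leq_eqVlt => /negbTE->.
  exact: H.
rewrite /g (lab1 (j := K)) ?ffunE ?xK// mul1r; congr cup.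
by apply/setP => i; rewrite !inE -val_eqE /= ltnS leq_eqVlt; case: ltngtP.
Qed.
End Kuhn.

(** A total of 1 forces a cube with nonzero [cup]. On it no label can be constant, since [cup_const]
    would make the product vanish. *)
Lemma kuhn n m (lab : 'I_n -> {ffun 'I_n -> nat} -> bool) :
  (forall j (w : {ffun _ -> nat}), w j = 0%N -> lab j w = false) ->
  (forall j (w : {ffun _ -> nat}), (m <= w j)%N -> lab j w) ->
  exists v : {ffun 'I_n -> nat}, (forall i, (v i < m)%N) /\
    forall j, exists w w' : {ffun 'I_n -> nat}, [/\ forall i, (v i <= w i <= (v i).+1)%N,
      forall i, (v i <= w' i <= (v i).+1)%N, lab j w = false & lab j w' = true].
Proof.
move=> lab0 lab1.
pose L (k : nat) w : 'F_2 := if insub k is Some j then (lab j w)%:R else 0.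
have LE (j : 'I_n) w : L j w = (lab j w)%:R by rewrite /L valK.
have H : \sum_(x : {ffun 'I_n -> 'I_m.+1} | [forall i, (x i < m)%N])
    cup L n [set i : 'I_n | (i < n)%N]%SET (grid_nat x) = 1.
  have l0 (j : 'I_n) (w : {ffun 'I_n -> nat}) : w j = 0%N -> L j w = 0 by move=> wj; rewrite LE lab0.
  have l1 (j : 'I_n) (w : {ffun 'I_n -> nat}) : (m <= w j)%N -> L j w = 1 by move=> wj; rewrite LE lab1.
  rewrite -(sum_cup l0 l1 (leqnn n)).
  by apply: eq_bigl => x; apply: eq_forallb => i; rewrite ltn_ord.
have [x /forallP xm Wx] : exists2 x : {ffun 'I_n -> 'I_m.+1}, [forall i, (x i < m)%N] &
   cup L n [set i : 'I_n | (i < n)%N]%SET (grid_nat x) != 0.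
  apply: contrapT => N; have := H; rewrite big1 => [/esym/eqP|x xm]; first by rewrite oner_eq0.
  by apply/eqP; apply: contrapT => /negP W; apply: N; exists x.
exists (grid_nat x); split=> [i|j]; first by rewrite ffunE.
pose near (w : {ffun 'I_n -> nat}) := forall i, (grid_nat x i <= w i <= (grid_nat x i).+1)%N.
have [b|] := pselect (exists b, forall w, near w -> lab j w = b).
  case: b => b bE; case/negP: Wx; apply/eqP.
  apply: (@cup_const _ _ _ _ _ j b%:R
     (fun (B : {set 'I_n}) w => near w /\ forall i, i \in B -> w i = grid_nat x i)).
  - exact: ltn_ord.
  - by split=> // i; rewrite leqnn leqnSn.
  - move=> B w i iB [wn wB]; split=> k.
      rewrite [grid_shift _ _ _]ffunE; case: (eqVneq k i) => [->|_]; last by rewrite addn0.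
      by rewrite wB// addn1 leqnSn leqnn.
    by rewrite !inE ffunE => /andP[/negbTE-> /wB->]; rewrite addn0.
  - by move=> B w [wn _]; rewrite LE bE.
move=> N.
have [w [wn lw]] : exists w : {ffun 'I_n -> nat}, near w /\ lab j w = false.
  apply: contrapT => N'; apply: N; exists true => w wn.
  by apply/negPn/negP => /negbTE lw; apply: N'; exists w.
have [w' [wn' lw']] : exists w : {ffun 'I_n -> nat}, near w /\ lab j w = true.
  apply: contrapT => N'; apply: N; exists false => w' wn'.
  by apply/negP => lw'; apply: N'; exists w'.
by exists w, w'.
Qed.

Lemma mx_norm_lt (K : realFieldType) m n (x : 'M[K]_(m, n)) (e : K) : 0 < e ->
  (forall i j, `|x i j| < e) -> `|x| < e.
Proof.
move=> e0 xe; rewrite /Num.Def.normr /= mx_normrE.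
by apply/bigmax_ltP; split=> // -[i j] _; exact: xe.
Qed.

Lemma mx_norm_ge (K : realFieldType) m n (x : 'M[K]_(m, n)) i j : `|x i j| <= `|x|.
Proof.
rewrite [leRHS]/Num.Def.normr /= mx_normrE.
exact: (le_bigmax _ (fun ij : 'I_m * 'I_n => `|x ij.1 ij.2|) (i, j)).
Qed.

Lemma cvg_mx (T : Type) (F : set_system T) (FF : Filter F) (K : topologicalType) m n
    (f : T -> 'M[K]_(m, n)) (M : 'M[K]_(m, n)) :
  (forall i j, f x i j @[x --> F] --> M i j) -> f x @[x --> F] --> M.
Proof.
move=> fM A [P PM PA]; have : F (fun x => forall i j, P i j (f x i j)).
  apply: filter_forall => i; apply: filter_forall => j; exact: fM (PM i j).
by apply: (@filterS _ F FF) => x Px; apply: PA => i j; exact: Px.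
Qed.

(** The bounded range keeps [f] inside an open cube, which is subdivided ever more finely. The cells
    provided by [kuhn] cluster at a point [x]. If a coordinate of [f x - x] were nonzero, it would
    keep its sign near [x], whereas a nearby cell has vertices at which that coordinate is
    nonnegative and nonpositive. *)
Theorem brouwer (R : realType) n (f : 'rV[R]_n -> 'rV[R]_n) (r : R) :
  continuous f -> (forall x, `|f x| <= r) -> exists x, f x = x.
Proof.
move=> cf fr0.
(* Strictly larger than the bound on [f], so that [f] points inwards on every face of the cube. *)
pose r1 : R := `|r| + 1; have r1_gt0 : 0 < r1 by rewrite ltr_pwDr.
have fr x i : `|f x 0 i| < r1.
  by rewrite (le_lt_trans (mx_norm_ge _ _ _))// (le_lt_trans (fr0 x))// ltr_pwDr// ler_norm.
pose pt m (w : {ffun 'I_n -> nat}) : 'rV[R]_n := \row_i (- r1 + 2 * r1 / m.+1%:R * (w i)%:R).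
have ptm m (w : {ffun 'I_n -> nat}) i : w i = m.+1 -> pt m w 0 i = r1.
  by move=> wi; rewrite mxE wi mulfVK ?pnatr_eq0//; ring.
have step m (w w' v : {ffun 'I_n -> nat}) : (forall i, (v i <= w i <= (v i).+1)%N) ->
    (forall i, (v i <= w' i <= (v i).+1)%N) -> forall i, `|pt m w 0 i - pt m w' 0 i| <= 2 * r1 / m.+1%:R.
  move=> vw vw' i; rewrite !mxE; set c := 2 * r1 / _.
  have c0 : 0 <= c by rewrite divr_ge0// mulr_ge0// ltW.
  rewrite (_ : _ - _ = c * ((w i)%:R - (w' i)%:R)); last by ring.
  rewrite normrM (ger0_norm c0) ler_piMr//.
  have /andP[vwi wvi] := vw i; have /andP[vwi' wvi'] := vw' i.
  rewrite ler_distl lerBlDr !natr1 !ler_nat.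
  by rewrite (leq_trans wvi) ?ltnS// (leq_trans wvi') ?ltnS.
(* The label tells that [f] does not increase coordinate [j]. The values imposed on the two extreme
   faces agree with this meaning because the coordinates of [f] lie strictly between [- r1] and
   [r1]. *)
pose lab m (j : 'I_n) (w : {ffun 'I_n -> nat}) :=
  (w j != 0%N) && ((m.+1 <= w j)%N || (f (pt m w) 0 j <= pt m w 0 j)).
have [v vP] : {v : nat -> {ffun 'I_n -> nat} & forall m, (forall i, (v m i < m.+1)%N) /\
    forall j, exists w w' : {ffun 'I_n -> nat}, [/\ forall i, (v m i <= w i <= (v m i).+1)%N,
      forall i, (v m i <= w' i <= (v m i).+1)%N, lab m j w = false & lab m j w' = true]}.
  apply: (@choice _ _ (fun m (v : {ffun 'I_n -> nat}) => (forall i, (v i < m.+1)%N) /\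
    forall j, exists w w' : {ffun 'I_n -> nat}, [/\ forall i, (v i <= w i <= (v i).+1)%N,
      forall i, (v i <= w' i <= (v i).+1)%N, lab m j w = false & lab m j w' = true])) => m.
  apply: kuhn => j w; first by move=> wj; rewrite /lab wj.
  by rewrite /lab => mw; rewrite mw; case: (w j) mw.
have cpt : compact [set x : 'rV[R]_n | forall i, x 0 i \in `[- r1, r1]].
  by apply: (@rV_compact _ _ (fun=> `[- r1, r1]%classic)) => _; exact: segment_compact.
have [|x [_ xcl]] := cpt ((fun m => pt m (v m)) @ \oo) _.
  exists 0%N => // m _ /= i; rewrite mxE in_itv /=; apply/andP; split.
    by rewrite lerDl mulr_ge0 ?divr_ge0 ?mulr_ge0// ltW.
  have [vm _] := vP m.
  set q := (X in - r1 + X); suff : q <= 2 * r1 by move: q => q ?; lra.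
  rewrite /q -mulrA ler_piMr ?mulr_ge0 ?(ltW r1_gt0)// mulrC ler_pdivrMr// mul1r ler_nat.
  exact: ltnW.
exists x; apply/rowP => j; apply/eqP; rewrite -subr_eq0; apply/eqP; apply: contrapT => /eqP G0.
pose G y := f y 0 j - y 0 j.
have cG : {for x, continuous G}.
  have c1 : {for x, continuous (fun y => f y 0 j)}.
    exact: (continuous_comp (cf x) (@coord_continuous R 1 n 0 j (f x))).
  exact: (continuousB c1 (@coord_continuous R 1 n 0 j x)).
pose d := `|G x| / 2; have d0 : 0 < d by rewrite divr_gt0// normr_gt0.
have := cG; move/cvgr_dist_lt => /(_ _ d0) /nbhs_ballP[e /= e0 eG].
have e20 : 0 < e / 2 by rewrite divr_gt0.
have [M _ Me] : \forall m \near \oo, 2 * r1 / m.+1%:R < e / 2.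
  have /cvgr0_norm_lt/(_ _ e20) : 2 * r1 / m.+1%:R @[m --> \oo] --> (0 : R).
    rewrite -[X in _ --> X](mulr0 (2 * r1)); apply: cvgM; first exact: cvg_cst.
    by have := @cvg_harmonic R; apply: cvg_trans; apply: near_eq_cvg; near=> k.
  apply: filterS => m; apply: le_lt_trans; exact: ler_norm.
have [_ [[m /= Mm <-] xm]] : ([set pt m (v m) | m in [set m | (M <= m)%N]] `&` ball x (e / 2)) !=set0.
  apply: xcl; last exact: nbhsx_ballx.
  by exists M => // m /= Mm; exists m.
have {}Me := Me _ Mm.
have [vm /(_ j)[w [w' [vw vw' lw lw']]]] := vP m.
have vv i : (v m i <= v m i <= (v m i).+1)%N by rewrite leqnn leqnSn.
have near_x (u : {ffun 'I_n -> nat}) : (forall i, (v m i <= u i <= (v m i).+1)%N) -> ball x e (pt m u).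
  move=> vu; apply: (ball_split xm).
  rewrite -ball_normE /ball_ /=; apply: mx_norm_lt => // i k; rewrite (ord1 i) !mxE.
  have := step m _ _ _ vv vu k; rewrite !mxE => h; exact: (le_lt_trans h).
have /eG/= Gw := near_x _ vw; have /eG/= Gw' := near_x _ vw'.
have w0 : 0 <= G (pt m w).
  move: lw; rewrite /lab /G; case: eqP => [w0 _|_ /=].
    rewrite subr_ge0 mxE w0 mulr0 addr0; have := fr (pt m w) j.
    by rewrite ltr_norml => /andP[/ltW].
  by move/negbT; rewrite negb_or -ltNge => /andP[_ /ltW]; rewrite subr_ge0.
have w'0 : G (pt m w') <= 0.
  move: lw'; rewrite /lab /G => /andP[_ /orP[w'm|]]; last by rewrite subr_le0.
  have w'E : w' j = m.+1.
    by apply/eqP; rewrite eqn_leq w'm andbT; have /andP[_ /leq_trans->] := vw' j.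
  rewrite subr_le0 (ptm _ _ _ w'E).
  by have := fr (pt m w') j; rewrite ltr_norml => /andP[_ /ltW].
rewrite /= in Gw Gw'.
move: Gw Gw' w0 w'0 d0; rewrite /d; move: (G (pt m w)) (G (pt m w')) (G x) => a b c.
by rewrite !ltr_norml; have [c0|c0] := leP 0 c; rewrite ?(ger0_norm c0) ?(ltr0_norm c0);
  move=> /andP[? ?] /andP[? ?]; lra.
Unshelve. all: by end_near. Qed.

(** * Integrals and meshes in the plane *)

Section AnyNull.
Local Open Scope ereal_scope.
Context d (T : measurableType d) (R : realType) (mu : {measure set T -> \bar R}).
Import HBNNSimple.

(** No measurability of [f] is assumed: the integral is a supremum over simple functions below [f],
    and cutting such a function off [N] preserves its integral. Integrands may thus be arbitrary on
    mesh edges. *)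
Lemma ge0_integral_null (N : set T) (f : T -> \bar R) :
  measurable N -> mu N = 0 -> (forall x, 0 <= f x) ->
  \int[mu]_x f x = \int[mu]_x (f \_ (~` N)) x.
Proof.
move=> mN N0 f0.
have f0' x : 0 <= (f \_ (~` N)) x by rewrite patchE; case: ifP.
rewrite !ge0_integralTE//; apply/eqP; rewrite eq_le; apply/andP; split.
  apply: ge_ereal_sup => _ [h /= hf <-].
  pose h' := proj_nnsfun h (measurableC mN).
  have -> : sintegral mu h = sintegral mu h'.
    rewrite -integralT_nnsfun (@ge0_negligible_integral _ _ _ mu setT N)//; last 2 first.
    - by apply/measurable_EFinP; exact: measurable_funP.
    - by move=> x _; rewrite lee_fin.
    
    rewrite setTD integral_nnsfun; last exact: measurableC.
    apply: eq_sintegral => x.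
    by rewrite patchE /= mindicE; case: ifP => _; rewrite ?mulr1 ?mulr0.
  apply: ereal_sup_ubound; exists h' => // x /=.
  rewrite mindicE patchE; case: ifP => _; rewrite ?mulr1 ?mulr0//; exact: hf.
apply: ge_ereal_sup => _ [h /= hf <-].
apply: ereal_sup_ubound; exists h => //= x.
by apply: (le_trans (hf x)); rewrite patchE; case: ifP.
Qed.

Lemma integral_null (N : set T) (f : T -> \bar R) :
  measurable N -> mu N = 0 ->
  \int[mu]_x f x = \int[mu]_x (f \_ (~` N)) x.
Proof.
move=> mN N0; rewrite integralE [RHS]integralE.
rewrite (ge0_integral_null mN N0 (fun x => funepos_ge0 f x)).
rewrite (ge0_integral_null mN N0 (fun x => funeneg_ge0 f x)).
by rewrite funepos_restrict funeneg_restrict.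
Qed.

Lemma eq_integral_null (N D : set T) (f g : T -> \bar R) :
  measurable N -> mu N = 0 -> (forall x, D x -> ~ N x -> f x = g x) ->
  \int[mu]_(x in D) f x = \int[mu]_(x in D) g x.
Proof.
move=> mN N0 fg; rewrite integral_mkcond [RHS]integral_mkcond.
rewrite (integral_null _ mN N0) [RHS](integral_null _ mN N0).
apply: eq_integral => x _; rewrite !patchE; case: ifPn => // xN; case: ifPn => // xD.
by apply: fg; [rewrite inE in xD|rewrite inE in xN].
Qed.
End AnyNull.

(** * Measurable and null sets of the plane *)

Section Plane.
Variable R : realType.
Local Notation T2 := (measurableTypeR R * measurableTypeR R)%type.
Local Notation mu := (leb2 R).

(** An open set is the union of the countably many boxes, with rational centre and radius [1/(n+1)],
    that it contains; each box is a measurable rectangle of the product sigma-algebra. *)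
Lemma open_measurable2 (A : set (R * R)) : open A -> measurable (A : set T2).
Proof.
move=> oA.
pose box (q : rat * rat * nat) : set T2 :=
  ball (ratr q.1.1 : R) q.2.+1%:R^-1 `*` ball (ratr q.1.2 : R) q.2.+1%:R^-1.
pose F q : set T2 := if pselect (box q `<=` A) then box q else set0.
have -> : A = \bigcup_q F q :> set T2.
  apply/seteqP; split => [x Ax|x [q _]]; last first.
    by rewrite /F; case: pselect => /= [qA|_ []]; exact: qA.
  have /nbhs_ballP[e /= e0 eA] : nbhs (x : R * R) A by exact: open_nbhs_nbhs.
  have e20 : 0 < e / 2 by rewrite divr_gt0.
  have [n ne] : exists n : nat, n.+1%:R^-1 < e / 2.
    have [M _ H] := @near_infty_natSinv_lt R (PosNum e20).
    by exists M; apply: H => /=.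
  have n0 : 0 < n.+1%:R^-1 :> R by rewrite invr_gt0.
  have rat_near (y : R) : exists q : rat, ball y n.+1%:R^-1 (ratr q).
    have oB : open (ball y n.+1%:R^-1) by exact: ball_open.
    have [|z [yz [q _ qz]]] := dense_rat _ oB.
      by exists y; exact: ballxx.
    by exists q; rewrite qz.
  have [q1 h1] := rat_near x.1; have [q2 h2] := rat_near x.2.
  exists (q1, q2, n) => //; rewrite /F; case: pselect => /= [_|].
    by split; exact: ball_sym.
  case=> y [/= y1 y2]; apply: eA; split => /=.
    apply: (@le_ball _ _ _ (n.+1%:R^-1 + n.+1%:R^-1)); first by rewrite [e]splitr lerD// ltW.
    exact: ball_triangle h1 y1.
  apply: (@le_ball _ _ _ (n.+1%:R^-1 + n.+1%:R^-1)); first by rewrite [e]splitr lerD// ltW.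
  exact: ball_triangle h2 y2.
apply: countable_bigcupT_measurable; first exact: countableP.
move=> q; rewrite /F; case: pselect => /= _ //; apply: measurableX; exact: measurable_ball.
Qed.

Lemma closed_measurable2 (A : set (R * R)) : closed A -> measurable (A : set T2).
Proof. by move/closed_openC/open_measurable2/measurableC; rewrite setCK. Qed.

Lemma continuous_measurable2 (D : set (R * R)) (f : R * R -> R) :
  open D -> {in D, continuous f} -> measurable_fun (D : set T2) f.
Proof.
move=> oD cf mD; apply: (measurability _ (RGenOpens.measurableE R)) => //.
move=> _ [_ [a [b ->] <-]]; apply: open_measurable2.
rewrite openE => x [Dx /= fx]; apply: filterI; first exact: open_nbhs_nbhs.
apply: (cf x); first by rewrite inE.
by apply: open_nbhs_nbhs; split => //; exact: interval_open.
Qed.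

Lemma leb2X (A B : set (measurableTypeR R)) : measurable A -> measurable B ->
  mu (A `*` B) = (lebesgue_measure A * lebesgue_measure B)%E.
Proof. by move=> mA mB; exact: product_measure1E. Qed.

(** A vertical line is a product with a null factor. For any other line each section at fixed
    abscissa is a single point. *)
Lemma leb2_line (a : R * R) (b : R) : a != 0 ->
  closed [set x | dot a x + b = 0] /\ mu [set x | dot a x + b = 0] = 0%E.
Proof.
move=> a0; split.
  have c : continuous (fun x : R * R => dot a x + b).
    move=> x; apply: cvgD; last exact: cvg_cst.
    by apply: cvgD; apply: cvgM; (try exact: cvg_cst); [exact: cvg_fst|exact: cvg_snd].
  rewrite (_ : [set _ | _] = (fun x => dot a x + b) @^-1` [set 0])//.
  by apply: closed_comp; [move=> ? _; exact: c|exact: closed_eq].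
have [a2|a2] := eqVneq a.2 0.
  have a1 : a.1 != 0.
    by apply: contra_neq a0 => a1; rewrite [a]surjective_pairing a1 a2.
  rewrite (_ : [set x | _] = [set - b / a.1] `*` setT); last first.
    apply/seteqP; split => [x|x]; rewrite /dot /= a2 mul0r addr0.
      move=> e; split=> //=; apply: (mulfI a1); rewrite mulrCA divff// mulr1.
      by apply/eqP; rewrite -subr_eq0 opprK e.
    by move=> [-> _]; rewrite mulrCA divff// mulr1 addNr.
  by rewrite leb2X//= lebesgue_measure_set1 mul0e.
rewrite /leb2 /= /product_measure1; apply: integral0_eq => x _ /=.
rewrite (_ : xsection _ _ = [set - (a.1 * x + b) / a.2]) ?lebesgue_measure_set1//.
apply/seteqP; split => [y|y]; rewrite /xsection /= ?inE /dot /=.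
  move=> e; apply: (mulfI a2); rewrite mulrCA divff// mulr1.
  by apply/eqP; rewrite -subr_eq0 opprK; apply/eqP; rewrite -[RHS]e; ring.
by move=> ->; rewrite mulrCA divff// mulr1; ring.
Qed.

(** The ball is a square of side [2e], since the product carries the sup norm. *)
Lemma leb2_ball (x : R * R) (e : R) : 0 < e ->
  mu (ball x e) = (e *+ 2 * (e *+ 2))%:E.
Proof.
move=> e0; rewrite (_ : ball x e = ball x.1 e `*` ball x.2 e)//.
rewrite leb2X; [|exact: measurable_ball|exact: measurable_ball].
by rewrite !lebesgue_measure_ball ?ltW.
Qed.

Lemma leb2_open_gt0 (A : set (R * R)) : open A -> A !=set0 -> (0 < mu A)%E.
Proof.
move=> oA [x Ax].
have /nbhs_ballP[e /= e0 eA] : nbhs x A by exact: open_nbhs_nbhs.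
apply: (@lt_le_trans _ _ (mu (ball x e))).
  by rewrite leb2_ball// lte_fin mulr_gt0// mulrn_wgt0.
apply: le_measure => //; rewrite inE; apply: open_measurable2 => //.
exact: ball_open.
Qed.

Lemma leb2_bounded_lty (A : set (R * R)) :
  measurable (A : set T2) -> bounded_set A -> (mu A < +oo)%E.
Proof.
move=> mA [M [_ MA]].
have m0 : 0 < `|M| + 2 by rewrite ltr_wpDl.
apply: (@le_lt_trans _ _ (mu (ball 0 (`|M| + 2)))); last by rewrite leb2_ball// ltry.
apply: le_measure; rewrite ?inE//; first by apply: open_measurable2; exact: ball_open.
move=> x Ax; rewrite -ball_normE /ball_ /= sub0r normrN.
by apply: (@le_lt_trans _ _ (`|M| + 1)); [apply: MA => //; rewrite ltr_pwDr// ler_norm|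
  rewrite ltrD2l ltr1n].
Qed.

Lemma eq_nrm (N Omega : set (R * R)) p (f g : R * R -> R) :
  measurable (N : set T2) -> mu N = 0%E -> (forall x, Omega x -> ~ N x -> `|f x| = `|g x|) ->
  nrm Omega p f = nrm Omega p g.
Proof.
move=> mN N0 fg; rewrite /nrm Lnorm.unlock; apply: (congr1 (fun t => t `^ p^-1)%E).
apply: (eq_integral_null mN N0) => x _ Nx /=.
by rewrite !patchE; case: ifPn => //; rewrite inE => Ox; rewrite fg.
Qed.

Lemma nrm_setD (N Omega : set (R * R)) p (f : R * R -> R) : p != 0 ->
  measurable (N : set T2) -> mu N = 0%E -> nrm Omega p f = nrm (Omega `\` N) p f.
Proof.
move=> p0 mN N0; rewrite /nrm Lnorm.unlock; apply: (congr1 (fun t => t `^ p^-1)%E).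
apply: (eq_integral_null mN N0) => x _ Nx /=; rewrite !patchE in_setD.
by rewrite (_ : x \notin N) ?andbT//; apply/negP; rewrite inE.
Qed.
End Plane.

(** * Affine functions and their classical gradients *)

Section Affine.
Variable R : realType.
Implicit Types (a x v : R * R) (b : R).

Lemma dotC x a : dot x a = dot a x.
Proof. by rewrite /dot mulrC [X in _ + X]mulrC. Qed.

Lemma dotDl x a v : dot (x + a) v = dot x v + dot a v.
Proof. by rewrite /dot /=; ring. Qed.

Lemma dotZl (k : R) a v : dot (k *: a) v = k * dot a v.
Proof. by rewrite /dot /= -![_ *: _]/(_ * _); ring. Qed.

Lemma dotDr x a v : dot v (x + a) = dot v x + dot v a.
Proof. by rewrite /dot /=; ring. Qed.

Lemma dotZr (k : R) a v : dot v (k *: a) = k * dot v a.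
Proof. by rewrite /dot /= -![_ *: _]/(_ * _); ring. Qed.

Lemma continuous_dot a : continuous (dot a).
Proof.
move=> x; apply: cvgD; apply: cvgM; (try exact: cvg_cst); [exact: cvg_fst|exact: cvg_snd].
Qed.

Lemma continuous_aff a b : continuous (fun x => dot a x + b).
Proof. by move=> x; apply: cvgD; [exact: continuous_dot|exact: cvg_cst]. Qed.

Lemma differentiable_aff a b x : differentiable (fun y => dot a y + b) x.
Proof.
have lin : linear (dot a : R * R -> R) by move=> k y z; rewrite dotDr dotZr.
pose dM := GRing.isLinear.Build _ _ _ _ _ lin.
pose dL : {linear _ -> _} := HB.pack (dot a : R * R -> R) dM.
apply: differentiableD => //.
by have := @linear_differentiable _ _ _ dL x; apply; exact: continuous_dot.
Qed.

Lemma is_derive_aff a b x v : is_derive x v (fun y => dot a y + b) (dot a v).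
Proof.
have cv : (fun h : R => h^-1 *: (((fun y => dot a y + b) \o shift x) (h *: v) -
    (dot a x + b))) @ 0^' --> (dot a v : R).
  apply: (@cvg_trans _ ((fun=> dot a v : R) @ 0^')); last exact: cvg_cst.
  apply: near_eq_cvg; near=> h => /=.
  have h0 : h != 0 by near: h; exact: nbhs_dnbhs_neq.
  rewrite dotDr dotZr (_ : _ - _ = h * dot a v); last by ring.
  by rewrite scalerA mulVf// scale1r.
by split; [apply/cvg_ex; exists (dot a v : R)|exact/cvg_lim].
Unshelve. all: by end_near. Qed.

Lemma pd_near_aff (f : R * R -> R) a b x i :
  (\forall y \near x, f y = dot a y + b) -> pd i f x = if i then a.2 else a.1.
Proof.
move=> fE; rewrite /pd (near_eq_derive _ fE).
have -> := @derive_val _ _ _ _ _ _ _ (is_derive_aff a b x _).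
by case: i; rewrite /dot /= ?mulr0 ?mulr1 ?add0r ?addr0.
Qed.

Lemma grad_near_aff (f : R * R -> R) a b x :
  (\forall y \near x, f y = dot a y + b) -> grad f x = a.
Proof. by move=> fE; rewrite /grad !(pd_near_aff _ fE) -surjective_pairing. Qed.

End Affine.

(** * Barycentric coordinates and the interior of a mesh *)

Section Triangle.
Variable R : realType.
Implicit Types (K : {ffun 'I_3 -> R * R}) (T : seq {ffun 'I_3 -> R * R}).

Lemma sum_ord3 (V : zmodType) (F : 'I_3 -> V) :
  \sum_i F i = F ord0 + F (inord 1) + F (inord 2).
Proof.
rewrite !big_ord_recl big_ord0 addr0 addrA; congr (_ + F _ + F _); apply: val_inj => /=;
by rewrite inordK.
Qed.

Lemma ord3_cases (P : 'I_3 -> Prop) : P ord0 -> P (inord 1) -> P (inord 2) -> forall i, P i.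
Proof.
move=> P0 P1 P2 [[|[|[|//]]] i].
- by rewrite (_ : Ordinal i = ord0)//; apply: val_inj.
- by rewrite (_ : Ordinal i = inord 1)//; apply: val_inj; rewrite /= inordK.
- by rewrite (_ : Ordinal i = inord 2)//; apply: val_inj; rewrite /= inordK.
Qed.

Lemma ord3_neqs : ((inord 2 == inord 1 :> 'I_3) = false) *
  ((ord0 == inord 1 :> 'I_3) = false) * ((ord0 == inord 2 :> 'I_3) = false).
Proof. by rewrite -!val_eqE /= !inordK. Qed.

(* The barycentric coordinate of index i is [dot g.1 x + g.2] with [g = bary K i] (Cramer). *)
Definition bary K (i : 'I_3) : (R * R) * R :=
  let a := K (inord 1) - K ord0 in
  let b := K (inord 2) - K ord0 in
  let D := a.1 * b.2 - a.2 * b.1 in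
  let g1 := (b.2 / D, - b.1 / D) : R * R in
  let g2 := (- a.2 / D, a.1 / D) : R * R in
  let c1 := - dot g1 (K ord0) in
  let c2 := - dot g2 (K ord0) in
  if i == inord 1 then (g1, c1) else if i == inord 2 then (g2, c2)
  else (- g1 - g2, 1 - c1 - c2).

Lemma baryE K (l : 'I_3 -> R) i : Defs.nondegenerate K -> \sum_i l i = 1 ->
  dot (bary K i).1 (\sum_i l i *: K i) + (bary K i).2 = l i.
Proof.
rewrite /Defs.nondegenerate !sum_ord3 /bary.
move: (K ord0) (K (inord 1)) (K (inord 2)) => k0 k1 k2.
set D := (X in X != 0) => D0 l1.
have l0 : l ord0 = 1 - l (inord 1) - l (inord 2) by rewrite -l1; ring.
move: i; apply: ord3_cases; rewrite ?ord3_neqs ?eqxx /dot /= l0; rewrite -/D.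
- by move: D0; rewrite /D /= -![_ *: _]/(_ * _) => D0; field.
- by move: D0; rewrite /D /= -![_ *: _]/(_ * _) => D0; field.
- by move: D0; rewrite /D /= -![_ *: _]/(_ * _) => D0; field.
Qed.

Lemma bary_sum K x : Defs.nondegenerate K ->
  \sum_i (dot (bary K i).1 x + (bary K i).2) = 1 /\
  \sum_i (dot (bary K i).1 x + (bary K i).2) *: K i = x.
Proof.
rewrite /Defs.nondegenerate !sum_ord3 /bary.
move: (K ord0) (K (inord 1)) (K (inord 2)) => k0 k1 k2.
set D := (X in X != 0) => D0.
rewrite ?ord3_neqs ?eqxx /dot /= -/D; split; first by move: D0; rewrite /D /= => D0; field.
by rewrite [RHS]surjective_pairing; congr pair; move: D0; rewrite /D /= -![_ *: _]/(_ * _) => D0; field.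
Qed.

Lemma bary_neq0 K i : Defs.nondegenerate K -> (bary K i).1 != 0.
Proof.
move=> nK; apply/eqP => e.
have H (j : 'I_3) : (bary K i).2 = (i == j)%:R.
  have := @baryE K (fun k => (k == j)%:R) i nK.
  rewrite e (bigD1 j)//= eqxx big1 ?addr0 => [|k /negbTE->//].
  by move=> /(_ erefl) <-; rewrite /dot !mul0r !add0r.
have [j ij] : exists j, i != j.
  by have [->|i0] := eqVneq i ord0; [exists (inord 1); rewrite -val_eqE /= inordK|exists ord0].
by have := H i; rewrite (H j) eqxx (negbTE ij) => /eqP; rewrite eq_sym oner_eq0.
Qed.

(** A point with three positive barycentric coordinates is interior, as these are continuous. The
    other points of the triangle lie on one of the three lines where a coordinate vanishes. *)
Lemma tri_boundary_null K : Defs.nondegenerate K ->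
  exists N : set (R * R), [/\ measurable (N : set (measurableTypeR R * measurableTypeR R)),
    leb2 R N = 0%E & tri K `\` interior (tri K) `<=` N].
Proof.
move=> nK.
pose L i : set (R * R) := [set x | dot (bary K i).1 x + (bary K i).2 = 0].
have LP i : closed (L i) /\ leb2 R (L i) = 0%E by apply: leb2_line; exact: bary_neq0.
have mL i : measurable (L i : set (measurableTypeR R * measurableTypeR R)).
  by apply: closed_measurable2; case: (LP i).
exists (L ord0 `|` L (inord 1) `|` L (inord 2)); split.
- by do !apply: measurableU.
- have L0 i : leb2 R (L i) = 0%E by case: (LP i).
  have m01 := measurableU _ _ (mL ord0) (mL (inord 1)).
  by rewrite null_set_setU ?null_set_setU.
move=> x [[l [l0 _ l1 xE]] nint].
have xb i : dot (bary K i).1 x + (bary K i).2 = l i by rewrite xE baryE.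
have [i li] : exists i, l i = 0.
  apply: contrapT => /forallNP ln0; apply: nint.
  have lp i : 0 < dot (bary K i).1 x + (bary K i).2.
    by rewrite xb lt_neqAle l0 andbT eq_sym; apply/eqP; exact: ln0.
  have near1 i : \forall y \near x, 0 < dot (bary K i).1 y + (bary K i).2.
    by have /cvgr_gt := @continuous_aff _ (bary K i).1 (bary K i).2 x; apply.
  have : \forall y \near x, forall i, 0 < dot (bary K i).1 y + (bary K i).2.
    exact: filter_forall near1.
  rewrite /interior /=; apply: filterS => y yp.
  exists (fun i => dot (bary K i).1 y + (bary K i).2); have [s1 s2] := bary_sum y nK.
  by split => // [i|i]; [exact: ltW|rewrite inE].
have : L i x by rewrite /L /= xb.
by move: i {li}; apply: ord3_cases => ?; [left; left|left; right|right].
Qed.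

(** The working set of the discrete analysis: open, of full measure in [Omega], and such that a
    function affine on each open triangle is affine near each of its points, where classical
    derivatives are therefore the elementwise ones. *)
Definition mesh_interior (Omega : set (R * R)) T : set (R * R) :=
  Omega `&` [set x | exists2 K, K \in T & interior (tri K) x].

Lemma open_mesh_interior Omega T : open Omega -> open (mesh_interior Omega T).
Proof.
move=> oO; apply: openI => //.
rewrite (_ : mkset _ = \bigcup_(K in [set` T]) interior (tri K)).
  by apply: bigcup_open => K _; exact: open_interior.
by apply/seteqP; split => x [K KT Kx]; exists K.
Qed.

Lemma mesh_null Omega T : open Omega -> conforming_mesh Omega T ->
  measurable (Omega `\` mesh_interior Omega T : set (measurableTypeR R * measurableTypeR R)) /\
  leb2 R (Omega `\` mesh_interior Omega T) = 0%E.
Proof.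
move=> oO [nT cT _].
have mN : measurable (Omega `\` mesh_interior Omega T : set (measurableTypeR R * measurableTypeR R)).
  by apply: measurableD; apply: open_measurable2 => //; exact: open_mesh_interior.
split=> //.
have [N [mN' N0 sN]] : exists N : set (R * R),
   [/\ measurable (N : set (measurableTypeR R * measurableTypeR R)), leb2 R N = 0%E &
    forall K, K \in T -> tri K `\` interior (tri K) `<=` N].
  elim: T nT {cT mN} => [|K T IH] nT; first by exists set0; split => //; rewrite measure0.
  have [|N1 [mN1 N10 sN1]] := IH; first by move=> K' K'T; apply: nT; rewrite inE K'T orbT.
  have [|N2 [mN2 N20 sN2]] := @tri_boundary_null K; first by apply: nT; rewrite inE eqxx.
  exists (N1 `|` N2); split; [exact: measurableU|by rewrite null_set_setU|].
  move=> K'; rewrite inE => /predU1P[->|K'T] x Kx; first by right; exact: sN2.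
  by left; exact: sN1 Kx.
apply: (subset_measure0 mN mN' _ N0) => x [Ox nx].
have : closure Omega x by exact: subset_closure.
rewrite cT => -[K KT Kx]; apply: (sN _ KT); split => // iK.
by apply: nx; split => //; exists K.
Qed.
End Triangle.

(** * Smooth approximation of piecewise affine functions *)

Section FlatExp.
Variable R : realType.
Implicit Types (e t s : R) (q : {poly R}).

(* The family [e^(-e/t) q(1/t)] on [t > 0], extended by 0, is stable under derivation. *)
Definition flat e q t : R := if 0 < t then q.[t^-1] * expR (- e * t^-1) else 0.

(** With [s = 1/t], the derivative in [t] of [q(s) exp(-e s)] is
    [s^2 (e q(s) - q'(s)) exp(-e s)]. *)
Definition dflat e q : {poly R} := 'X^2 * (e *: q - q^`()).

(** Induction on the polynomial with the exponent split in two: one half absorbs [q], the other the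
    additional factor [s]. *)
Lemma poly_le_expR q e : 0 < e -> exists2 C, 0 <= C & forall s, 0 < s -> `|q.[s]| <= C * expR (e * s).
Proof.
elim/poly_ind: q e => [|q c IH] e e0; first by exists 0 => // s _; rewrite horner0 normr0 mul0r.
have e20 : 0 < e / 2 by rewrite divr_gt0.
have [C C0 HC] := IH _ e20.
exists (C * (2 / e) + `|c|); first by rewrite addr_ge0// mulr_ge0// divr_ge0// ltW.
move=> s s0; rewrite hornerMXaddC (le_trans (ler_normD _ _))// mulrDl lerD//.
  have eE : expR (e * s) = expR (e / 2 * s) * expR (e / 2 * s).
    by rewrite -expRD -mulrDl -splitr.
  have -> : C * (2 / e) * expR (e * s) =
    (C * expR (e / 2 * s)) * (2 / e * expR (e / 2 * s)) by rewrite eE; ring.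
  rewrite normrM (gtr0_norm s0).
  apply: ler_pM => //; [exact: ltW|exact: HC|].
  rewrite mulrC -ler_pdivrMr ?divr_gt0// invf_div.
  by have := expR_ge1Dx (e / 2 * s); lra.
by rewrite ler_peMr// -expR0 ler_expR mulr_ge0// ltW.
Qed.

(** An additional factor [1/t] is still absorbed by the exponential. Applied to [q * 'X], this
    bounds the difference quotient of [flat e q] at 0 by a multiple of the increment. *)
Lemma flat_small q e : 0 < e -> exists2 C, 0 <= C & forall t, `|flat e q t| <= C * `|t|.
Proof.
move=> e0; have [C C0 HC] := poly_le_expR (q * 'X) e0.
exists C => // t; rewrite /flat; case: ifPn => t0; last by rewrite normr0 mulr_ge0.
have ti : 0 < t^-1 by rewrite invr_gt0.
have := HC _ ti; rewrite hornerMX !normrM (gtr0_norm ti) (gtr0_norm t0) => H.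
rewrite (gtr0_norm (expR_gt0 _)) mulNr expRN ler_pdivrMr ?expR_gt0//.
by rewrite mulrAC -ler_pdivrMr.
Qed.

Lemma is_derive_flat e q t : 0 < e -> is_derive t 1 (flat e q) (flat e (dflat e q) t).
Proof.
move=> e0; have [t0|t0|t0] := ltgtP t 0.
- rewrite {2}/flat ltNge (ltW t0) /=.
  apply: (@near_eq_is_derive _ _ _ (cst 0)).
  near=> y; rewrite /flat ifN// -leNgt; apply: ltW; near: y.
  exact: lt_nbhsl.
- pose g y : R := q.[y^-1] * expR (- e * y^-1).
  apply: (@near_eq_is_derive _ _ _ g).
    near=> y; rewrite /flat ifT//; near: y; exact: lt_nbhsr.
  have tn0 : t != 0 by rewrite gt_eqF.
  have d1 : is_derive t 1 (fun y : R => y^-1) (- t ^- 2).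
    by apply: (is_derive_eq (is_deriveV tn0 (is_derive_id _ _))); rewrite -[_ *: _]/(_ * _) mulr1.
  have d2 : is_derive t 1 (fun y => q.[y^-1]) (q^`().[t^-1] * - t ^- 2).
    exact: (@is_derive1_comp _ (horner q) (fun y => y^-1) _ _ _ (is_derive_poly q t^-1) d1).
  have d3 : is_derive t 1 (fun y => - e * y^-1) (- e * - t ^- 2).
    by apply: is_derive_eq; rewrite -[_ *: _]/(_ * _).
  have d4 : is_derive t 1 (fun y => expR (- e * y^-1)) (expR (- e * t^-1) * (- e * - t ^- 2)).
    exact: (@is_derive1_comp _ expR (fun y => - e * y^-1) _ _ _ (is_derive_expR _) d3).
  apply: is_derive_eq; rewrite -![_ *: _]/(_ * _) /flat t0 /dflat.
  by rewrite hornerM hornerXn hornerD hornerN hornerZ exprVn; ring.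
- rewrite t0 {2}/flat ltxx; have [C C0 HC] := flat_small (q * 'X) e0.
  have cv : (fun h : R => h^-1 *: ((flat e q \o shift 0) (h *: 1) - flat e q 0)) @ 0^' --> (0 : R).
    have flat0 : flat e q 0 = 0 by rewrite /flat ltxx.
    apply: (@cvg_trans _ (flat e (q * 'X) @ 0^')).
      apply: near_eq_cvg; near=> h.
      rewrite /= flat0 subr0 addr0 -![_ *: _]/(_ * _) mulr1 /flat; case: ifP; rewrite ?mulr0//.
      by rewrite hornerMX => _; ring.
    apply/cvgr0Pnorm_le => d d0; near=> h.
    apply: (le_trans (HC h)).
    apply: (@le_trans _ _ ((C + 1) * `|h|)); first by rewrite ler_wpM2r// lerDl.
    rewrite mulrC -ler_pdivlMr ?ltr_wpDl//; near: h.
    apply: nbhs_dnbhs; apply/nbhs_ballP; exists (d / (C + 1)) => /=.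
      by rewrite divr_gt0// ltr_wpDl.
    by move=> y; rewrite -ball_normE /= sub0r normrN => /ltW.
  by split; [apply/cvg_ex; exists (0 : R)|exact/cvg_lim].
Unshelve. all: by end_near. Qed.

Definition ppos e t := t * flat e 1 t.

Definition dppos e t := if 0 < t then (1 + e / t) * expR (- e / t) else 0.

Lemma ppos_le0 e t : t <= 0 -> ppos e t = 0.
Proof. by move=> t0; rewrite /ppos /flat ltNge t0 mulr0. Qed.

Lemma ppos_dist e t : 0 < e -> `|ppos e t - Num.max t 0| <= e.
Proof.
move=> e0; have [t0|t0] := leP t 0; first by rewrite ppos_le0// subr0 normr0 ltW.
rewrite /ppos /flat t0 hornerC mul1r -[X in _ - X]mulr1 -mulrBr normrM (gtr0_norm t0).
have ed : 0 < e / t by rewrite divr_gt0.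
rewrite mulNr ler0_norm ?subr_le0 -?expR0 ?ler_expR ?oppr_le0 ?(ltW ed)// opprB expR0.
rewrite [t * _]mulrC -ler_pdivlMr//; have := expR_ge1Dx (- (e / t)); lra.
Qed.

Lemma dppos_ge0 e t : 0 < e -> 0 <= dppos e t.
Proof.
move=> e0; rewrite /dppos; case: ifP => // t0.
by rewrite mulr_ge0 ?expR_ge0// addr_ge0// ltW// divr_gt0.
Qed.

(** This is [1 + s <= exp s] at [s = e / t]. The bound is uniform in [e], so regularising a positive
    part never increases gradients. *)
Lemma dppos_le1 e t : 0 < e -> dppos e t <= 1.
Proof.
move=> e0; rewrite /dppos; case: ifP => // t0.
by rewrite mulNr expRN ler_pdivrMr ?expR_gt0// mul1r expR_ge1Dx.
Qed.

Lemma is_derive_ppos e t : 0 < e -> is_derive t 1 (ppos e) (dppos e t).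
Proof.
move=> e0; have d1 := is_derive_flat 1 t e0.
have -> : dppos e t = t *: flat e (dflat e 1) t + flat e 1 t *: (1 : R).
  rewrite -![_ *: _]/(_ * _) /dppos /flat /dflat; case: ifP => t0; last by rewrite !(mulr0, mul0r, addr0).
  rewrite derivC subr0 hornerM hornerXn hornerZ hornerC; field.
  by rewrite gt_eqF.
exact: (@is_deriveM _ _ id (flat e 1) t 1 1 _ (is_derive_id _ _) d1).
Qed.

(** The limit [t = 0] is excluded: there the value depends on how [ee n / tt n] behaves. Points
    where two pieces meet are treated separately for this reason. *)
Lemma cvg_dppos (ee : nat -> R) (tt : nat -> R) t : (forall n, 0 < ee n) ->
  ee n @[n --> \oo] --> (0 : R) -> tt n @[n --> \oo] --> t -> t != 0 ->
  dppos (ee n) (tt n) @[n --> \oo] --> ((0 < t)%R%:R : R).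
Proof.
move=> e0 ce ct tn0; have [t0|t0|e] := ltgtP t 0; last by rewrite e eqxx in tn0.
  apply: (@cvg_trans _ ((fun=> 0 : R) @ \oo)); last by apply: cvg_cst.
  apply: near_eq_cvg; have /cvgr_lt/(_ _ t0) := ct; apply: filterS => n tn.
  by rewrite /dppos ltNge (ltW tn).
apply: (@cvg_trans _ ((fun n => (1 + ee n / tt n) * expR (- (ee n / tt n))) @ \oo)).
  apply: near_eq_cvg; have /cvgr_gt/(_ _ t0) := ct; apply: filterS => n tn.
  by rewrite /dppos tn mulNr.
have cu : ee n / tt n @[n --> \oo] --> (0 : R).
  by rewrite -(mul0r t^-1); apply: cvgM => //; apply: cvgV.
have <- : (1 + 0) * expR (- 0) = true%:R :> R by rewrite oppr0 expR0 addr0 mulr1.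
apply: cvgM; first by apply: cvgD => //; exact: cvg_cst.
apply: continuous_cvg; first exact: continuous_expR.
exact: cvgN.
Qed.

(* A class stable under partial derivatives, so that [smooth] follows by induction. *)
Inductive smooth_expr : (R * R -> R) -> Prop :=
| smooth_aff a b : smooth_expr (fun x => dot a x + b)
| smooth_add f g : smooth_expr f -> smooth_expr g -> smooth_expr (fun x => f x + g x)
| smooth_mul f g : smooth_expr f -> smooth_expr g -> smooth_expr (fun x => f x * g x)
| smooth_flat e q f : 0 < e -> smooth_expr f -> smooth_expr (fun x => flat e q (f x)).

Lemma differentiable_comp1 (f : R * R -> R) (g : R -> R) dg x :
  differentiable f x -> is_derive (f x) 1 g dg -> differentiable (fun y => g (f y)) x.
Proof.
move=> df [dg1 _]; apply: (@differentiable_comp _ _ _ _ f g) => //.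
exact/derivable1_diffP.
Qed.

Lemma pd_comp (f : R * R -> R) (g : R -> R) dg x i :
  differentiable f x -> is_derive (f x) 1 g dg -> pd i (fun y => g (f y)) x = dg * pd i f x.
Proof.
move=> df [dg1 dgE]; have dfg : differentiable g (f x) by exact/derivable1_diffP.
rewrite /pd deriveE; last exact: (@differentiable_comp _ _ _ _ f g).
rewrite (@diff_comp _ _ _ _ f g)//= diff1E// deriveE// -[_ *: _]/(_ * _) mulrC.
by rewrite derive1E dgE.
Qed.

Lemma smooth_expr_diff f : smooth_expr f -> forall x, differentiable f x.
Proof.
elim=> {f} [a b x|f g _ df _ dg x|f g _ df _ dg x|e q f e0 _ df x].
- exact: differentiable_aff.
- exact: differentiableD.
- exact: differentiableM.
- exact: (differentiable_comp1 (df x) (is_derive_flat q _ e0)).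
Qed.

Implicit Types (f g : R * R -> R) (x : R * R).

Lemma pdD f g x i : differentiable f x -> differentiable g x ->
  pd i (fun y => f y + g y) x = pd i f x + pd i g x.
Proof. by move=> df dg; rewrite /pd deriveD//; exact: diff_derivable. Qed.

Lemma pdM f g x i : differentiable f x -> differentiable g x ->
  pd i (fun y => f y * g y) x = f x * pd i g x + g x * pd i f x.
Proof. by move=> df dg; rewrite /pd deriveM//; exact: diff_derivable. Qed.

Lemma smooth_expr_pd f i : smooth_expr f -> smooth_expr (pd i f).
Proof.
elim=> {f} [a b|f g sf IHf sg IHg|f g sf IHf sg IHg|e q f e0 sf IH].
- have -> : pd i (fun x => dot a x + b) = fun x => dot 0 x + if i then a.2 else a.1.
    apply/funext => x; rewrite (@pd_near_aff _ _ a b)//; last by near=> y.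
    by rewrite /dot !mul0r !add0r.
  exact: smooth_aff.
- have -> : pd i (fun x => f x + g x) = fun x => pd i f x + pd i g x.
    by apply/funext => x; apply: pdD; exact: smooth_expr_diff.
  exact: smooth_add.
- have -> : pd i (fun x => f x * g x) = fun x => f x * pd i g x + g x * pd i f x.
    by apply/funext => x; apply: pdM; exact: smooth_expr_diff.
  by apply: smooth_add; apply: smooth_mul.
- have -> : pd i (fun x => flat e q (f x)) = fun x => flat e (dflat e q) (f x) * pd i f x.
    apply/funext => x; apply: pd_comp; [exact: smooth_expr_diff|exact: is_derive_flat].
  by apply: smooth_mul => //; apply: smooth_flat.
Unshelve. all: by end_near. Qed.

Lemma smooth_exprP f : smooth_expr f -> smooth f.
Proof.
move=> sf s x; apply: smooth_expr_diff.
by elim: s => //= i s; exact: smooth_expr_pd.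
Qed.

Lemma smooth_ppos e f : 0 < e -> smooth_expr f -> smooth_expr (fun x => ppos e (f x)).
Proof. by move=> e0 sf; apply: smooth_mul => //; apply: smooth_flat. Qed.

Lemma grad_ppos e f x : 0 < e -> smooth_expr f ->
  grad (fun y => ppos e (f y)) x = dppos e (f x) *: grad f x.
Proof.
by move=> e0 sf; rewrite /grad !(pd_comp _ (smooth_expr_diff sf x) (is_derive_ppos _ e0)).
Qed.

Lemma smooth_expr_continuous f : smooth_expr f -> continuous f.
Proof. by move=> sf x; apply: differentiable_continuous; exact: smooth_expr_diff. Qed.

Lemma gradD f g x : smooth_expr f -> smooth_expr g ->
  grad (fun y => f y + g y) x = grad f x + grad g x.
Proof. by move=> sf sg; rewrite /grad !pdD//; exact: smooth_expr_diff. Qed.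

Lemma smooth_cst c : smooth_expr (fun=> c).
Proof.
rewrite (_ : (fun=> c) = fun x => dot 0 x + c); first exact: smooth_aff.
by apply/funext => x; rewrite /dot !mul0r !add0r.
Qed.

Lemma smooth_opp f : smooth_expr f -> smooth_expr (fun x => - f x).
Proof.
move=> sf; rewrite (_ : (fun x => - f x) = (fun x => - 1 * f x)).
  by apply: smooth_mul => //; exact: smooth_cst.
by apply/funext => x; rewrite mulN1r.
Qed.

Lemma gradN f x : smooth_expr f -> grad (fun y => - f y) x = - grad f x.
Proof.
move=> sf; rewrite /grad /pd.
by rewrite !(@deriveN _ _ _ f)//; apply: diff_derivable; exact: smooth_expr_diff.
Qed.

End FlatExp.

(** * Choosing an affine piece along a segment *)

Section Crossing.
Variable R : realType.

Definition aff (l : (R * R) * R) (x : R * R) : R := dot l.1 x + l.2.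

Lemma near_seq (I : eqType) (T : Type) (F : set_system T) (FF : Filter F) (s : seq I)
    (P : I -> T -> Prop) :
  (forall i, i \in s -> \forall t \near F, P i t) ->
  \forall t \near F, forall i, i \in s -> P i t.
Proof.
elim: s => [|i s IH] H; first exact: nearW.
have := IH (fun j js => H j (mem_behead (s := i :: s) js)).
have := H i (mem_head i s); apply: filterS2 => t Pi Ps j.
by rewrite inE => /predU1P[->//|/Ps].
Qed.

Lemma sup_closed_mem (S : set R) (b : R) :
  S !=set0 -> ubound S b -> closed S -> S (sup S).
Proof.
move=> S0 Sb cS; apply: cS; apply: closure_sup => //; by exists b.
Qed.

(* Last parameter [t] at which the path lies above the line [c t]: the piece active
   just after [t] then starts above 0 as well. *)
Lemma crossing1 (I : eqType) (s : seq I) (u v : I -> R) (g : R -> R) :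
  (forall t, 0 <= t <= 1 -> exists2 i, i \in s & g t = (1 - t) * u i + t * v i) ->
  continuous g -> g 0 = 0 -> g 1 = 0 ->
  exists2 i, i \in s & 0 <= u i /\ v i <= 0.
Proof.
move=> gs cg g0 g1; apply: contrapT => N.
have vpos i : i \in s -> 0 <= u i -> 0 < v i.
  move=> si ui; rewrite ltNge; apply/negP => vi; apply: N; by exists i.
(* The least final value among the pieces that start at or above 0, positive by the contradiction
   hypothesis. All these pieces stay above the line of slope [c]. *)
pose c : R := \big[Order.min/1]_(i <- s | 0 <= u i) v i.
have c0 : 0 < c.
  rewrite /c; move: (s) vpos; elim=> [|i r IH] vpos; first by rewrite big_nil.
  have {}IH : 0 < \big[Order.min/1]_(j <- r | 0 <= u j) v j.
    by apply: IH => j js; apply: vpos; rewrite inE js orbT.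
  by rewrite big_cons; case: ifP => // ui; rewrite lt_min IH vpos// inE eqxx.
have cv i : i \in s -> 0 <= u i -> c <= v i.
  move=> si ui; rewrite /c; move: (s) si; elim=> // j r IH.
  rewrite inE big_cons => /predU1P[<-|/IH h]; first by rewrite ui ge_min lexx.
  by case: ifP => // _; rewrite ge_min h orbT.
pose S : set R := [set t | 0 <= t <= 1 /\ c * t <= g t].
have S0 : S 0 by split; rewrite ?lexx ?ler01// mulr0 g0.
have clS : closed S.
  have -> : S = `[0, 1]%classic `&` [set t | 0 <= g t - c * t].
    by apply/seteqP; split=> t; rewrite /S /= in_itv /= subr_ge0.
  apply: closedI; first exact: interval_closed.
  rewrite (_ : mkset _ = (fun t => g t - c * t) @^-1` [set x | 0 <= x])//.
  apply: closed_comp => [t _|]; last exact: closed_ge.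
  by apply: cvgB; [exact: cg|apply: cvgM; [exact: cvg_cst|exact: cvg_id]].
have Sub : ubound S 1 by move=> t [/andP[]].
have [/andP[t0 t1] gt] : S (sup S) by apply: sup_closed_mem Sub clS; exists 0.
set t := sup S in t0 t1 gt *.
have {}t1 : t < 1.
  rewrite lt_neqAle t1 andbT; apply/eqP => e; move: gt; rewrite e g1 mulr1 leNgt c0//.
have after y : t < y -> y <= 1 -> g y < c * y.
  move=> ty y1; rewrite ltNge; apply/negP => gy.
  have : y <= t by apply: ub_le_sup; [exists 1|split=> //; rewrite y1 (le_trans t0)// ltW].
  by rewrite leNgt ty.
(* Just after the last parameter [t], the path is strictly below the line of slope [c] and no piece
   can represent it. Pieces starting at or above 0 stay above the line. A piece starting below 0
   that meets the path at [t] is at least as high as the line there, hence steeper, and remains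
   above it afterwards. Any other piece misses [g t] and stays away by continuity. *)
have key i : i \in s -> \forall y \near t^'+, g y != (1 - y) * u i + y * v i.
  move=> si; have [ui|ui] := leP 0 (u i).
    near=> y; rewrite lt_eqF//.
    have ty : t < y by near: y; exact: nbhs_right_gt.
    have y1 : y <= 1 by near: y; exact: nbhs_right_le.
    apply: (lt_le_trans (after y ty y1)).
    rewrite -[leLHS]add0r lerD//; first by rewrite mulr_ge0// subr_ge0.
    by rewrite mulrC ler_wpM2l ?cv// (le_trans t0)// ltW.
  have [e|e] := eqVneq (g t) ((1 - t) * u i + t * v i).
    near=> y; rewrite lt_eqF//.
    have ty : t < y by near: y; exact: nbhs_right_gt.
    have y1 : y <= 1 by near: y; exact: nbhs_right_le.
    apply: (lt_le_trans (after y ty y1)).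
    have tp : 0 < t.
      rewrite lt_neqAle t0 andbT; apply/eqP => t00; move: e; rewrite -t00 g0 subr0 mul1r mul0r addr0.
      by move=> e; rewrite -e ltxx in ui.
    move: gt; rewrite e => h.
    have h2 : t * (c * y) <= t * ((1 - y) * u i + y * v i) by nra.
    by rewrite ler_pM2l in h2.
  have cc : {for t, continuous (fun y => g y - ((1 - y) * u i + y * v i))}.
    apply: cvgB; first exact: cg.
    by apply: cvgD; apply: cvgM; (try exact: cvg_cst); (try exact: cvg_id); apply: cvgB;
       [exact: cvg_cst|exact: cvg_id].
  have : \forall y \near t, g y - ((1 - y) * u i + y * v i) != 0.
    by apply: (cvgr_neq0 _ cc); rewrite subr_eq0.
  by move=> H; apply: cvg_within; apply: filterS H => z; rewrite subr_eq0.
have [y [ty y1 yk]] : exists y, [/\ t < y, y <= 1 & forall i, i \in s -> g y != (1 - y) * u i + y * v i].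
  have H := near_seq _ key.
  near t^'+ => y; exists y; split.
  - by near: y; exact: nbhs_right_gt.
  - by near: y; exact: nbhs_right_le.
  - by near: y; exact: H.
have [|i si /eqP] := gs y; first by rewrite y1 andbT (le_trans t0)// ltW.
by apply/negP; exact: yk.
Unshelve. all: by end_near. Qed.

(** [crossing1] applied to [f] along the segment from [y] to [x], minus the chord joining its end
    values. *)
Lemma crossing (s : seq ((R * R) * R)) (f : R * R -> R) :
  continuous f -> (forall x, exists2 l, l \in s & f x = aff l x) ->
  forall x y, exists2 l, l \in s & f y <= aff l y /\ aff l x <= f x.
Proof.
move=> cf fs x y.
pose p (t : R) : R * R := y + t *: (x - y).
pose g t := f (p t) - (f y + t * (f x - f y)).
have p0 : p 0 = y by rewrite /p scale0r addr0.
have p1 : p 1 = x by rewrite /p scale1r addrCA subrr addr0.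
have [||||l ls [l1 l2]] := @crossing1 _ s (fun l => aff l y - f y) (fun l => aff l x - f x) g.
- move=> t _; have [l ls fl] := fs (p t); exists l => //.
  rewrite /g fl /aff /p dotDr dotZr (_ : dot l.1 (x - y) = dot l.1 x - dot l.1 y); first by ring.
  by rewrite dotDr -scaleN1r dotZr mulN1r.
- move=> t; apply: cvgB.
    apply: (@continuous_comp _ _ _ p f); last exact: cf.
    by apply: cvgD; [exact: cvg_cst|apply: cvgZr_tmp; exact: cvg_id].
  by apply: cvgD; [exact: cvg_cst|apply: cvgM; [exact: cvg_id|exact: cvg_cst]].
- by rewrite /g p0 mul0r addr0 subrr.
- by rewrite /g p1; ring.
by exists l => //; rewrite -subr_ge0 -[aff l x <= _]subr_le0.
Qed.

End Crossing.

(** * Smooth approximation of maxima and minima of affine functions *)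

Section Approx.
Variables (R : realType) (n : nat) (L : 'I_n -> (R * R) * R).
Implicit Types (f g : R * R -> R) (phi psi : nat -> R * R -> R) (x y : R * R).

(** Off this set distinct pieces take distinct values, so the value of a function at a point
    determines its active piece. *)
Definition tie : set (R * R) :=
  [set x | exists i j, L i != L j /\ aff (L i) x = aff (L j) x].

Lemma tie_null : measurable (tie : set (measurableTypeR R * measurableTypeR R)) /\
  leb2 R tie = 0%E.
Proof.
pose E (ij : 'I_n * 'I_n) : set (R * R) :=
  [set x | L ij.1 != L ij.2 /\ aff (L ij.1) x = aff (L ij.2) x].
have P0 : measurable (set0 : set (measurableTypeR R * measurableTypeR R)) /\ leb2 R set0 = 0%E.
  by split; [exact: measurable0|exact: measure0].
have EP ij : measurable (E ij : set (measurableTypeR R * measurableTypeR R)) /\ leb2 R (E ij) = 0%E.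
  case: ij => i j; rewrite /E /=.
  have [e|ne] := eqVneq (L i) (L j).
    by rewrite (_ : mkset _ = set0)//; apply/seteqP; split=> // x [].
  have [e1|ne1] := eqVneq (L i).1 (L j).1.
    rewrite (_ : mkset _ = set0)//; apply/seteqP; split=> // x [_].
    rewrite /aff e1 => /addrI e2; move: ne.
    by rewrite [L i]surjective_pairing [L j]surjective_pairing e1 e2 eqxx.
  have -> : [set x | true /\ aff (L i) x = aff (L j) x] =
      [set x | dot ((L i).1 - (L j).1) x + ((L i).2 - (L j).2) = 0].
    have e x : dot ((L i).1 - (L j).1) x + ((L i).2 - (L j).2) = aff (L i) x - aff (L j) x.
      by rewrite dotDl -scaleN1r dotZl /aff; ring.
    apply/seteqP; split => x /=; rewrite e; first by move=> [_ ->]; rewrite subrr.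
    by move/eqP; rewrite subr_eq0 => /eqP.
  have [cl nul] := @leb2_line R ((L i).1 - (L j).1) ((L i).2 - (L j).2) ltac:(by rewrite subr_eq0).
  by split => //; exact: closed_measurable2.
have -> : tie = \big[setU/set0]_(ij <- enum {: 'I_n * 'I_n}) E ij.
  rewrite -bigcup_seq; apply/seteqP; split => x.
    by move=> [i [j ij]]; exists (i, j) => //=; rewrite mem_enum.
  by move=> [[i j] _ ij]; exists i, j.
elim/big_ind: _ => //.
by move=> A B [mA A0] [mB B0]; split; [exact: measurableU|rewrite null_set_setU].
Qed.

Definition near_piece f x i := \forall y \near x, f y = aff (L i) y.

(** An invariant stable under maximum and minimum. The active piece and the limit of the gradients
    share one index, which allows the pieces of two functions to be compared; the uniform bounds
    provide the majorant for dominated convergence. *)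
Definition approx f phi (C : R) :=
  [/\ forall k, smooth_expr (phi k),
      forall k x, `|phi k x - f x| <= C * k.+1%:R^-1,
      forall k x, `|grad (phi k) x| <= C &
      forall x, ~ tie x -> exists2 i, near_piece f x i &
        grad (phi k) x @[k --> \oo] --> (L i).1].

Lemma approx_ge0 f phi C : approx f phi C -> 0 <= C.
Proof. by case=> _ _ /(_ 0%N 0) h _; exact: le_trans h. Qed.

Lemma approx_cvg f phi C x : approx f phi C -> phi k x @[k --> \oo] --> f x.
Proof.
move=> aC; have C0 := approx_ge0 aC; case: aC => _ aC _ _.
apply/cvgrPdist_le => e e0; have C1 : 0 < C + 1 by rewrite ltr_wpDl.
near=> k; rewrite distrC (le_trans (aC k x))//.
apply: (@le_trans _ _ ((C + 1) * k.+1%:R^-1)).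
  by rewrite ler_wpM2r ?invr_ge0// lerDl.
rewrite mulrC -ler_pdivlMr//; apply: ltW; near: k.
exact: near_infty_natSinv_lt (PosNum (divr_gt0 e0 C1)).
Unshelve. all: by end_near. Qed.

Lemma approx_piece i : approx (aff (L i)) (fun=> aff (L i)) `|(L i).1|.
Proof.
have gE x : grad (aff (L i)) x = (L i).1.
  by apply: (@grad_near_aff _ _ _ (L i).2); near=> y.
split=> [k|k x|k x|x _].
- exact: smooth_aff.
- by rewrite subrr normr0 mulr_ge0// invr_ge0.
- by rewrite gE.
- by exists i; [near=> y|rewrite gE; exact: cvg_cst].
Unshelve. all: by end_near. Qed.

Definition pos_diff phi psi (k : nat) x := ppos (k.+1%:R^-1) (phi k x - psi k x).

(** Both [max(f, g) = g + (f - g)^+] and [min(f, g) = f - (f - g)^+] reduce to this case. At a point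
    that is not a tie, either the two active pieces coincide, and the gradient of the difference
    tends to 0 while [dppos] stays at most 1, or they differ there, so [f - g] has a fixed sign
    nearby and [dppos] tends to 0 or 1. *)
Lemma approx_pos_diff f g phi psi C D : approx f phi C -> approx g psi D ->
  [/\ forall k, smooth_expr (pos_diff phi psi k),
    forall k x, `|pos_diff phi psi k x - Num.max (f x - g x) 0| <= (1 + C + D) * k.+1%:R^-1,
    forall k x, `|grad (pos_diff phi psi k) x| <= C + D &
    forall x i j, ~ tie x -> near_piece f x i -> near_piece g x j ->
      grad (phi k) x @[k --> \oo] --> (L i).1 -> grad (psi k) x @[k --> \oo] --> (L j).1 ->
      exists b : bool, (\forall y \near x, Num.max (f y - g y) 0 = if b then f y - g y else 0) /\
        grad (pos_diff phi psi k) x @[k --> \oo] --> (if b then (L i).1 - (L j).1 else 0)].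
Proof.
move=> af ag; have [sphi phif gphi _] := af; have [spsi psig gpsi _] := ag.
have sdiff k : smooth_expr (fun x => phi k x - psi k x).
  by apply: smooth_add => //; exact: smooth_opp.
have k0 k : 0 < k.+1%:R^-1 :> R by rewrite invr_gt0.
have gd k x : grad (fun x => phi k x - psi k x) x = grad (phi k) x - grad (psi k) x.
  by rewrite gradD// ?gradN//; exact: smooth_opp.
have gE k x : grad (pos_diff phi psi k) x =
    dppos k.+1%:R^-1 (phi k x - psi k x) *: (grad (phi k) x - grad (psi k) x).
  by rewrite /pos_diff grad_ppos// gd.
have dp k t : `|dppos k.+1%:R^-1 t| <= 1 :> R.
  by rewrite ger0_norm ?dppos_ge0// dppos_le1.
have gle k x : `|grad (pos_diff phi psi k) x| <= `|grad (phi k) x - grad (psi k) x|.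
  by rewrite gE normrZ ler_piMl.
split.
- by move=> k; exact: smooth_ppos.
- move=> k x; rewrite /pos_diff.
  have h1 := ppos_dist (phi k x - psi k x) (k0 k).
  have h2 : `|Num.max (phi k x - psi k x) 0 - Num.max (f x - g x) 0| <=
     `|(phi k x - psi k x) - (f x - g x)|.
    move: (phi k x - psi k x) (f x - g x) => a b.
    have [d1 d2] : a - b <= `|a - b| /\ b - a <= `|a - b|.
      by split; [exact: ler_norm|rewrite distrC ler_norm].
    move: (`|a - b|) d1 d2 => d d1 d2; rewrite ler_norml.
    by case: (leP a 0) => a0; case: (leP b 0) => b0; apply/andP; split; lra.
  have h3 : `|(phi k x - psi k x) - (f x - g x)| <= `|phi k x - f x| + `|psi k x - g x|.
    by rewrite (_ : _ - _ = (phi k x - f x) - (psi k x - g x)) ?ler_normB//; ring.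
  apply: (le_trans (ler_distD (Num.max (phi k x - psi k x) 0) _ _)).
  rewrite !mulrDl mul1r -addrA lerD//; apply: (le_trans h2); apply: (le_trans h3).
  by rewrite lerD.
- by move=> k x; rewrite (le_trans (gle k x))// (le_trans (ler_normB _ _))// lerD.
move=> x i j ntx fi gj ci cj.
have cd : grad (phi k) x - grad (psi k) x @[k --> \oo] --> (L i).1 - (L j).1.
  exact: cvgB.
have fx : f x = aff (L i) x := nbhs_singleton fi.
have gx : g x = aff (L j) x := nbhs_singleton gj.
have [e|ne] := eqVneq (aff (L i) x) (aff (L j) x).
  have Lij : L i = L j.
    by apply: contrapT => /eqP N; apply: ntx; exists i, j.
  exists false; split.
    near=> y; rewrite (_ : f y - g y = 0) ?maxxx//.
    have -> : f y = aff (L i) y by near: y.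
    have -> : g y = aff (L j) y by near: y.
    by rewrite Lij subrr.
  move: cd; rewrite Lij subrr => /cvgr0_norm_le cd.
  apply/cvgr0Pnorm_le => d d0; have := cd _ d0.
  by apply: filterS => k; exact: le_trans.
pose t := aff (L i) x - aff (L j) x.
have tn0 : t != 0 by rewrite subr_eq0.
exists (0 < t); split.
  have cfg : \forall y \near x, f y - g y = aff (L i) y - aff (L j) y.
    by apply: filterS2 fi gj => y -> ->.
  have ct : {for x, continuous (fun y => aff (L i) y - aff (L j) y)}.
    by apply: cvgB; exact: continuous_aff.
  have [t0|t0|e] := ltgtP t 0; last by rewrite e eqxx in tn0.
    have : \forall y \near x, aff (L i) y - aff (L j) y < 0 by exact: (cvgr_lt _ ct).
    by apply: filterS2 cfg => y -> h; rewrite max_r// ltW.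
  have : \forall y \near x, 0 < aff (L i) y - aff (L j) y by exact: (cvgr_gt _ ct).
  by apply: filterS2 cfg => y -> h; rewrite max_l// ltW.
rewrite (_ : (fun k => grad (pos_diff phi psi k) x) = (fun k =>
    dppos k.+1%:R^-1 (phi k x - psi k x) *: (grad (phi k) x - grad (psi k) x))); last exact/funext.
rewrite (_ : (if _ then _ else _) = ((0 < t)%R%:R : R) *: ((L i).1 - (L j).1)); last first.
  by case: ifP => _; rewrite ?scale1r ?scale0r.
apply: cvgZ => //; apply: (@cvg_dppos _ (fun k => k.+1%:R^-1) _ t) => //; first exact: cvg_harmonic.
by rewrite /t -fx -gx; apply: cvgB; [exact: approx_cvg af|exact: approx_cvg ag].
Unshelve. all: by end_near. Qed.

Lemma approx_max f g phi psi C D : approx f phi C -> approx g psi D ->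
  exists chi E, approx (fun x => Num.max (f x) (g x)) chi E.
Proof.
move=> af ag; have [sd dd gd cd] := approx_pos_diff af ag.
have C0 := approx_ge0 af; have D0 := approx_ge0 ag.
have [sphi phif gphi cphi] := af; have [spsi psig gpsi cpsi] := ag.
have maxE y : Num.max (f y) (g y) = g y + Num.max (f y - g y) 0.
  case: (leP (f y) (g y)) => h; first by rewrite max_r ?subr_le0// addr0.
  by rewrite max_l ?subr_ge0 ?ltW//; ring.
exists (fun k x => psi k x + pos_diff phi psi k x), (1 + C + D + D); split.
- by move=> k; exact: smooth_add.
- move=> k x; rewrite maxE opprD addrACA (le_trans (ler_normD _ _))//.
  by rewrite [leRHS]mulrDl [leRHS]addrC; apply: lerD; [exact: psig|exact: dd].
- move=> k x; rewrite gradD// (le_trans (ler_normD _ _))//.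
  by have := gpsi k x; have := gd k x; lra.
move=> x ntx; have [i fi ci] := cphi x ntx; have [j gj cj] := cpsi x ntx.
have [b [nb cb]] := cd _ _ _ ntx fi gj ci cj.
exists (if b then i else j).
  rewrite /near_piece; near=> y; rewrite maxE.
  have -> : Num.max (f y - g y) 0 = if b then f y - g y else 0 by near: y.
  case: (b); last by rewrite addr0; near: y.
  by rewrite addrC subrK; near: y.
rewrite (_ : (L _).1 = (L j).1 + (if b then (L i).1 - (L j).1 else 0)); last first.
  by case: (b); rewrite ?addr0// addrC subrK.
under eq_fun do rewrite gradD//.
exact: cvgD.
Unshelve. all: by end_near. Qed.

Lemma approx_min f g phi psi C D : approx f phi C -> approx g psi D ->
  exists chi E, approx (fun x => Num.min (f x) (g x)) chi E.
Proof.
move=> af ag; have [sd dd gd cd] := approx_pos_diff af ag.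
have C0 := approx_ge0 af; have D0 := approx_ge0 ag.
have [sphi phif gphi cphi] := af; have [spsi psig gpsi cpsi] := ag.
have minE y : Num.min (f y) (g y) = f y - Num.max (f y - g y) 0.
  case: (leP (f y) (g y)) => h; first by rewrite max_r ?subr_le0// subr0.
  by rewrite max_l ?subr_ge0 ?ltW//; ring.
exists (fun k x => phi k x - pos_diff phi psi k x), (1 + C + D + C); split.
- by move=> k; apply: smooth_add => //; exact: smooth_opp.
- move=> k x; rewrite minE (_ : _ - _ = (phi k x - f x) -
    (pos_diff phi psi k x - Num.max (f x - g x) 0)); last by ring.
  rewrite (le_trans (ler_normB _ _))// [leRHS]mulrDl [leRHS]addrC.
  by apply: lerD; [exact: phif|exact: dd].
- move=> k x; rewrite gradD ?gradN//; last exact: smooth_opp.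
  rewrite (le_trans (ler_normB _ _))//.
  by have := gphi k x; have := gd k x; lra.
move=> x ntx; have [i fi ci] := cphi x ntx; have [j gj cj] := cpsi x ntx.
have [b [nb cb]] := cd _ _ _ ntx fi gj ci cj.
exists (if b then j else i).
  rewrite /near_piece; near=> y; rewrite minE.
  have -> : Num.max (f y - g y) 0 = if b then f y - g y else 0 by near: y.
  case: (b); last by rewrite subr0; near: y.
  by rewrite opprB addrC subrK; near: y.
rewrite (_ : (L _).1 = (L i).1 - (if b then (L i).1 - (L j).1 else 0)); last first.
  by case: (b); rewrite ?subr0// opprB addrC subrK.
have -> : (fun k => grad (fun x0 => phi k x0 - pos_diff phi psi k x0) x) =
    (fun k => grad (phi k) x - grad (pos_diff phi psi k) x).
  by apply/funext => k; rewrite gradD ?gradN//; exact: smooth_opp.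
exact: cvgB.
Unshelve. all: by end_near. Qed.

Lemma approx_bigmin (I : Type) (s : seq I) (P : pred I) (a0 : R * R -> R) (a : I -> R * R -> R) :
  (exists phi C, approx a0 phi C) -> (forall i, exists phi C, approx (a i) phi C) ->
  exists phi C, approx (fun x => \big[Order.min/a0 x]_(i <- s | P i) a i x) phi C.
Proof.
move=> A0 A; elim: s => [|i s [phi [C IH]]].
  by rewrite (_ : (fun x => _) = a0)//; apply/funext => x; rewrite big_nil.
have [psi [D ai]] := A i.
rewrite (_ : (fun x => _) = fun x => if P i then
    Num.min (a i x) (\big[Order.min/a0 x]_(j <- s | P j) a j x)
  else \big[Order.min/a0 x]_(j <- s | P j) a j x); last first.
  by apply/funext => x; rewrite big_cons.
case: (P i); last by exists phi, C.
exact: approx_min ai IH.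
Qed.

Lemma approx_bigmax (I : Type) (s : seq I) (P : pred I) (a0 : R * R -> R) (a : I -> R * R -> R) :
  (exists phi C, approx a0 phi C) -> (forall i, exists phi C, approx (a i) phi C) ->
  exists phi C, approx (fun x => \big[Order.max/a0 x]_(i <- s | P i) a i x) phi C.
Proof.
move=> A0 A; elim: s => [|i s [phi [C IH]]].
  by rewrite (_ : (fun x => _) = a0)//; apply/funext => x; rewrite big_nil.
have [psi [D ai]] := A i.
rewrite (_ : (fun x => _) = fun x => if P i then
    Num.max (a i x) (\big[Order.max/a0 x]_(j <- s | P j) a j x)
  else \big[Order.max/a0 x]_(j <- s | P j) a j x); last first.
  by apply/funext => x; rewrite big_cons.
case: (P i); last by exists phi, C.
exact: approx_max ai IH.
Qed.

(* Max-min representation: [f x] is the maximum over [y] of the minimum at [x] of the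
   pieces lying above [f] at [y]; only finitely many sets of pieces occur. *)
Lemma approx_pl f : continuous f -> (forall x, exists i, f x = aff (L i) x) ->
  exists phi C, approx f phi C.
Proof.
move=> cf fL.
pose J y : {set 'I_n} := [set i | f y <= aff (L i) y]%SET.
have fJ x : exists2 i, i \in J x & f x = aff (L i) x.
  by have [i fi] := fL x; exists i => //; rewrite inE fi.
pose JJ : {set {set 'I_n}} := [set A | `[< exists y, A = J y >]]%SET.
have JJ_y y : J y \in JJ by rewrite inE; apply/asboolP; exists y.
have [i0 _] := fL 0.
(* The iterated minimum needs a starting value; a member of [A] leaves it unchanged. *)
pose pk (A : {set 'I_n}) := if [pick i in A] is Some i then i else i0.
have pkP y : pk (J y) \in J y.
  rewrite /pk; case: pickP => // N; have [i] := fJ y; by rewrite N.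
pose m A x := \big[Order.min/aff (L (pk A)) x]_(i in A) aff (L i) x.
(* By [crossing], some piece above [f] at [y] is below [f] at [x]; it takes part in the minimum. *)
have mf x y : m (J y) x <= f x.
  have [|l ls [h1 h2]] := @crossing R [seq L i | i <- enum 'I_n] f cf _ x y.
    by move=> z; have [i fi] := fL z; exists (L i) => //; apply: map_f; rewrite mem_enum.
  move/mapP: ls => [i _ lE]; subst l; apply: le_trans h2.
  by apply: bigmin_le_cond; rewrite inE.
have fm x : f x <= m (J x) x.
  by rewrite /m; apply: le_bigmin => [|i]; [have := pkP x|]; rewrite inE.
pose M x := \big[Order.max/m (J 0) x]_(A in JJ) m A x.
have -> : f = M.
  apply/funext => x; apply: le_anti; apply/andP; split.
    by apply: (le_trans (fm x)); exact: le_bigmax_cond.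
  apply: bigmax_le => [|A]; first exact: mf.
  by rewrite inE => /asboolP[y ->].
apply: approx_bigmax => [|A].
  by apply: approx_bigmin => [|i]; eexists; eexists; exact: approx_piece.
by apply: approx_bigmin => [|i]; eexists; eexists; exact: approx_piece.
Qed.

End Approx.

(** * The Euclidean norm of the plane *)

Section Enorm.
Variable R : realType.
Implicit Types a b : R * R.

Lemma dot_ge0 a : 0 <= dot a a.
Proof. by rewrite /dot -!expr2 addr_ge0 ?sqr_ge0. Qed.

Lemma enorm_ge0 a : 0 <= enorm a.
Proof. exact: sqrtr_ge0. Qed.

Lemma enorm_sqr a : enorm a ^+ 2 = dot a a.
Proof. by rewrite sqr_sqrtr// dot_ge0. Qed.

Lemma normr_enorm a : `|enorm a| = enorm a.
Proof. by rewrite ger0_norm// enorm_ge0. Qed.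

Lemma enorm0 : enorm (0 : R * R) = 0.
Proof. by rewrite /enorm /dot !mul0r addr0 sqrtr0. Qed.

Lemma enorm_eq0 a : enorm a = 0 -> a = 0.
Proof.
move=> e; have := enorm_sqr a; rewrite e expr0n /= /dot => /esym/eqP.
rewrite -!expr2 paddr_eq0 ?sqr_ge0// !sqrf_eq0 => /andP[/eqP a1 /eqP a2].
by rewrite [a]surjective_pairing a1 a2.
Qed.

Lemma enormZ (k : R) a : enorm (k *: a) = `|k| * enorm a.
Proof.
by rewrite /enorm dotZl dotZr mulrA -expr2 sqrtrM ?sqr_ge0// sqrtr_sqr.
Qed.

Lemma enormN a : enorm (- a) = enorm a.
Proof. by rewrite /enorm /dot /= !mulrNN. Qed.

(** Lagrange's identity: the squares of the two sides differ by [(a.1 b.2 - a.2 b.1)^2]. *)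
Lemma dot_le a b : `|dot a b| <= enorm a * enorm b.
Proof.
rewrite -(ler_pXn2r (n := 2))// ?nnegrE ?mulr_ge0 ?enorm_ge0//.
rewrite exprMn !enorm_sqr real_normK ?num_real// /dot.
by have := sqr_ge0 (a.1 * b.2 - a.2 * b.1); nra.
Qed.

Lemma enormD a b : enorm (a + b) <= enorm a + enorm b.
Proof.
rewrite -(ler_pXn2r (n := 2))// ?nnegrE ?addr_ge0 ?enorm_ge0//.
rewrite sqrrD !enorm_sqr dotDl !dotDr (dotC b a).
by have := ler_norm (dot a b); have := dot_le a b; lra.
Qed.

Lemma fst_le_enorm a : `|a.1| <= enorm a.
Proof. by rewrite -sqrtr_sqr ler_wsqrtr// /dot -!expr2 lerDl sqr_ge0. Qed.

Lemma snd_le_enorm a : `|a.2| <= enorm a.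
Proof. by rewrite -sqrtr_sqr ler_wsqrtr// /dot -!expr2 lerDr sqr_ge0. Qed.

Lemma enorm_le a : enorm a <= `|a.1| + `|a.2|.
Proof.
rewrite -(ler_pXn2r (n := 2))// ?nnegrE ?addr_ge0 ?enorm_ge0//.
rewrite enorm_sqr sqrrD !real_normK ?num_real// /dot -!expr2.
by rewrite addrAC lerDl mulrn_wge0// mulr_ge0.
Qed.

Lemma enorm_le_norm a : enorm a <= 2 * `|a|.
Proof.
apply: (le_trans (enorm_le a)); rewrite mulrDl mul1r lerD//.
  by rewrite [leRHS]prod_normE le_max lexx.
by rewrite [leRHS]prod_normE le_max lexx orbT.
Qed.

End Enorm.

(** * L^p norms and convergence to zero *)

Section Lnorms.
Variable R : realType.
Local Notation T2 := (measurableTypeR R * measurableTypeR R)%type.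
Local Notation mu := (leb2 R).
Implicit Types (Omega N : set (R * R)) (f g : R * R -> R) (v w : R * R -> R * R) (p M : R).

Lemma nrmE Omega p f : 0 < p ->
  nrm Omega p f = ((\int[mu]_(x in Omega) (`|f x| `^ p)%:E) `^ p^-1)%E.
Proof.
move=> p0; rewrite /nrm Lnorm.unlock; apply: (congr1 (fun t => t `^ p^-1)%E).
rewrite [RHS]integral_mkcond; apply: eq_integral => x _ /=.
rewrite !patchE; case: ifP => // _.
by rewrite normr0 powR0// gt_eqF.
Qed.

Lemma measurable_powR_norm Omega p f : measurable (Omega : set T2) ->
  measurable_fun (Omega : set T2) f ->
  measurable_fun (Omega : set T2) (fun x => (`|f x| `^ p)%:E).
Proof.
move=> mO mf; apply/measurable_EFinP.
apply: (@measurableT_comp _ _ _ _ _ _ (@powR R ^~ p)); first exact: measurable_powR.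
by apply: measurableT_comp.
Qed.

Lemma nrm_ge0 Omega p f : (0 <= nrm Omega p f)%E.
Proof. exact: Lnorm_ge0. Qed.

Lemma nrm_bounded_lty Omega p f M : measurable (Omega : set T2) -> (mu Omega < +oo)%E -> 0 < p ->
  measurable_fun (Omega : set T2) f ->
  (forall x, Omega x -> `|f x| <= M) -> (nrm Omega p f < +oo)%E.
Proof.
move=> mO fO p0 mf fM; rewrite nrmE// poweR_lty//.
apply: (@le_lt_trans _ _ (\int[mu]_(x in Omega) (cst (`|M| `^ p)%:E) x)%E).
  apply: ge0_le_integral => //; first exact: measurable_powR_norm.
  move=> x Ox; rewrite lee_fin ge0_ler_powR ?nnegrE ?(ltW p0)//.
  exact: (le_trans (fM _ Ox) (ler_norm _)).
by rewrite integral_cst// lte_mul_pinfty.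
Qed.

(** Dominated convergence for the p-th powers off [N]. The majorant is constant, hence integrable on
    a domain of finite measure. *)
Lemma nrm_cvg0 Omega N p (h : nat -> R * R -> R) M :
  measurable (Omega : set T2) -> (mu Omega < +oo)%E -> 0 < p ->
  measurable (N : set T2) -> mu N = 0%E ->
  (forall k, measurable_fun (Omega : set T2) (h k)) ->
  (forall k x, Omega x -> ~ N x -> `|h k x| <= M) ->
  (forall x, Omega x -> ~ N x -> h k x @[k --> \oo] --> (0 : R)) ->
  nrm Omega p (h k) @[k --> \oo] --> 0%E.
Proof.
move=> mO fO p0 mN N0 mh hM h0.
have pn0 : p != 0 by rewrite gt_eqF.
under eq_fun do rewrite (nrm_setD _ _ pn0 mN N0).
have mD : measurable (Omega `\` N : set T2) by exact: measurableD.
have fD : (mu (Omega `\` N) < +oo)%E.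
  by apply: le_lt_trans fO; apply: le_measure; rewrite ?inE//; exact: subDsetl.
have mhD k : measurable_fun (Omega `\` N : set T2) (h k).
  by apply: measurable_funS (mh k) => //; exact: subDsetl.
have [|||||_ _ cI] := @dominated_convergence _ T2 R mu (Omega `\` N) mD
   (fun k x => (`|h k x| `^ p)%:E) (cst 0%E) (cst (`|M| `^ p)%:E).
- by move=> k; exact: measurable_powR_norm.
- exact: measurable_cst.
- apply: aeW => x [Ox Nx]; apply: cvg_EFin; first exact: nearW.
  apply/cvgr0Pnorm_lt => e e0.
  have ep : 0 < e `^ p^-1 by rewrite powR_gt0.
  have /cvgr0_norm_lt/(_ _ ep) := h0 x Ox Nx; apply: filterS => k hk /=.
  rewrite ger0_norm ?powR_ge0// -[ltRHS]powRr1 ?(ltW e0)// -(mulVf pn0) powRrM.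
  by rewrite gt0_ltr_powR ?nnegrE ?powR_ge0.
- apply: (@measurable_bounded_integrable _ _ _ mu (cst (`|M| `^ p))) => //.
  by exists (`|M| `^ p); split; [exact: num_real|move=> r rM x _ /=; rewrite ger0_norm ?powR_ge0// ltW].
- apply: aeW => x k [Ox Nx] /=; rewrite lee_fin ger0_norm ?powR_ge0//.
  rewrite ge0_ler_powR ?nnegrE ?(ltW p0)//.
  exact: (le_trans (hM k x Ox Nx) (ler_norm _)).
rewrite integral0 in cI; have /fine_cvgP[ifin icvg] := cI.
apply: cvg_trans (_ : _ --> _) => //; apply/fine_cvgP; split.
  by apply: filterS ifin => k kfin; rewrite nrmE// fin_num_poweR.
apply/cvgr0Pnorm_lt => e e0.
have ep : 0 < e `^ p by rewrite powR_gt0.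
have /cvgr0_norm_lt/(_ _ ep) := icvg; apply: filterS => k hk /=.
rewrite nrmE// fine_poweR ger0_norm ?powR_ge0//.
rewrite -[ltRHS]powRr1 ?(ltW e0)// -(mulfV pn0) powRrM.
have i0 : 0 <= fine (\int[mu]_(x in Omega `\` N) (`|h k x| `^ p)%:E)%E.
  by rewrite fine_ge0// integral_ge0.
rewrite gt0_ltr_powR ?nnegrE ?powR_ge0 ?invr_gt0//.
by move: hk; rewrite /= ger0_norm.
Qed.
End Lnorms.

(** * Functions of V_h as members of W^{1,p}_0 *)

Section VhLocal.
Variables (R : realType) (Omega : set (R * R)) (T : seq {ffun 'I_3 -> R * R}).
Local Notation T2 := (measurableTypeR R * measurableTypeR R)%type.
Hypothesis oO : open Omega.
Hypothesis bO : bounded_set Omega.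
Hypothesis cT : conforming_mesh Omega T.
Implicit Types (S : R * R -> R) (x y : R * R).
Local Notation U := (mesh_interior Omega T).

Lemma Vh_pieces S : Vh Omega T S ->
  exists l : {ffun 'I_3 -> R * R} -> (R * R) * R,
    forall K, K \in T -> forall x, tri K x -> S x = aff (l K) x.
Proof.
case=> _ SK _.
suff /choice[l lP] : forall K, exists l : (R * R) * R,
    K \in T -> forall x, tri K x -> S x = aff l x by exists l.
move=> K; have [KT|KT] := boolP (K \in T); last by exists 0.
by have [a [b ab]] := SK K KT; exists (a, b).
Qed.

Lemma Vh_near S l x : (forall K, K \in T -> forall x, tri K x -> S x = aff (l K) x) ->
  U x -> exists2 K, K \in T & \forall y \near x, S y = aff (l K) y.
Proof.
move=> Sl [Ox [K KT iK]]; exists K => //.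
by apply: filterS iK => y Ky; exact: Sl Ky.
Qed.

Lemma open_mesh : open U. Proof. exact: open_mesh_interior. Qed.

Lemma Vh_pd_continuous S i : Vh Omega T S -> {in U, continuous (pd i S)}.
Proof.
move=> /Vh_pieces[l Sl] x; rewrite inE => Ux.
have [K KT KS] := Vh_near Sl Ux.
apply: (@cvg_trans _ ((fun=> if i then (l K).1.2 else (l K).1.1) @ x)).
  apply: near_eq_cvg.
  have H := nbhs_interior KS.
  near=> y.
  have Sy : \forall z \near y, S z = dot (l K).1 z + (l K).2 by near: y.
  by rewrite (pd_near_aff _ Sy).
rewrite (pd_near_aff _ KS); exact: (@cst_continuous (R * R)%type R _ x).
Unshelve. all: by end_near. Qed.

Lemma Vh_grad_bound S : Vh Omega T S -> exists M, forall x, U x -> enorm (grad S x) <= M.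
Proof.
move=> /Vh_pieces[l Sl]; exists (\sum_(K <- T) enorm (l K).1) => x Ux.
have [K KT KS] := Vh_near Sl Ux; rewrite (grad_near_aff KS).
by rewrite (big_rem K)//= lerDl sumr_ge0// => *; exact: enorm_ge0.
Qed.

Lemma Vh_continuous S : Vh Omega T S -> {in Omega, continuous S}.
Proof.
case=> cS _ _; rewrite -(continuous_open_subspace S oO).
apply: continuous_subspaceW cS; exact: subset_closure.
Qed.

Lemma mesh_cover x : Omega x -> exists2 K, K \in T & tri K x.
Proof.
by move=> Ox; have [_ e _] := cT; have : closure Omega x by [exact: subset_closure]; rewrite e.
Qed.

Lemma Omega_bound : exists r, 0 <= r /\ forall x, Omega x -> enorm x <= r.
Proof.
have [M [_ MO]] := bO; exists (2 * (`|M| + 1)); split; first by rewrite mulr_ge0// addr_ge0.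
move=> x Ox; rewrite (le_trans (enorm_le_norm _))// ler_pM2l//.
by apply: MO => //; rewrite ltr_pwDr// ler_norm.
Qed.

Lemma closed_subset_compact (A : set (R * R)) : closed A -> A `<=` Omega -> compact A.
Proof.
move=> cA AO; have [r [r0 rO]] := Omega_bound.
apply: (@subclosed_compact _ _ (`[- r, r]%classic `*` `[- r, r]%classic)) => //.
  by apply: compact_setX; exact: segment_compact.
move=> x /AO Ox; have := rO x Ox => xr.
have x1 := le_trans (fst_le_enorm x) xr; have x2 := le_trans (snd_le_enorm x) xr.
by split; rewrite /= in_itv /= -ler_norml.
Qed.

Lemma Vh_bound S : Vh Omega T S -> exists M, forall x, Omega x -> `|S x| <= M.
Proof.
move=> /Vh_pieces[l Sl]; have [r [r0 rO]] := Omega_bound.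
exists (\sum_(K <- T) (enorm (l K).1 * r + `|(l K).2|)) => x Ox.
have [K KT Kx] := mesh_cover Ox; rewrite (Sl _ KT _ Kx).
have le1 : `|aff (l K) x| <= enorm (l K).1 * r + `|(l K).2|.
  rewrite (le_trans (ler_normD _ _))// lerD2r (le_trans (dot_le _ _))//.
  by rewrite ler_wpM2l ?enorm_ge0// rO.
rewrite (le_trans le1)// (big_rem K)//= lerDl sumr_ge0// => *.
by rewrite addr_ge0// mulr_ge0// enorm_ge0.
Qed.

(** [W10] asks for a gradient measurable on all of [Omega]. The value 0 on the mesh edges gives a
    bounded measurable representative of the elementwise gradient. *)
Definition gradU S x : R * R := if x \in U then grad S x else 0.

Lemma measurable_Omega : measurable (Omega : set T2).
Proof. exact: open_measurable2. Qed.

Lemma Omega_lty : (leb2 R Omega < +oo)%E.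
Proof. exact: leb2_bounded_lty measurable_Omega bO. Qed.

Lemma Vh_measurable S : Vh Omega T S -> measurable_fun (Omega : set T2) S.
Proof. by move=> VS; apply: continuous_measurable2 => //; exact: Vh_continuous. Qed.

Lemma measurable_patchU (f : R * R -> R) : measurable_fun (U : set T2) f ->
  measurable_fun (Omega : set T2) (fun x => if x \in U then f x else 0).
Proof.
move=> mf; have -> : (fun x => if x \in U then f x else 0) = f \_ U.
  by apply/funext => x; rewrite patchE.
apply/measurable_restrict; first exact: open_measurable2 open_mesh.
  exact: measurable_Omega.
apply: measurable_funS mf; first exact: open_measurable2 open_mesh.
by move=> x [].
Qed.

Lemma gradU_measurable S : Vh Omega T S ->
  measurable_fun (Omega : set T2) (fun x => (gradU S x).1) /\
  measurable_fun (Omega : set T2) (fun x => (gradU S x).2).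
Proof.
move=> VS; have mpd i : measurable_fun (U : set T2) (pd i S).
  by apply: continuous_measurable2; [exact: open_mesh|exact: Vh_pd_continuous].
split.
  rewrite (_ : (fun x => _) = (fun x => if x \in U then pd false S x else 0)).
    exact: measurable_patchU.
  by apply/funext => x; rewrite /gradU; case: ifP.
rewrite (_ : (fun x => _) = (fun x => if x \in U then pd true S x else 0)).
  exact: measurable_patchU.
by apply/funext => x; rewrite /gradU; case: ifP.
Qed.

Lemma gradU_bound S : Vh Omega T S -> exists M, forall x, enorm (gradU S x) <= M.
Proof.
move=> VS; have [M HM] := Vh_grad_bound VS; exists `|M| => x; rewrite /gradU.
case: ifPn => [|_]; last by rewrite enorm0.
by rewrite inE => Ux; rewrite (le_trans (HM x Ux))// ler_norm.
Qed.

Lemma measurable_enorm (v : R * R -> R * R) : 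
  measurable_fun (Omega : set T2) (fun x => (v x).1) ->
  measurable_fun (Omega : set T2) (fun x => (v x).2) ->
  measurable_fun (Omega : set T2) (fun x => enorm (v x)).
Proof.
move=> m1 m2; apply: (@measurableT_comp _ _ _ _ _ _ (@Num.sqrt R)).
  by apply: continuous_measurable_fun => x; exact: sqrt_continuous.
by apply: measurable_funD; apply: measurable_funM.
Qed.

(** The closed sets [closure Omega] and the complement of [Omega] cover the plane, and the two
    definitions agree on their intersection, the boundary, where [S] vanishes. *)
Lemma Vh_ext_continuous S : Vh Omega T S -> continuous (S \_ (closure Omega)).
Proof.
case=> cS _ S0; apply/continuous_subspace_setT.
have -> : [set: R * R] = closure Omega `|` ~` Omega.
  apply/seteqP; split=> // x _; have [Ox|Ox] := pselect (Omega x); last by right.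
  by left; exact: subset_closure.
apply: withinU_continuous; [exact: closed_closure|exact: open_closedC| |].
  by apply: subspace_eq_continuous cS => x xO; rewrite /from_subspace patchE xO.
apply: (@subspace_eq_continuous _ _ _ (cst 0)); last exact: cst_continuous.
move=> x; rewrite inE /= => nO; rewrite /from_subspace patchE /=; case: ifPn => //; rewrite inE => cx.
by rewrite S0//; split => //; rewrite (interior_id Omega).1.
Qed.

(** The zero extension has the pieces of the triangles and one more, the zero function, stored at
    the last index. That index is returned because the zeros of the extension must be recognised
    later as ties or as points of the zero piece. *)
Lemma Vh_ext_approx S : Vh Omega T S ->
  exists n (L : 'I_n -> (R * R) * R) phi C i0,
    approx L (S \_ (closure Omega)) phi C /\ L i0 = 0.
Proof.
move=> VS; have [l Sl] := Vh_pieces VS.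
pose K0 : {ffun 'I_3 -> R * R} := [ffun=> 0].
pose L (i : 'I_(size T).+1) := if (i < size T)%N then l (nth K0 T i) else 0.
have [phi [C aC]] : exists phi C, approx L (S \_ (closure Omega)) phi C.
  apply: approx_pl; first exact: Vh_ext_continuous.
  move=> x; rewrite patchE; case: ifPn => cx.
    have [_ e _] := cT; rewrite inE e in cx; case: cx => K KT Kx.
    have iK : (index K T < (size T).+1)%N by rewrite ltnS ltnW// index_mem.
    by exists (Ordinal iK); rewrite /L /= index_mem KT nth_index//; exact: Sl Kx.
  by exists ord_max; rewrite /L /= ltnn /aff /dot !mul0r !addr0.
by exists _, L, phi, C, ord_max; split => //; rewrite /L /= ltnn.
Qed.

(** The approximations [tau k] come from the smooth [phi k] by a soft threshold on both sides of 0.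
    Off ties and edges their gradients converge to that of [S], under a uniform bound. *)
Lemma Vh_W10 S p : 0 < p -> Vh Omega T S -> W10 Omega p S (gradU S).
Proof.
move=> p0 VS; have [n [L [phi [C [i0 [aC Li0]]]]]] := Vh_ext_approx VS.
set f := S \_ (closure Omega) in aC.
have C0 := approx_ge0 aC; have [sphi phif gphi cphi] := aC.
(* The threshold [d k] exceeds the uniform error [C * e k] by [e k]. Hence [tau k] vanishes wherever
   [|f| < e k], and its support lies in a closed set contained in [Omega]. *)
pose e k : R := k.+1%:R^-1; pose d k : R := (C + 1) * e k.
have e0 k : 0 < e k by rewrite invr_gt0.
have d0 k : 0 < d k by rewrite mulr_gt0// ltr_wpDl.
pose tau k x := ppos (e k) (phi k x - d k) - ppos (e k) (- phi k x - d k).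
have s1 k : smooth_expr (fun x => phi k x - d k).
  by apply: smooth_add => //; exact: smooth_cst.
have s2 k : smooth_expr (fun x => - phi k x - d k).
  by apply: smooth_add; [exact: smooth_opp|exact: smooth_cst].
have p1 k := smooth_ppos (e0 k) (s1 k); have p2 k := smooth_ppos (e0 k) (s2 k).
have stau k : smooth_expr (tau k) by apply: smooth_add => //; exact: smooth_opp.
have cst0 k : smooth_expr (fun=> - d k) by exact: smooth_cst.
have gcst k x : grad (fun=> - d k) x = 0.
  apply: (@grad_near_aff _ _ 0 (- d k)); near=> y.
  by rewrite /dot !mul0r !add0r.
have gtau k x : grad (tau k) x =
   (dppos (e k) (phi k x - d k) + dppos (e k) (- phi k x - d k)) *: grad (phi k) x.
  rewrite gradD//; last exact: smooth_opp.
  rewrite gradN// !grad_ppos//.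
  have -> : grad (fun y => phi k y - d k) x = grad (phi k) x.
    by rewrite (@gradD _ (phi k) (fun=> - d k))// gcst addr0.
  have -> : grad (fun y => - phi k y - d k) x = - grad (phi k) x.
    rewrite (@gradD _ (fun y => - phi k y) (fun=> - d k))//; last exact: smooth_opp.
    by rewrite gcst addr0 gradN.
  by rewrite scalerN opprK scalerDl.
have gtau_le k x : `|grad (tau k) x| <= 2 * `|grad (phi k) x|.
  rewrite gtau normrZ ler_wpM2r// ger0_norm ?addr_ge0 ?dppos_ge0//.
  have -> : (2 : R) = 1 + 1 by ring.
  by rewrite lerD// dppos_le1.
(* The constant collects 2 for the two regularised positive parts, [C + 1] for the threshold and [C]
   for [phi k - f]. *)
have tau_f k x : `|tau k x - f x| <= (2 + (C + 1) + C) * e k.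
  have h1 := ppos_dist (phi k x - d k) (e0 k).
  have h2 := ppos_dist (- phi k x - d k) (e0 k).
  have h3 := phif k x; rewrite -/(e k) in h3.
  have h4 : `|(Num.max (phi k x - d k) 0 - Num.max (- phi k x - d k) 0) - phi k x| <= d k.
    move: (phi k x) (d k) (d0 k) => a b b0; rewrite ler_norml.
    by case: (leP (a - b) 0) => h; case: (leP (- a - b) 0) => h'; apply/andP; split; lra.
  rewrite /tau; have -> : (2 + (C + 1) + C) * e k = e k + e k + d k + C * e k by rewrite /d; ring.
  set m1 := Num.max _ _ in h1 h4; set m2 := Num.max _ _ in h2 h4.
  set a1 := ppos _ _ in h1 *; set a2 := ppos _ _ in h2 *.
  rewrite (_ : a1 - a2 - f x = (a1 - m1) + (m2 - a2) + (m1 - m2 - phi k x) + (phi k x - f x)); last by ring.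
  rewrite (le_trans (ler_normD _ _))// lerD// (le_trans (ler_normD _ _))// lerD//.
  by rewrite (le_trans (ler_normD _ _))// lerD// distrC.
have supp k : [set x | tau k x != 0] `<=` [set x | e k <= `|f x|].
  move=> x /= t0.
  have : d k < `|phi k x|.
    rewrite ltNge; apply/negP => hle; move: t0.
    have := ler_norm (phi k x); have := ler_norm (- phi k x); rewrite normrN => h1 h2.
    by rewrite /tau !ppos_le0 ?subrr ?eqxx//; lra.
  have := phif k x; rewrite -/(e k) => h1 h2.
  have h3 := ler_distD 0 (phi k x) (f x); rewrite !subr0 sub0r normrN in h3.
  have : `|phi k x| <= `|phi k x - f x| + `|f x|.
    by rewrite -[X in `|X| <= _](subrK (f x)) ler_normD.
  by move: h2; rewrite /d; lra.
have cf : continuous f by exact: Vh_ext_continuous.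
have cl k : closed [set x | e k <= `|f x|].
  rewrite (_ : mkset _ = (fun x => `|f x|) @^-1` [set y | e k <= y])//.
  apply: closed_comp => [x _|]; last exact: closed_ge.
  by apply: cvg_norm; exact: cf.
have sO k : [set x | e k <= `|f x|] `<=` Omega.
  move=> x /= ex; apply: contrapT => nO; move: ex; rewrite leNgt /f patchE.
  case: ifPn => [cx|_]; last by rewrite normr0 e0.
  have [_ _ S0] := VS; rewrite S0 ?normr0 ?e0//; split; first by rewrite inE in cx.
  by rewrite (interior_id Omega).1.
have supp_cl k : closure [set x | tau k x != 0] `<=` [set x | e k <= `|f x|].
  by rewrite [X in _ `<=` X](closure_id _).1//; apply: closure_subset.
have [N2m N20] := mesh_null oO cT; have [N1m N10] := tie_null L.
pose N := tie L `|` (Omega `\` U).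
have mN : measurable (N : set T2) by exact: measurableU.
have N0 : leb2 R N = 0%E by rewrite null_set_setU.
have NU x : Omega x -> ~ N x -> U x /\ ~ tie L x.
  move=> Ox Nx; split; last by move=> tx; apply: Nx; left.
  by apply: contrapT => nU; apply: Nx; right.
have pdc k i : continuous (pd i (tau k)) by apply: smooth_expr_continuous; exact: smooth_expr_pd.
have tauc k : continuous (tau k) by exact: smooth_expr_continuous.
have cm (h : R * R -> R) : continuous h -> measurable_fun (Omega : set T2) h.
  by move=> ch; apply: continuous_measurable2 => // x _; exact: ch.
have [mg1 mg2] := gradU_measurable VS.
have [Mg HMg] := gradU_bound VS.
have [Ms HMs] := Vh_bound VS.
have mS := Vh_measurable VS.
have fS x : Omega x -> f x = S x.
  by move=> Ox; rewrite /f patchE mem_set//; exact: subset_closure.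
split.
- split => //; apply: (nrm_bounded_lty (M := Ms)) => //; [exact: measurable_Omega|exact: Omega_lty].
- split; split => //; apply: (nrm_bounded_lty (M := Mg)) => //;
    try exact: measurable_Omega; try exact: Omega_lty; move=> x _.
    exact: le_trans (fst_le_enorm _) (HMg x).
  exact: le_trans (snd_le_enorm _) (HMg x).
exists tau; split.
- move=> k; split.
  + exact: smooth_exprP.
  + by apply: closed_subset_compact; [exact: closed_closure|exact: subset_trans (supp_cl k) (sO k)].
  + exact: subset_trans (supp_cl k) (sO k).
- apply: (@nrm_cvg0 _ Omega N p _ (2 + (C + 1) + C)) => //.
  + exact: measurable_Omega.
  + exact: Omega_lty.
  + by move=> k; apply: measurable_funB => //; exact: cm.
  + move=> k x Ox _; rewrite -fS// (le_trans (tau_f k x))// ler_piMr//.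
      by rewrite !addr_ge0.
    by rewrite /e invf_le1// ler1n.
  + move=> x Ox _; apply/cvgr0Pnorm_le => r r0.
    pose Q := 2 + (C + 1) + C.
    have Q0 : 0 < Q by rewrite /Q -addrA ltr_pwDl ?addr_ge0.
    near=> k; rewrite -fS// (le_trans (tau_f k x))// -/Q mulrC -ler_pdivlMr//.
    apply: ltW; near: k; exact: near_infty_natSinv_lt (PosNum (divr_gt0 r0 Q0)).
apply: (@nrm_cvg0 _ Omega N p _ (2 * (2 * (2 * C)) + Mg)) => //.
- exact: measurable_Omega.
- exact: Omega_lty.
- move=> k; apply: measurable_enorm.
    exact: (@measurable_funB _ _ _ _ (pd false (tau k)) (fun x => (gradU S x).1) (cm _ (pdc k false)) mg1).
  exact: (@measurable_funB _ _ _ _ (pd true (tau k)) (fun x => (gradU S x).2) (cm _ (pdc k true)) mg2).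
- move=> k x Ox _; rewrite normr_enorm (le_trans (enormD _ _))// lerD//.
    rewrite (le_trans (enorm_le_norm _))// ler_pM2l// (le_trans (gtau_le k x))//.
    by rewrite ler_pM2l// (le_trans (gphi k x))// ler_peMl// ler1n.
  by rewrite enormN.
move=> x Ox Nx; have [Ux ntx] := NU x Ox Nx.
have [i fi ci] := cphi x ntx.
have gS : gradU S x = (L i).1.
  rewrite /gradU mem_set//; apply: (@grad_near_aff _ _ _ (L i).2).
  have : \forall y \near x, Omega y by exact: open_nbhs_nbhs.
  by apply: filterS2 fi => y fy Oy; rewrite -fS// fy.
have fx : f x = aff (L i) x := nbhs_singleton fi.
have ce : e k @[k --> \oo] --> (0 : R) by exact: cvg_harmonic.
have cd : d k @[k --> \oo] --> (0 : R).
  by rewrite -[X in _ --> X](mulr0 (C + 1)); apply: cvgM => //; exact: cvg_cst.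
have cph : phi k x @[k --> \oo] --> f x := approx_cvg aC.
have cg : grad (tau k) x @[k --> \oo] --> (L i).1.
  (* Where [f x = 0], the active piece off ties is the zero piece, so the gradients of [phi k] tend
     to 0 themselves. Elsewhere exactly one of the two factors [dppos] tends to 1 and the other to
     0. *)
  have [f0|fn0] := eqVneq (f x) 0.
    have Li : L i = 0.
      apply: contrapT => /eqP nL; apply: ntx; exists i, i0; split; first by rewrite Li0.
      by rewrite -fx f0 Li0 /aff /dot !mul0r !add0r.
    move: ci; rewrite Li => /cvgr0_norm_le ci.
    apply/cvgr0Pnorm_le => r r0; have r20 : 0 < r / 2 by rewrite divr_gt0.
    apply: filterS (ci _ r20) => k hk; rewrite (le_trans (gtau_le k x))//.
    by rewrite mulrC -ler_pdivlMr.
  rewrite (_ : (fun k => grad (tau k) x) = fun k =>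
    (dppos (e k) (phi k x - d k) + dppos (e k) (- phi k x - d k)) *: grad (phi k) x); last first.
    by apply/funext => k.
  rewrite -[X in _ --> X]scale1r.
  have c1 : dppos (e k) (phi k x - d k) @[k --> \oo] --> ((0 < f x)%R%:R : R).
    by apply: cvg_dppos => //; rewrite -[f x]subr0; apply: cvgB.
  have c2 : dppos (e k) (- phi k x - d k) @[k --> \oo] --> ((0 < - f x)%R%:R : R).
    by apply: cvg_dppos; rewrite ?oppr_eq0//; rewrite -[- f x]subr0; apply: cvgB => //; exact: cvgN.
  have -> : (1 : R) = (0 < f x)%R%:R + (0 < - f x)%R%:R.
    by rewrite oppr_gt0; case: ltgtP fn0; rewrite ?addr0 ?add0r ?eqxx.
  by apply: cvgZ => //; exact: cvgD.
rewrite gS.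
have : grad (tau k) x - (L i).1 @[k --> \oo] --> (0 : R * R).
  by rewrite -[X in _ --> X](subrr (L i).1); apply: cvgB => //; exact: cvg_cst.
move/cvgr0_norm_le => cl0; apply/cvgr0Pnorm_le => r r0.
have r20 : 0 < r / 2 by rewrite divr_gt0.
apply: filterS (cl0 _ r20) => k hk; rewrite normr_enorm (le_trans (enorm_le_norm _))//.
by rewrite mulrC -ler_pdivlMr.
Unshelve. all: by end_near. Qed.

End VhLocal.

(** * The discrete spaces *)

Section FiniteDim.
Variables (R : realType) (E : lmodType R) (N : nat) (V : E -> Prop) (ev : E -> 'rV[R]_N).
Hypothesis V0 : V 0.
Hypothesis VD : forall (k : R) u v, V u -> V v -> V (k *: u + v).
Hypothesis evD : forall (k : R) u v, V u -> V v -> ev (k *: u + v) = k *: ev u + ev v.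

Lemma subspace_sum m (e : 'I_m -> E) (x : 'rV[R]_m) :
  (forall i, V (e i)) -> V (\sum_i x 0 i *: e i).
Proof.
move=> Ve; elim/big_rec: _ => // i u _ Vu; exact: VD.
Qed.

(* A family of members of [V] with independent images under [ev], of maximal size. *)
Lemma subspace_basis : exists m (e : 'I_m -> E),
  [/\ forall i, V (e i),
      forall x : 'rV[R]_m, ev (\sum_i x 0 i *: e i) = 0 -> x = 0 &
      forall v, V v -> exists x : 'rV[R]_m, ev v = ev (\sum_i x 0 i *: e i)].
Proof.
pose P (m : nat) := `[< exists e : 'I_m -> E, (forall i, V (e i)) /\
  row_free (\matrix_i ev (e i)) >].
have ev0 : ev 0 = 0.
  have := evD 1 V0 V0; rewrite scaler0 addr0 scale1r => /eqP.
  by rewrite -subr_eq subrr => /eqP <-.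
have evE m (e : 'I_m -> E) (x : 'rV[R]_m) : (forall i, V (e i)) ->
    ev (\sum_i x 0 i *: e i) = x *m (\matrix_i ev (e i)).
  move=> Ve; rewrite mulmx_sum_row.
  have [] : V (\sum_i x 0 i *: e i) /\
     ev (\sum_i x 0 i *: e i) = \sum_i x 0 i *: row i (\matrix_i ev (e i)).
    elim/big_rec2: _ => // i y1 y2 _ [Vy <-].
    by split; [exact: VD|rewrite evD// rowK].
  by [].
have exP : exists m, P m.
  exists 0%N; apply/asboolP; exists (fun=> 0); split => //.
  by rewrite /row_free -leqn0 rank_leq_row.
have bP m : P m -> (m <= N)%N.
  by move=> /asboolP[e [_ /eqP <-]]; exact: rank_leq_col.
case: (ex_maxnP exP bP) => m /asboolP[e [Ve fe]] maxm.
exists m, e; split => //.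
  move=> x; rewrite evE// => xe; apply: (row_free_inj fe).
  by rewrite xe mul0mx.
move=> v Vv; pose A := \matrix_i ev (e i).
have [/submxP[D vD]|nv] := boolP (ev v <= A)%MS.
  by exists D; rewrite evE.
have : P m.+1; last by move/maxm; rewrite ltnn.
apply/asboolP; exists (fun i => if unlift ord0 i is Some j then e j else v); split.
  by move=> i; case: unliftP.
have -> : (\matrix_i ev (if unlift ord0 i is Some j then e j else v)) = col_mx (ev v) A :> 'M[R]_(1 + m, N).
  apply/row_matrixP => i; rewrite rowK; case: (unliftP ord0 i) => [j ->|->].
    by rewrite (_ : lift ord0 j = rshift 1 j) ?rowKd ?rowK//; apply: val_inj.
  by rewrite (_ : ord0 = lshift m (ord0 : 'I_1)) ?rowKu ?row_id//; apply: val_inj.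
have rk : \rank (ev v + A) = \rank (col_mx (ev v) A) by rewrite addsmxE.
rewrite /row_free; apply/eqP; rewrite -rk.
(* A single row has rank at most one, so a nonzero intersection would contain it and place [ev v] in
   the row space of [A]. *)
have h : (ev v :&: A)%MS = 0 :> 'M[R]_N.
  apply/eqP; apply: contraNT nv => h.
  have := mxrankS (capmxSl (ev v) A); have : (0 < \rank (ev v :&: A))%N by rewrite lt0n mxrank_eq0.
  move=> r1 r2; have rv : (\rank (ev v) <= 1)%N by exact: rank_leq_row.
  have [_ rE] := mxrank_leqif_eq (capmxSl (ev v) A).
  have : (\rank (ev v :&: A) == \rank (ev v)) by rewrite eqn_leq r2 (leq_trans rv).
  rewrite rE => /andP[_ sv]; apply: submx_trans sv _; exact: capmxSr.
have := mxrank_sum_cap (ev v) A; rewrite h mxrank0 addn0 => ->.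
have -> : \rank A = m by apply/eqP.
suff -> : \rank (ev v) = 1%N by rewrite add1n.
apply/eqP; rewrite eqn_leq rank_leq_row /= lt0n mxrank_eq0.
by apply: contraNneq nv => ->; exact: sub0mx.
Qed.

End FiniteDim.

(** Double annihilator: a linear form that vanishes on the left kernel of [D] lies in the span of
    its columns. The vector [r] will be the list of pressure coefficients. *)
Lemma dual_combination (F : fieldType) k l (D : 'M[F]_(k, l)) (c : 'cV[F]_k) :
  (forall x : 'rV[F]_k, x *m D = 0 -> x *m c = 0) -> exists r : 'cV[F]_l, c = D *m r.
Proof.
move=> H; have : (c^T <= D^T)%MS.
  rewrite submxE; apply/eqP/trmx_inj; rewrite trmx_mul trmxK trmx0.
  apply/row_matrixP => i; rewrite row_mul row0; apply: H.
  rewrite -row_mul (_ : _ *m D = 0) ?row0//.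
  by apply: trmx_inj; rewrite trmx_mul trmxK trmx0 mulmx_coker.
by move/submxP => [r cr]; exists r^T; apply: trmx_inj; rewrite trmx_mul trmxK.
Qed.

(** * Piecewise affine integrands on the mesh interior *)

Section PiecewiseAffine.
Variables (R : realType) (Omega : set (R * R)) (T : seq {ffun 'I_3 -> R * R}).
Local Notation T2 := (measurableTypeR R * measurableTypeR R)%type.
Hypothesis oO : open Omega.
Hypothesis bO : bounded_set Omega.
Hypothesis cT : conforming_mesh Omega T.
Implicit Types (f g : R * R -> R) (x y : R * R).
Local Notation U := (mesh_interior Omega T).

Lemma eq_near_open (f g : R * R -> R) (A : set (R * R)) x : open A -> A x ->
  (forall y, A y -> f y = g y) -> \forall y \near x, f y = g y.
Proof.
move=> oA Ax fg; have : nbhs x A by exact: open_nbhs_nbhs.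
by apply: filterS => y; exact: fg.
Qed.

(** A common frame for V_h, Q_h and the components of X_h; nothing relates the pieces across an
    edge. *)
Definition PA f := exists l : {ffun 'I_3 -> R * R} -> (R * R) * R,
  forall K, K \in T -> forall x, interior (tri K) x -> f x = aff (l K) x.

Lemma PA_intro f :
  (forall K, K \in T -> exists l, forall x, interior (tri K) x -> f x = aff l x) -> PA f.
Proof.
move=> H; suff /choice[l lP] : forall K, exists l : (R * R) * R,
    K \in T -> forall x, interior (tri K) x -> f x = aff l x by exists l.
move=> K; have [KT|KT] := boolP (K \in T); last by exists 0.
by have [l Hl] := H K KT; exists l.
Qed.

Lemma PA_near f l x : (forall K, K \in T -> forall x, interior (tri K) x -> f x = aff (l K) x) ->
  U x -> exists2 K, K \in T & \forall y \near x, f y = dot (l K).1 y + (l K).2.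
Proof.
move=> fl [Ox [K KT iK]]; exists K => //.
by apply: (eq_near_open (@open_interior _ (tri K)) iK) => y; exact: fl.
Qed.

Lemma lin_fctE (k : R) f g x : (k *: f + g) x = k * f x + g x.
Proof. by []. Qed.

Lemma PA_lin (k : R) f g : PA f -> PA g -> PA (k *: f + g).
Proof.
move=> [l fl] [l' gl]; exists (fun K => k *: l K + l' K) => K KT x Kx.
by rewrite lin_fctE (fl K)// (gl K)// /aff /dot /= -![_ *: _]/(_ * _); ring.
Qed.

Lemma PA0 : PA 0.
Proof. by exists (fun=> 0) => K _ x _; rewrite /aff /dot /= !mul0r !addr0. Qed.

Lemma pd_lin (k : R) f g x i : PA f -> PA g -> U x ->
  pd i (k *: f + g) x = k * pd i f x + pd i g x.
Proof.
move=> [l fl] [l' gl] [Ox [K KT iK]].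
have oK := @open_interior _ (tri K).
have nf : \forall y \near x, f y = dot (l K).1 y + (l K).2.
  by apply: (eq_near_open oK iK) => y; exact: fl.
have ng : \forall y \near x, g y = dot (l' K).1 y + (l' K).2.
  by apply: (eq_near_open oK iK) => y; exact: gl.
have nfg : \forall y \near x, (k *: f + g) y = dot (k *: (l K).1 + (l' K).1) y + (k * (l K).2 + (l' K).2).
  apply: filterS2 nf ng => y fy gy.
  by rewrite lin_fctE fy gy /dot /= -![_ *: _]/(_ * _); ring.
by rewrite (pd_near_aff _ nfg) (pd_near_aff _ nf) (pd_near_aff _ ng); case: i.
Qed.

Lemma Vh_PA f : Vh Omega T f -> PA f.
Proof.
move=> /Vh_pieces[l fl]; exists l => K KT x Kx; apply: fl => //.
exact: interior_subset Kx.
Qed.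

(** An algebra containing the piecewise affine functions, their partial derivatives and the
    coefficients evaluated at them. Since [U] has finite measure, membership settles
    integrability. *)
Definition bm f := measurable_fun (U : set T2) f /\ exists M, forall x, U x -> `|f x| <= M.

Lemma measurable_U : measurable (U : set T2).
Proof. by apply: open_measurable2; exact: open_mesh_interior. Qed.

Lemma U_lty : (leb2 R U < +oo)%E.
Proof.
apply: le_lt_trans (Omega_lty oO bO); apply: le_measure; rewrite ?inE.
- exact: measurable_U.
- exact: open_measurable2.
- by move=> x [].
Qed.

Lemma bm_cst (c : R) : bm (fun=> c).
Proof. by split; [exact: measurable_cst|exists `|c|]. Qed.

Lemma bmD f g : bm f -> bm g -> bm (fun x => f x + g x).
Proof.
move=> [mf [M fM]] [mg [N gN]]; split; first exact: measurable_funD.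
by exists (M + N) => x Ux; rewrite (le_trans (ler_normD _ _))// lerD// ?fM ?gN.
Qed.

Lemma bmM f g : bm f -> bm g -> bm (fun x => f x * g x).
Proof.
move=> [mf [M fM]] [mg [N gN]]; split; first exact: measurable_funM.
by exists (M * N) => x Ux; rewrite normrM ler_pM// ?fM ?gN.
Qed.

Lemma bmZ (c : R) f : bm f -> bm (fun x => c * f x).
Proof. by move=> bf; apply: bmM => //; exact: bm_cst. Qed.

Lemma bmN f : bm f -> bm (fun x => - f x).
Proof. by move=> /(bmZ (-1)); under eq_fun do rewrite mulN1r. Qed.

Lemma bm_comp (h : R -> R) f : continuous h -> (exists M, forall s, `|h s| <= M) ->
  bm f -> bm (fun x => h (f x)).
Proof.
move=> ch [M hM] [mf _]; split; last by exists M.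
by apply: (@measurableT_comp _ _ _ _ _ _ h) => //; exact: continuous_measurable_fun.
Qed.

Lemma bm_norm f : bm f -> bm (fun x => `|f x|).
Proof.
move=> [mf [M fM]]; split; first exact: measurableT_comp.
by exists M => x Ux; rewrite normr_id fM.
Qed.

Lemma bm_enorm (v : R * R -> R * R) : bm (fun x => (v x).1) -> bm (fun x => (v x).2) ->
  bm (fun x => enorm (v x)).
Proof.
move=> [m1 [M1 b1]] [m2 [M2 b2]]; split.
  apply: (@measurableT_comp _ _ _ _ _ _ (@Num.sqrt R)).
    by apply: continuous_measurable_fun => x; exact: sqrt_continuous.
  by apply: measurable_funD; apply: measurable_funM.
by exists (M1 + M2) => x Ux; rewrite normr_enorm (le_trans (enorm_le _))// lerD// ?b1 ?b2.
Qed.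

Lemma PA_bm f : PA f -> bm f.
Proof.
move=> [l fl]; split.
  apply: continuous_measurable2; first exact: open_mesh_interior.
  move=> x; rewrite inE => Ux; have [K KT fK] := PA_near fl Ux.
  have fx : f x = dot (l K).1 x + (l K).2 := nbhs_singleton fK.
  rewrite /continuous_at fx; apply: cvg_trans (@continuous_aff R (l K).1 (l K).2 x).
  by apply: near_eq_cvg; apply: filterS fK => y ->.
have [r [r0 rO]] := Omega_bound bO.
exists (\sum_(K <- T) (enorm (l K).1 * r + `|(l K).2|)) => x Ux.
have [K KT fK] := PA_near fl Ux.
have -> : f x = dot (l K).1 x + (l K).2 := nbhs_singleton fK.
have le1 : `|dot (l K).1 x + (l K).2| <= enorm (l K).1 * r + `|(l K).2|.
  rewrite (le_trans (ler_normD _ _))// lerD2r (le_trans (dot_le _ _))//.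
  by rewrite ler_wpM2l ?enorm_ge0// rO//; case: Ux.
rewrite (le_trans le1)// (big_rem K)//= lerDl sumr_ge0// => *.
by rewrite addr_ge0// mulr_ge0// enorm_ge0.
Qed.

Lemma PA_pd_bm f i : PA f -> bm (pd i f).
Proof.
move=> [l fl]; have fE x : U x -> exists2 K, K \in T &
    \forall y \near x, pd i f y = if i then (l K).1.2 else (l K).1.1.
  move=> Ux; have [K KT fK] := PA_near fl Ux; exists K => //.
  by apply: filterS (nbhs_interior fK) => y fy; exact: pd_near_aff fy.
split.
  apply: continuous_measurable2; first exact: open_mesh_interior.
  move=> x; rewrite inE => Ux; have [K KT fK] := fE x Ux.
  rewrite /continuous_at (nbhs_singleton fK).
  apply: cvg_trans (@cst_continuous (R * R)%type R (if i then (l K).1.2 else (l K).1.1) x).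
  by apply: near_eq_cvg; apply: filterS fK => y ->.
exists (\sum_(K <- T) enorm (l K).1) => x Ux.
have [K KT fK] := fE x Ux; rewrite (nbhs_singleton fK).
have le1 : `|if i then (l K).1.2 else (l K).1.1| <= enorm (l K).1.
  by case: (i); [exact: snd_le_enorm|exact: fst_le_enorm].
by rewrite (le_trans le1)// (big_rem K)//= lerDl sumr_ge0// => *; exact: enorm_ge0.
Qed.

(** Holds for an arbitrary [f], because the integral ignores null sets even without measurability.
    Elementwise identities pass to [Omega] through it. *)
Lemma int2_U f : int2 Omega f = int2 U f.
Proof.
have [mN N0] := mesh_null oO cT.
rewrite /int2 /Rintegral; congr fine; rewrite [LHS]integral_mkcond [RHS]integral_mkcond.
rewrite (integral_null _ mN N0) [RHS](integral_null _ mN N0).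
apply: eq_integral => x _; rewrite !patchE; case: ifPn => //; rewrite inE /= => nx.
case: ifPn => xO; case: ifPn => xU //; rewrite ?inE ?notin_setE in xO xU.
  by exfalso; apply: nx.
by case: xU => /xO.
Qed.

Lemma nrm_U p f : p != 0 -> nrm Omega p f = nrm U p f.
Proof.
move=> p0; have [mN N0] := mesh_null oO cT.
rewrite (nrm_setD _ f p0 mN N0); congr nrm.
apply/seteqP; split => x; last by move=> Ux; split; [case: Ux|case].
by move=> [Ox nx]; apply: contrapT => nU; apply: nx.
Qed.

Lemma eq_int2_U f g : (forall x, U x -> f x = g x) -> int2 Omega f = int2 Omega g.
Proof.
move=> fg; rewrite !int2_U; apply: eq_Rintegral => x; rewrite inE; exact: fg.
Qed.

Lemma eq_nrm_U p f g : p != 0 -> (forall x, U x -> `|f x| = `|g x|) ->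
  nrm Omega p f = nrm Omega p g.
Proof.
move=> p0 fg; have [mN N0] := mesh_null oO cT.
apply: (eq_nrm _ mN N0) => x Ox nx; apply: fg.
by apply: contrapT => nU; apply: nx.
Qed.

Definition integrU f := (leb2 R).-integrable (U : set T2) (EFin \o f).

Lemma bm_integr f : bm f -> integrU f.
Proof.
move=> [mf [M fM]]; apply: measurable_bounded_integrable => //.
- exact: measurable_U.
- exact: U_lty.
by exists M; split; [exact: num_real|move=> r Mr x Ux /=; rewrite (le_trans (fM x Ux))// ltW].
Qed.

Lemma int2D f g : integrU f -> integrU g ->
  int2 Omega (fun x => f x + g x) = int2 Omega f + int2 Omega g.
Proof. by move=> If Ig; rewrite !int2_U /int2 RintegralD//; exact: measurable_U. Qed.

Lemma int2B f g : integrU f -> integrU g ->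
  int2 Omega (fun x => f x - g x) = int2 Omega f - int2 Omega g.
Proof. by move=> If Ig; rewrite !int2_U /int2 RintegralB//; exact: measurable_U. Qed.

Lemma int2Z (c : R) f : integrU f -> int2 Omega (fun x => c * f x) = c * int2 Omega f.
Proof. by move=> If; rewrite !int2_U /int2 RintegralZl//; exact: measurable_U. Qed.

Lemma int2_le f g : integrU f -> integrU g -> (forall x, U x -> f x <= g x) ->
  int2 Omega f <= int2 Omega g.
Proof. by move=> If Ig fg; rewrite !int2_U; apply: le_Rintegral => //; exact: measurable_U. Qed.

Lemma int2_ge0 f : (forall x, U x -> 0 <= f x) -> 0 <= int2 Omega f.
Proof. by move=> f0; rewrite int2_U; exact: Rintegral_ge0. Qed.

Lemma int2_norm f : integrU f -> `|int2 Omega f| <= int2 Omega (fun x => `|f x|).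
Proof. by move=> If; rewrite !int2_U; apply: le_normr_Rintegral => //; exact: measurable_U. Qed.

Lemma int2_cst (c : R) : int2 Omega (fun=> c) = c * fine (leb2 R U).
Proof. by rewrite int2_U /int2 Rintegral_cst//; exact: measurable_U. Qed.

(** A nonnegative function of zero integral vanishes almost everywhere, and a nonempty open set has
    positive measure. The form with an open set [A] suits integrands that are only locally
    continuous. *)
Lemma int2_eq0 f (A : set (R * R)) : bm f -> (forall x, U x -> 0 <= f x) ->
  int2 Omega f = 0 -> open A -> A `<=` U -> (forall x, A x -> 0 < f x) -> A = set0.
Proof.
move=> bf f0 If oA AU fA; apply: contrapT => /eqP/set0P A0.
have := leb2_open_gt0 oA A0.
have mA : measurable (A : set T2) by exact: open_measurable2.
have /integrableP[mf _] := bm_integr bf.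
have : (\int[leb2 R]_(x in U) `|(f x)%:E| = 0)%E.
  have <- : (\int[leb2 R]_(x in U) (f x)%:E = \int[leb2 R]_(x in U) `|(f x)%:E|)%E.
    by apply: eq_integral => x; rewrite inE => Ux; rewrite gee0_abs// lee_fin f0.
  have fn : (\int[leb2 R]_(x in U) (f x)%:E)%E \is a fin_num.
    by apply: integrable_fin_num; [exact: measurable_U|exact: bm_integr].
  by move: If; rewrite int2_U /int2 /Rintegral => If; rewrite -(fineK fn) If.
move/(ae_eq_integral_abs _ measurable_U mf) => -[N [mN N0 sN]].
have sAN : A `<=` N.
  move=> x Ax; apply: sN => /= /(_ (AU _ Ax)) [fx]; have := fA x Ax; by rewrite fx ltxx.
by rewrite (subset_measure0 mA mN sAN N0) ltxx.
Qed.

End PiecewiseAffine.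

Lemma subspace_basis_fin (R : realType) (E : lmodType R) (J : finType) (V : E -> Prop)
    (phi : J -> E -> R) :
  V 0 -> (forall (k : R) u v, V u -> V v -> V (k *: u + v)) ->
  (forall j (k : R) u v, V u -> V v -> phi j (k *: u + v) = k * phi j u + phi j v) ->
  exists m (e : 'I_m -> E), [/\ forall i, V (e i),
    forall x : 'rV[R]_m, (forall j, phi j (\sum_i x 0 i *: e i) = 0) -> x = 0 &
    forall v, V v -> exists x : 'rV[R]_m, forall j, phi j v = phi j (\sum_i x 0 i *: e i)].
Proof.
move=> V0 VD phiD.
pose ev (u : E) : 'rV[R]_#|J| := \row_j phi (enum_val j) u.
have evD (k : R) u v : V u -> V v -> ev (k *: u + v) = k *: ev u + ev v.
  by move=> Vu Vv; apply/rowP => j; rewrite !mxE phiD.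
have [m [e [Ve e0 eV]]] := subspace_basis V0 VD evD.
exists m, e; split => // [x H|v Vv].
  by apply: e0; apply/rowP => j; rewrite !mxE H.
have [x xE] := eV v Vv; exists x => j.
have := congr1 (fun w : 'rV_#|J| => w 0 (enum_rank j)) xE.
by rewrite !mxE enum_rankK.
Qed.

(** * Bases of spaces of piecewise affine functions *)

Section Bases.
Variables (R : realType) (Omega : set (R * R)) (T : seq {ffun 'I_3 -> R * R}).
Hypothesis oO : open Omega.
Implicit Types (f g : R * R -> R) (v w : R * R -> R * R) (x y : R * R).
Local Notation U := (mesh_interior Omega T).
Local Notation PA := (@PA R T).

Let cell (K : {ffun 'I_3 -> R * R}) : set (R * R) := Omega `&` interior (tri K).

Let open_cell K : open (cell K).
Proof. by apply: openI => //; exact: open_interior. Qed.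

Let pick_cell K : R * R := xget 0 (cell K).

Let cell_U K : K \in T -> cell K `<=` U.
Proof. by move=> KT x [Ox Kx]; split => //; exists K. Qed.

(* Linear forms (value and partial derivatives at one point of each cell) separating
   the piecewise affine functions up to equality on [U]. *)
Definition dof (j : 'I_(size T) * 'I_3) f : R :=
  let K := nth [ffun=> 0] T j.1 in
  if `[< cell K (pick_cell K) >] then
    if j.2 == ord0 then f (pick_cell K) else pd (j.2 == inord 2) f (pick_cell K)
  else 0.

Lemma dof_lin j (k : R) f g : PA f -> PA g ->
  dof j (k *: f + g) = k * dof j f + dof j g.
Proof.
move=> pf pg; rewrite /dof; case: asboolP => [cK|_]; last by rewrite mulr0 addr0.
case: ifP => _; first exact: lin_fctE.
by rewrite (@pd_lin _ Omega T)//; apply: cell_U cK; exact: mem_nth.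
Qed.

Lemma dof_eq0 f : PA f -> (forall j, dof j f = 0) -> forall x, U x -> f x = 0.
Proof.
move=> [l fl] f0 x [Ox [K KT Kx]].
have iK : (index K T < size T)%N by rewrite index_mem.
have nK : nth [ffun=> 0] T (Ordinal iK) = K by rewrite nth_index.
have cK : cell K (pick_cell K) by apply: (@xgetPex _ 0 (cell K)); exists x.
have nf : \forall y \near pick_cell K, f y = dot (l K).1 y + (l K).2.
  by apply: (eq_near_open (@open_interior _ (tri K)) cK.2) => y; exact: fl.
have d c := f0 (Ordinal iK, c).
have n10 : (inord 1 == ord0 :> 'I_3) = false by rewrite -val_eqE /= !inordK.
have n20 : (inord 2 == ord0 :> 'I_3) = false by rewrite -val_eqE /= !inordK.
have n12 : (inord 1 == inord 2 :> 'I_3) = false by rewrite -val_eqE /= !inordK.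
have := d ord0; have := d (inord 1); have := d (inord 2).
rewrite /dof /= nth_index// (asboolT cK) n10 n20 n12 !eqxx /= !(pd_near_aff _ nf).
move=> l2 l1; rewrite (nbhs_singleton nf) => l0.
have lK1 : (l K).1 = 0 by rewrite [LHS]surjective_pairing l1 l2.
have lK2 : (l K).2 = 0 by move: l0; rewrite lK1 /dot !mul0r !add0r.
by rewrite (fl K)// /aff lK1 lK2 /dot !mul0r !addr0.
Qed.

Lemma eq0_dof f : (forall x, U x -> f x = 0) -> forall j, dof j f = 0.
Proof.
move=> f0 j; rewrite /dof; case: asboolP => [cK|//].
set K := nth _ _ _ in cK *.
have cU : cell K `<=` U by apply: cell_U; exact: mem_nth.
case: ifP => _; first by apply: f0; exact: cU.
have nf : \forall y \near pick_cell K, f y = dot 0 y + 0.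
  apply: (eq_near_open (open_cell (K := K)) cK) => y cy.
  by rewrite f0; [rewrite /dot !mul0r !addr0|exact: cU].
by rewrite (pd_near_aff _ nf); case: ifP.
Qed.

Lemma sum_fctE m (x : 'rV[R]_m) (e : 'I_m -> R * R -> R) y :
  (\sum_i x 0 i *: e i) y = \sum_i x 0 i * e i y.
Proof. by rewrite fct_sumE; apply: eq_bigr. Qed.

Lemma PA_sum m (x : 'rV[R]_m) (e : 'I_m -> R * R -> R) :
  (forall i, PA (e i)) -> PA (\sum_i x 0 i *: e i).
Proof.
by move=> pe; elim/big_rec: _ => [|i f _ pf]; [exact: PA0|exact: PA_lin].
Qed.

Lemma pd_sum m (x : 'rV[R]_m) (e : 'I_m -> R * R -> R) y i :
  (forall i, PA (e i)) -> U y ->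
  pd i (\sum_j x 0 j *: e j) y = \sum_j x 0 j * pd i (e j) y.
Proof.
move=> pe Uy.
suff [] : PA (\sum_j x 0 j *: e j) /\
  pd i (\sum_j x 0 j *: e j) y = \sum_j x 0 j * pd i (e j) y by [].
elim/big_rec2: _ => [|j r f _ [pf fE]].
  split; first exact: PA0.
  have nf : \forall z \near y, (0 : R * R -> R) z = dot 0 z + 0.
    by near=> z; rewrite /dot !mul0r !addr0.
  by rewrite (pd_near_aff _ nf); case: ifP.
by split; [exact: PA_lin|rewrite (@pd_lin _ Omega T)// fE].
Unshelve. all: by end_near. Qed.

(** Freeness and spanning refer to [U], since the piecewise affine form leaves values off the open
    triangles unconstrained. *)
Lemma PA_basis (V : (R * R -> R) -> Prop) : V 0 ->
  (forall (k : R) f g, V f -> V g -> V (k *: f + g)) -> (forall f, V f -> PA f) ->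
  exists m (e : 'I_m -> R * R -> R), [/\ forall i, V (e i),
    forall x : 'rV[R]_m, (forall y, U y -> (\sum_i x 0 i *: e i) y = 0) -> x = 0 &
    forall f, V f -> exists x : 'rV[R]_m, forall y, U y -> f y = (\sum_i x 0 i *: e i) y].
Proof.
move=> V0 VD VPA.
have [|m [e [Ve e0 eV]]] := @subspace_basis_fin R _ _ V dof V0 VD.
  by move=> j k f g Vf Vg; apply: dof_lin; exact: VPA.
exists m, e; split => // [x H|f Vf]; first by apply: e0; exact: eq0_dof.
have [x xE] := eV f Vf; exists x => y Uy.
have pe : PA (\sum_i x 0 i *: e i) by apply: PA_sum => i; exact: VPA.
have := @dof_eq0 ((-1) *: f + \sum_i x 0 i *: e i) (PA_lin (-1) (VPA _ Vf) pe) _ y Uy.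
rewrite lin_fctE mulN1r => H; apply/esym/eqP; rewrite -subr_eq0 addrC; apply/eqP; apply: H => j.
by rewrite dof_lin ?xE ?mulN1r ?addNr//; exact: VPA.
Qed.

Definition PAv v := PA (fun x => (v x).1) /\ PA (fun x => (v x).2).

Lemma PAv_lin (k : R) v w : PAv v -> PAv w -> PAv (k *: v + w).
Proof.
move=> [v1 v2] [w1 w2]; split; first exact: (PA_lin k v1 w1).
exact: (PA_lin k v2 w2).
Qed.

Lemma PAv_sum m (x : 'rV[R]_m) (e : 'I_m -> R * R -> R * R) :
  (forall i, PAv (e i)) -> PAv (\sum_i x 0 i *: e i).
Proof.
move=> pe; elim/big_rec: _ => [|i f _ pf]; last exact: PAv_lin.
by split; exact: PA0.
Qed.

Lemma sum_vfctE m (x : 'rV[R]_m) (e : 'I_m -> R * R -> R * R) y :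
  (\sum_i x 0 i *: e i) y = \sum_i x 0 i *: e i y.
Proof. by rewrite fct_sumE; apply: eq_bigr. Qed.

Lemma PAv_basis (V : (R * R -> R * R) -> Prop) : V 0 ->
  (forall (k : R) v w, V v -> V w -> V (k *: v + w)) -> (forall v, V v -> PAv v) ->
  exists m (e : 'I_m -> R * R -> R * R), [/\ forall i, V (e i),
    forall x : 'rV[R]_m, (forall y, U y -> (\sum_i x 0 i *: e i) y = 0) -> x = 0 &
    forall v, V v -> exists x : 'rV[R]_m, forall y, U y -> v y = (\sum_i x 0 i *: e i) y].
Proof.
move=> V0 VD VPA.
pose dofv (j : bool * ('I_(size T) * 'I_3)) v :=
  if j.1 then dof j.2 (fun x => (v x).1) else dof j.2 (fun x => (v x).2).
have dofvD j (k : R) v w : V v -> V w -> dofv j (k *: v + w) = k * dofv j v + dofv j w.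
  move=> /VPA[v1 v2] /VPA[w1 w2]; rewrite /dofv; case: ifP => _.
    exact: (dof_lin _ k v1 w1).
  exact: (dof_lin _ k v2 w2).
have [m [e [Ve e0 eV]]] := @subspace_basis_fin R _ _ V dofv V0 VD dofvD.
exists m, e; split => // [x H|f Vf].
  by apply: e0 => -[b j]; rewrite /dofv /=; case: b; apply: eq0_dof => y /H ->.
have [x xE] := eV f Vf; exists x => y Uy.
have [p1 p2] : PAv (\sum_i x 0 i *: e i) by apply: PAv_sum => i; exact: VPA.
have [f1 f2] := VPA _ Vf.
rewrite [LHS]surjective_pairing [RHS]surjective_pairing.
have H1 := @dof_eq0 _ (PA_lin (-1) f1 p1) _ y Uy.
have H2 := @dof_eq0 _ (PA_lin (-1) f2 p2) _ y Uy.
rewrite !lin_fctE !mulN1r in H1 H2.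
congr pair; apply/esym/eqP; rewrite -subr_eq0 addrC; apply/eqP.
  apply: H1 => j; rewrite dof_lin// mulN1r addrC; apply/eqP; rewrite subr_eq0; apply/eqP/esym.
  exact: (xE (true, j)).
apply: H2 => j; rewrite dof_lin// mulN1r addrC; apply/eqP; rewrite subr_eq0; apply/eqP/esym.
exact: (xE (false, j)).
Qed.

End Bases.

(** * V_h, X_h and Q_h as vector spaces *)

Section Spaces.
Variables (R : realType) (Omega : set (R * R)) (T : seq {ffun 'I_3 -> R * R}).
Local Notation T2 := (measurableTypeR R * measurableTypeR R)%type.
Hypothesis oO : open Omega.
Hypothesis bO : bounded_set Omega.
Hypothesis cT : conforming_mesh Omega T.
Implicit Types (f g : R * R -> R) (v w : R * R -> R * R) (x y : R * R).
Local Notation U := (mesh_interior Omega T).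
Local Notation integrU := (integrU Omega T).
Local Notation bm := (bm Omega T).

(** The part of [Omega] outside [U] is null, so it contains no nonempty open set. *)
Lemma mesh_dense (A : set (R * R)) : open A -> (Omega `&` A) !=set0 -> (U `&` A) !=set0.
Proof.
move=> oA A0; apply: contrapT => N.
have [mN N0] := mesh_null oO cT.
have oOA : open (Omega `&` A) by exact: openI.
have := leb2_open_gt0 oOA A0.
rewrite (subset_measure0 (open_measurable2 oOA) mN _ N0) ?ltxx//.
by move=> x [Ox Ax]; split => // Ux; apply: N; exists x.
Qed.

Lemma Vh0 : Vh Omega T 0.
Proof.
split => [x|K _|//]; first exact: cvg_cst.
by exists 0, 0 => x _; rewrite /dot !mul0r !addr0.
Qed.

Lemma Vh_lin (k : R) f g : Vh Omega T f -> Vh Omega T g -> Vh Omega T (k *: f + g).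
Proof.
move=> [cf pf bf] [cg pg bg]; split.
- move=> x; apply: (@cvgD _ _ _ _ _ (fun x => k * f x) g); last exact: cg.
  by apply: (@cvgM _ _ _ _ (fun=> k) f); [exact: cvg_cst|exact: cf].
- move=> K KT; have [a [b ab]] := pf K KT; have [c [d cd]] := pg K KT.
  exists (k *: a + c), (k * b + d) => x Kx.
  by rewrite lin_fctE ab// cd// dotDl dotZl; ring.
- by move=> x bx; rewrite lin_fctE bf// bg// mulr0 addr0.
Qed.

Lemma Vh_eq0 f : Vh Omega T f -> (forall x, U x -> f x = 0) -> forall x, Omega x -> f x = 0.
Proof.
move=> Vf f0 x Ox; apply: contrapT => /eqP fx.
have cf : {for x, continuous f} by apply: (Vh_continuous oO Vf); rewrite inE.
have nx : \forall y \near x, f y != 0 by exact: (cvgr_neq0 _ cf).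
have [y [Uy]] : (U `&` interior [set y | f y != 0]) !=set0.
  by apply: mesh_dense; [exact: open_interior|exists x; split].
by move=> /interior_subset /=; rewrite f0// eqxx.
Qed.

Lemma Vh_eq f g : Vh Omega T f -> Vh Omega T g -> (forall x, U x -> f x = g x) ->
  forall x, Omega x -> f x = g x.
Proof.
move=> Vf Vg fg x Ox; apply/esym/eqP; rewrite -subr_eq0 addrC -mulN1r -lin_fctE.
apply/eqP; apply: Vh_eq0 Ox; first exact: Vh_lin.
by move=> y Uy; rewrite lin_fctE fg// mulN1r addNr.
Qed.

Lemma Vh_sum m (c : 'rV[R]_m) (e : 'I_m -> R * R -> R) :
  (forall i, Vh Omega T (e i)) -> Vh Omega T (\sum_i c 0 i *: e i).
Proof. by move=> Ve; apply: subspace_sum => //; [exact: Vh0|exact: Vh_lin]. Qed.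

Lemma continuous_bm f : continuous f -> bm f.
Proof.
move=> cf; split.
  by apply: continuous_measurable2; [exact: open_mesh_interior|move=> x _; exact: cf].
have [r [r0 rO]] := Omega_bound bO.
have cb : compact (`[- r, r]%classic `*` `[- r, r]%classic : set (R * R)).
  by apply: compact_setX; exact: segment_compact.
have [M [_ HM]] : bounded_set (f @` (`[- r, r]%classic `*` `[- r, r]%classic)).
  apply: compact_bounded; apply: continuous_compact => //.
  exact: continuous_subspaceT.
exists (`|M| + 1) => x [Ox _]; apply: (HM (`|M| + 1)); first by rewrite ltr_pwDr// ler_norm.
exists x => //; have xr := rO x Ox.
have x1 := le_trans (fst_le_enorm x) xr; have x2 := le_trans (snd_le_enorm x) xr.
by split; rewrite /= in_itv /= -ler_norml.
Qed.

Lemma test_fun_bm phi : test_fun Omega phi -> bm phi /\ forall i, bm (pd i phi).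
Proof.
case=> s _ _; split=> [|i]; apply: continuous_bm => x; apply: differentiable_continuous.
  exact: (s [::]).
exact: (s [:: i]).
Qed.

(** Weak divergences, normal traces and the force pair functions that are only square integrable;
    products of two of these are integrable because [|f g| <= f^2 + g^2]. *)
Definition L2U f := measurable_fun (U : set T2) f /\ integrU (fun x => f x * f x).

Lemma integrUD f g : integrU f -> integrU g -> integrU (fun x => f x + g x).
Proof. by move=> If Ig; exact: (integrableD (measurable_U T oO) If Ig). Qed.

Lemma integrUZ (c : R) f : integrU f -> integrU (fun x => c * f x).
Proof. by move=> If; exact: (integrableZl (measurable_U T oO) c If). Qed.

Lemma integrU_le f g : measurable_fun (U : set T2) f -> integrU g ->
  (forall x, U x -> `|f x| <= `|g x|) -> integrU f.
Proof.
move=> mf Ig fg; apply: (le_integrable (measurable_U T oO) _ _ Ig).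
  exact/measurable_EFinP.
by move=> x Ux; rewrite !abse_EFin lee_fin; exact: fg.
Qed.

Lemma L2U_mul f g : L2U f -> L2U g -> integrU (fun x => f x * g x).
Proof.
move=> [mf If] [mg Ig]; apply: (@integrU_le _ (fun x => f x * f x + g x * g x)).
- exact: measurable_funM.
- exact: integrUD.
move=> x _; rewrite [leRHS]ger0_norm -?expr2 ?addr_ge0 ?sqr_ge0// normrM.
have := sqr_ge0 (`|f x| - `|g x|); rewrite -(real_normK (num_real (f x))) -(real_normK (num_real (g x))).
have := sqr_ge0 `|f x|; have := sqr_ge0 `|g x|; nra.
Qed.

Lemma bm_L2U f : bm f -> L2U f.
Proof. by move=> bf; split; [case: bf|apply: bm_integr => //; exact: bmM]. Qed.

Lemma L2U_lin (k : R) f g : L2U f -> L2U g -> L2U (k *: f + g).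
Proof.
move=> Lf Lg; have Ifg := L2U_mul Lf Lg; have [mf If] := Lf; have [mg Ig] := Lg.
have mfg : measurable_fun (U : set T2) (k *: f + g).
  apply: (@measurable_funD _ _ _ _ (fun x => k * f x) g) => //.
  by apply: measurable_funM => //; exact: measurable_cst.
split => //.
rewrite (_ : (fun x => _) = fun x => k * k * (f x * f x) + (2 * k * (f x * g x) + g x * g x)).
  by apply: integrUD; [exact: integrUZ|apply: integrUD => //; exact: integrUZ].
by apply/funext => x; rewrite lin_fctE; ring.
Qed.

Lemma Lp2P f : measurable_fun (Omega : set T2) f -> Lp Omega 2 f <-> L2U f.
Proof.
move=> mf; have mU : measurable_fun (U : set T2) f.
  by apply: measurable_funS mf; [exact: open_measurable2|move=> x []].
have e : (\int[leb2 R]_(x in U) `|(f x * f x)%:E| = \int[leb2 R]_(x in U) (`|f x| `^ 2)%:E)%E.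
  apply: eq_integral => x _; rewrite abse_EFin normrM -expr2.
  by rewrite -(@powR_mulrn _ _ 2).
split.
  move=> [_]; rewrite (nrm_U oO cT) ?pnatr_eq0// nrmE// => /lty_poweRy h.
  split => //; apply/integrableP; split.
    by apply/measurable_EFinP; exact: measurable_funM.
  by rewrite e h// invr_eq0 pnatr_eq0.
move=> [_ /integrableP[_]]; rewrite e => h; split => //.
by rewrite (nrm_U oO cT) ?pnatr_eq0// nrmE// poweR_lty.
Qed.

Lemma Lp2_L2U f : Lp Omega 2 f -> L2U f.
Proof. by move=> Lf; apply/Lp2P => //; case: Lf. Qed.

Lemma Lp2_lin (k : R) f g : Lp Omega 2 f -> Lp Omega 2 g -> Lp Omega 2 (k *: f + g).
Proof.
move=> Lf Lg; have m : measurable_fun (Omega : set T2) (k *: f + g).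
  apply: (@measurable_funD _ _ _ _ (fun x => k * f x) g); last by case: Lg.
  by apply: measurable_funM; [exact: measurable_cst|case: Lf].
by apply/(Lp2P m)/L2U_lin; exact: Lp2_L2U.
Qed.

Lemma Lp20 : Lp Omega 2 (0 : R * R -> R).
Proof.
have m : measurable_fun (Omega : set T2) (0 : R * R -> R) by exact: measurable_cst.
by apply/(Lp2P m)/bm_L2U; exact: bm_cst.
Qed.

Lemma int2_lin (k : R) f g : integrU f -> integrU g ->
  int2 Omega (fun x => k * f x + g x) = k * int2 Omega f + int2 Omega g.
Proof. by move=> If Ig; rewrite (int2D oO cT (integrUZ k If) Ig) (int2Z oO cT). Qed.

Lemma dot_integr v w : L2U (fun x => (v x).1) -> L2U (fun x => (v x).2) ->
  L2U (fun x => (w x).1) -> L2U (fun x => (w x).2) -> integrU (fun x => dot (v x) (w x)).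
Proof. by move=> *; apply: integrUD; exact: L2U_mul. Qed.

Lemma int2_0 : int2 Omega (fun=> 0 : R) = 0.
Proof. by rewrite (int2_cst oO cT) mul0r. Qed.

Lemma H0div0 : H0div Omega (0 : R * R -> R * R).
Proof.
exists 0.
  split; [split; exact: Lp20|exact: Lp20|move=> phi _].
  rewrite (_ : (fun x => _) = fun=> 0); last by apply/funext => x; rewrite /dot !mul0r addr0.
  rewrite [in RHS](_ : (fun x => _) = fun=> 0); last by apply/funext => x; rewrite mul0r.
  by rewrite int2_0 oppr0.
move=> f g _; rewrite (_ : (fun x => _) = fun=> 0) ?int2_0//.
by apply/funext => x; rewrite /dot !mul0r !addr0.
Qed.

Lemma H0div_lin (k : R) v w : H0div Omega v -> H0div Omega w -> H0div Omega (k *: v + w).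
Proof.
move=> [d [[v1 v2] Ld vd] vn] [d' [[w1 w2] Ld' wd] wn].
have [v1' v2' d1] := And3 (Lp2_L2U v1) (Lp2_L2U v2) (Lp2_L2U Ld).
have [w1' w2' d2] := And3 (Lp2_L2U w1) (Lp2_L2U w2) (Lp2_L2U Ld').
exists (k *: d + d').
  split; [split; [exact: (Lp2_lin k v1 w1)|exact: (Lp2_lin k v2 w2)]|exact: Lp2_lin|].
  move=> phi tphi; have [bp bpd] := test_fun_bm tphi.
  have p := bm_L2U bp; have p1 := bm_L2U (bpd false); have p2 := bm_L2U (bpd true).
  rewrite (_ : (fun x => _) = fun x => k * dot (v x) (grad phi x) + dot (w x) (grad phi x)); last first.
    by apply/funext => x; rewrite dotDl dotZl.
  rewrite [in RHS](_ : (fun x => _) = fun x => k * (d x * phi x) + d' x * phi x); last first.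
    by apply/funext => x; rewrite lin_fctE; ring.
  rewrite int2_lin; [|exact: dot_integr|exact: dot_integr].
  rewrite int2_lin; [|exact: L2U_mul|exact: L2U_mul].
  by rewrite vd// wd//; ring.
move=> f g fg; have [Lf [Lg1 Lg2] _] := fg.
have [f1 g1 g2] := And3 (Lp2_L2U Lf) (Lp2_L2U Lg1) (Lp2_L2U Lg2).
rewrite (_ : (fun x => _) = fun x =>
  k * (dot (v x) (g x) + d x * f x) + (dot (w x) (g x) + d' x * f x)); last first.
  by apply/funext => x; rewrite dotDl dotZl lin_fctE; ring.
rewrite int2_lin; first by rewrite vn// wn// mulr0 addr0.
  by apply: integrUD; [exact: dot_integr|exact: L2U_mul].
by apply: integrUD; [exact: dot_integr|exact: L2U_mul].
Qed.

Lemma Xh0 : Xh Omega T 0.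
Proof.
split; first exact: H0div0.
by move=> K _; exists 0, 0 => x _; rewrite scale0r addr0.
Qed.

Lemma Xh_lin (k : R) v w : Xh Omega T v -> Xh Omega T w -> Xh Omega T (k *: v + w).
Proof.
move=> [Hv pv] [Hw pw]; split; first exact: H0div_lin.
move=> K KT; have [a [b ab]] := pv K KT; have [c [d cd]] := pw K KT.
exists (k * a + c), (k *: b + d) => x Kx.
have -> : (k *: v + w) x = k *: v x + w x by [].
rewrite ab// cd// scalerDr scalerDl scalerA -!addrA; congr (_ + _).
by rewrite addrCA.
Qed.

Lemma Xh_PAv v : Xh Omega T v -> PAv T v.
Proof.
move=> [_ pv]; split; apply: PA_intro => K KT; have [a [b ab]] := pv K KT.
  exists ((a, 0), b.1) => x Kx; rewrite ab// /aff /dot /=.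
  by rewrite -![_ *: _]/(_ * _); ring.
exists ((0, a), b.2) => x Kx; rewrite ab// /aff /dot /=.
by rewrite -![_ *: _]/(_ * _); ring.
Qed.

Lemma Qh0 : Qh Omega T 0.
Proof. by split; [exact: Lp20|exact: int2_0|move=> K _; exists 0]. Qed.

Lemma Qh_lin (k : R) f g : Qh Omega T f -> Qh Omega T g -> Qh Omega T (k *: f + g).
Proof.
move=> [Lf f0 pf] [Lg g0 pg]; split; first exact: Lp2_lin.
  have L1 : L2U (fun=> 1 : R) by apply: bm_L2U; exact: bm_cst.
  have I f' : Lp Omega 2 f' -> integrU f'.
    move=> /Lp2_L2U Lf'; have := L2U_mul L1 Lf'.
    by under [X in integrU X]eq_fun do rewrite mul1r.
  by rewrite [LHS](int2_lin k (I _ Lf) (I _ Lg)) f0 g0 mulr0 addr0.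
move=> K KT; have [c cE] := pf K KT; have [d dE] := pg K KT.
by exists (k * c + d) => x Kx; rewrite lin_fctE cE// dE.
Qed.

Lemma Qh_PA f : Qh Omega T f -> PA T f.
Proof.
move=> [_ _ pf]; apply: PA_intro => K KT; have [c cE] := pf K KT.
by exists (0, c) => x Kx; rewrite cE// /aff /dot /= !mul0r !add0r.
Qed.

End Spaces.

(** * Hoelder inequalities for two and three factors *)

Section Hoelder.
Variables (R : realType) (Omega : set (R * R)) (T : seq {ffun 'I_3 -> R * R}).
Local Notation T2 := (measurableTypeR R * measurableTypeR R)%type.
Hypothesis oO : open Omega.
Hypothesis bO : bounded_set Omega.
Hypothesis cT : conforming_mesh Omega T.
Implicit Types (f g : R * R -> R) (v w : R * R -> R * R) (x y : R * R) (p q r : R).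
Local Notation U := (mesh_interior Omega T).
Local Notation bm := (bm Omega T).
Local Notation mu := (leb2 R).

Lemma nrm_UE p f : 0 < p ->
  nrm Omega p f = ((\int[mu]_(x in U) (`|f x| `^ p)%:E) `^ p^-1)%E.
Proof. by move=> p0; rewrite (nrm_U oO cT) ?gt_eqF// nrmE. Qed.

Lemma hoelder_U p q f g : 0 < p -> 0 < q -> p^-1 + q^-1 = 1 ->
  measurable_fun (U : set T2) f -> measurable_fun (U : set T2) g ->
  (\int[mu]_(x in U) `|f x * g x|%:E <= nrm Omega p f * nrm Omega q g)%E.
Proof.
move=> p0 q0 pq mf mg; have mU := measurable_U T oO.
have m (h : R * R -> R) : measurable_fun (U : set T2) h -> measurable_fun (setT : set T2) (h \_ U).
  by move=> mh; exact: (measurable_restrictT h mU).1.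
have := hoelder mu (m f mf) (m g mg) p0 q0 pq.
rewrite -[X in (_ <= X * _)%E]/(nrm U p f) -[X in (_ <= _ * X)%E]/(nrm U q g).
rewrite -!(nrm_U oO cT) ?gt_eqF//; apply: le_trans.
rewrite Lnorm1 [leLHS]integral_mkcond le_eqVlt; apply/orP; left; apply/eqP.
apply: eq_integral => x _ /=; rewrite !patchE; case: ifP => _ //.
by rewrite mulr0 normr0.
Qed.

Lemma bm_nrm_lty p f : 0 < p -> bm f -> (nrm Omega p f < +oo)%E.
Proof.
move=> p0 [mf [M fM]]; rewrite (nrm_U oO cT) ?gt_eqF//.
by apply: (nrm_bounded_lty (M := M)) => //; [exact: measurable_U|exact: U_lty].
Qed.

Lemma bm_nrm_fin p f : 0 < p -> bm f -> nrm Omega p f \is a fin_num.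
Proof. by move=> p0 bf; rewrite ge0_fin_numE ?nrm_ge0// bm_nrm_lty. Qed.

Lemma int2_EFin f : integrU Omega T f -> (int2 Omega f)%:E = (\int[mu]_(x in U) (f x)%:E)%E.
Proof.
move=> If; rewrite (int2_U oO cT) /int2 /Rintegral fineK//.
by apply: integrable_fin_num => //; exact: measurable_U.
Qed.

Lemma hoelder_int2 p q f g : 0 < p -> 0 < q -> p^-1 + q^-1 = 1 -> bm f -> bm g ->
  int2 Omega (fun x => `|f x * g x|) <= fine (nrm Omega p f) * fine (nrm Omega q g).
Proof.
move=> p0 q0 pq bf bg.
have bfg : bm (fun x => `|f x * g x|) by apply: bm_norm; exact: bmM.
rewrite -lee_fin int2_EFin; last exact: bm_integr.
rewrite EFinM !fineK ?bm_nrm_fin//; apply: hoelder_U => //; [by case: bf|by case: bg].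
Qed.

Lemma nrm_sqr p f : 0 < p -> bm f ->
  fine (nrm Omega (p / 2) (fun x => f x * f x)) = fine (nrm Omega p f) ^+ 2.
Proof.
move=> p0 bf; have p20 : 0 < p / 2 by rewrite divr_gt0.
rewrite !nrm_UE// !fine_poweR.
have -> : (\int[mu]_(x in U) (`|f x * f x| `^ (p / 2))%:E = \int[mu]_(x in U) (`|f x| `^ p)%:E)%E.
  apply: eq_integral => x _; congr EFin.
  rewrite normrM -expr2 -(@powR_mulrn _ _ 2)// -powRrM; congr (_ `^ _).
  by rewrite mulrCA mulfV ?mulr1// pnatr_eq0.
rewrite invf_div -(@powR_mulrn _ _ 2) ?powR_ge0// -powRrM; congr (_ `^ _).
by rewrite mulrC.
Qed.

(** Hoelder with exponents 2, 2 separates [b] from [a c]; applied again to [a^2 c^2] with exponents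
    [p/2], [q/2], it separates [a] from [c]. These are conjugate since [1/p + 1/q = 1/2]. *)
Lemma hoelder3 p q a b c : 0 < p -> 0 < q -> p^-1 + 2^-1 + q^-1 = 1 ->
  bm a -> bm b -> bm c ->
  int2 Omega (fun x => `|a x * b x * c x|) <=
    fine (nrm Omega p a) * fine (nrm Omega 2 b) * fine (nrm Omega q c).
Proof.
move=> p0 q0 pq ba bb bc.
have bac : bm (fun x => a x * c x) by exact: bmM.
have -> : int2 Omega (fun x => `|a x * b x * c x|) = int2 Omega (fun x => `|b x * (a x * c x)|).
  by congr int2; apply/funext => x; congr (`|_|); ring.
have h2 : (2 : R)^-1 + 2^-1 = 1 by field.
have t2 : 0 < 2 :> R by [].
apply: (le_trans (hoelder_int2 t2 t2 h2 bb bac)).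
rewrite [leRHS]mulrAC [leRHS]mulrC ler_wpM2l ?fine_ge0 ?nrm_ge0//.
rewrite -(ler_pXn2r (n := 2))// ?nnegrE ?mulr_ge0 ?fine_ge0 ?nrm_ge0//.
rewrite exprMn -!nrm_sqr// divff ?pnatr_eq0//.
have -> : nrm Omega 1 (fun x => (a x * c x) * (a x * c x)) =
   nrm Omega 1 (fun x => (a x * a x) * (c x * c x)).
  by congr nrm; apply/funext => x; ring.
have baa : bm (fun x => a x * a x) by exact: bmM.
have bcc : bm (fun x => c x * c x) by exact: bmM.
have bb2 : bm (fun x => (a x * a x) * (c x * c x)) by exact: bmM.
have e : fine (nrm Omega 1 (fun x => (a x * a x) * (c x * c x))) =
   int2 Omega (fun x => `|(a x * a x) * (c x * c x)|).
  rewrite nrm_UE// invr1 poweRe1; last by apply: integral_ge0 => x _; rewrite lee_fin powR_ge0.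
  rewrite (int2_U oO cT) /int2 /Rintegral; congr fine; apply: eq_integral => x _.
  by rewrite powRr1.
rewrite e; apply: hoelder_int2 => //; rewrite ?divr_gt0//.
rewrite !invf_div; move: pq; move: (p^-1) (q^-1) => s t; lra.
Qed.

End Hoelder.

(** * The gradient norm separates functions of V_h *)

Section Uniqueness.
Variables (R : realType) (Omega : set (R * R)) (T : seq {ffun 'I_3 -> R * R}).
Hypothesis oO : open Omega.
Hypothesis bO : bounded_set Omega.
Hypothesis cT : conforming_mesh Omega T.
Implicit Types (S : R * R -> R) (x y : R * R) (p : R).
Local Notation U := (mesh_interior Omega T).

(* Otherwise [|S|] would take, by the intermediate value theorem, a positive value that is
   none of the finitely many constants it assumes on the cells. *)
Lemma Vh_grad_eq0 S : Vh Omega T S -> (forall x, U x -> grad S x = 0) ->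
  forall x, Omega x -> S x = 0.
Proof.
move=> VS gS x0 Ox0; apply: contrapT => /eqP Sx0.
have [l Sl] := Vh_pieces VS.
have cf := Vh_ext_continuous oO VS.
set f := S \_ (closure Omega) in cf.
have fS x : Omega x -> f x = S x.
  by move=> Ox; rewrite /f patchE mem_set//; exact: subset_closure.
have fN x : ~ Omega x -> f x = 0.
  move=> nO; rewrite /f patchE; case: ifPn => // cx.
  have [_ _ S0] := VS; rewrite S0//; split; first by rewrite inE in cx.
  by rewrite (interior_id Omega).1.
have sU x : U x -> exists2 K, K \in T & S x = (l K).2.
  move=> Ux; have [K KT nK] := Vh_near Sl Ux; exists K => //.
  have g0 : (l K).1 = 0 by rewrite -(gS x Ux); apply/esym; exact: grad_near_aff nK.
  by have := nbhs_singleton nK; rewrite /aff g0 /dot !mul0r !add0r.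
pose m : R := \big[Order.min/`|S x0|]_(K <- T | (l K).2 != 0) `|(l K).2|.
have m0 : 0 < m.
  rewrite /m; elim/big_ind: _ => [|a b a0 b0|K K0]; rewrite ?normr_gt0//.
  by rewrite lt_min a0.
have mS : m <= `|S x0| by exact: bigmin_le_id.
have mK K : K \in T -> (l K).2 != 0 -> m <= `|(l K).2|.
  by move=> KT K0; apply: ge_bigmin_seq.
pose c := m / 2; have c0 : 0 < c by rewrite divr_gt0.
have cm : c < m by rewrite /c; lra.
have cK K : K \in T -> c != `|(l K).2|.
  move=> KT; have [->|K0] := eqVneq (l K).2 0; first by rewrite normr0 gt_eqF.
  by rewrite lt_eqF// (lt_le_trans cm)// mK.
have [r [r0 rO]] := Omega_bound bO.
(* A point outside [Omega], where the extension vanishes, so that [|f|] runs from [|S x0|] to 0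
   along the segment. *)
pose y0 : R * R := (r + 1, 0).
have y0O : ~ Omega y0.
  move=> /rO; have := fst_le_enorm y0; rewrite /= ger0_norm; last by rewrite addr_ge0.
  by move=> h1 h2; have := le_trans h1 h2; rewrite leNgt ltrDl ltr01.
pose P (t : R) : R * R := x0 + t *: (y0 - x0).
have cP : continuous P.
  by move=> t; apply: cvgD; [exact: cvg_cst|apply: cvgZr_tmp; exact: cvg_id].
have cg : continuous (fun t => `|f (P t)|).
  by move=> t; apply: cvg_norm; apply: (@continuous_comp _ _ _ P f); [exact: cP|exact: cf].
have P0 : P 0 = x0 by rewrite /P scale0r addr0.
have P1 : P 1 = y0 by rewrite /P scale1r addrCA subrr addr0.
have [||t _ ft] := @IVT R (fun t => `|f (P t)|) 0 1 c ler01.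
- exact: continuous_subspaceT.
- rewrite P0 P1 (fN _ y0O) normr0 fS// ge_min le_max (ltW c0) orbT /=.
  by rewrite (ltW (lt_le_trans cm mS)).
have Ow : Omega (P t).
  by apply: contrapT => /fN fw; move: ft; rewrite fw normr0 => e; rewrite e ltxx in c0.
have cw : {for P t, continuous (fun z => `|f z|)} by apply: cvg_norm; exact: cf.
have nw1 K : K \in T -> \forall z \near P t, `|f z| != `|(l K).2|.
  move=> KT; have : \forall z \near P t, `|f z| - `|(l K).2| != 0.
    have cd : {for P t, continuous (fun z => `|f z| - `|(l K).2|)}.
      by apply: cvgB => //; exact: cvg_cst.
    by apply: (cvgr_neq0 _ cd); rewrite subr_eq0 ft cK.
  by apply: filterS => z; rewrite subr_eq0.
(* The value [c] at [P t] differs from every constant, and so do nearby values; density then gives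
   such a point inside a cell, where [S] must be one of the constants. *)
have nw : \forall z \near P t, forall K, K \in T -> `|f z| != `|(l K).2|.
  exact: near_seq nw1.
have [|z [Uz]] := mesh_dense oO cT (@open_interior _ [set z | forall K, K \in T -> `|f z| != `|(l K).2|]).
  by exists (P t); split.
move=> /interior_subset /= nz; have [K KT SK] := sU z Uz.
by have := nz K KT; rewrite fS ?SK ?eqxx//; case: Uz.
Qed.

Lemma bm_nrm_eq0 g p (A : set (R * R)) : 0 < p -> bm Omega T g -> nrm Omega p g = 0%E ->
  open A -> A `<=` U -> (forall x, A x -> g x != 0) -> A = set0.
Proof.
move=> p0 bg n0 oA AU gA.
have bp : bm Omega T (fun x => `|g x| `^ p).
  have [mg [M hM]] := bg; split.
    apply: (@measurableT_comp _ _ _ _ _ _ (@powR R ^~ p)); first exact: measurable_powR.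
    exact: measurableT_comp.
  exists (`|M| `^ p) => y Uy; rewrite ger0_norm ?powR_ge0// ge0_ler_powR ?nnegrE ?(ltW p0)//.
  exact: le_trans (hM y Uy) (ler_norm _).
have I0 : int2 Omega (fun x => `|g x| `^ p) = 0.
  have e0 : (\int[leb2 R]_(x in U) (`|g x| `^ p)%:E = 0)%E.
    move: n0; rewrite (nrm_UE oO cT _ p0); apply: poweR_eq0_eq0.
    by apply: integral_ge0 => y _; rewrite lee_fin powR_ge0.
  by rewrite (int2_U oO cT) /int2 /Rintegral e0.
apply: (int2_eq0 oO bO cT bp (fun x _ => powR_ge0 _ _) I0 oA AU) => x Ax.
by rewrite powR_gt0// normr_gt0 gA.
Qed.

Lemma Vh_nrmv_eq0 S p : 0 < p -> Vh Omega T S -> nrmv Omega p (grad S) = 0%E ->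
  forall x, Omega x -> S x = 0.
Proof.
move=> p0 VS n0; apply: Vh_grad_eq0 => // x Ux; apply: contrapT => gx.
have PS := Vh_PA VS; have bpd i := PA_pd_bm oO i PS.
have bS : bm Omega T (fun x => enorm (grad S x)).
  by apply: bm_enorm; [exact: (bpd false)|exact: (bpd true)].
have oA : open (U `&` [set y | enorm (grad S y) != 0]).
  rewrite openE => y [Uy /= ny]; have [l Sl] := Vh_pieces VS.
  have [K KT nK] := Vh_near Sl Uy.
  have gy : grad S y = (l K).1 := grad_near_aff nK.
  rewrite gy in ny; apply: filterI.
    by apply: open_nbhs_nbhs; split => //; exact: open_mesh_interior.
  by apply: filterS (nbhs_interior nK) => z nz; rewrite /= (grad_near_aff nz).
suff : (set0 : set (R * R)) x by [].
rewrite -(bm_nrm_eq0 p0 bS n0 oA (fun y h => h.1) (fun y h => h.2)).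
by split => //=; apply/eqP => /enorm_eq0.
Qed.

End Uniqueness.

(** * Continuous dependence of linear systems on a parameter *)

Section Solve.
Variables (R : realType) (X : topologicalType).

Lemma continuous_big_sum (I : Type) (s : seq I) (P : pred I) (F : I -> X -> R) :
  (forall i, continuous (F i)) -> continuous (fun x => \sum_(i <- s | P i) F i x).
Proof.
move=> cF; elim: s => [|i s IH] x.
  by rewrite (_ : (fun x => _) = cst 0); [exact: cst_continuous|apply/funext => y; rewrite big_nil].
rewrite (_ : (fun x => _) = fun x => (if P i then F i x else 0) + \sum_(j <- s | P j) F j x); last first.
  by apply/funext => y; rewrite big_cons; case: ifP => _; rewrite ?add0r.
apply: cvgD; last exact: IH.
by case: (P i); [exact: cF|exact: cst_continuous].
Qed.

Lemma continuous_big_prod (I : Type) (s : seq I) (P : pred I) (F : I -> X -> R) :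
  (forall i, continuous (F i)) -> continuous (fun x => \prod_(i <- s | P i) F i x).
Proof.
move=> cF; elim: s => [|i s IH] x.
  by rewrite (_ : (fun x => _) = cst 1); [exact: cst_continuous|apply/funext => y; rewrite big_nil].
rewrite (_ : (fun x => _) = fun x => (if P i then F i x else 1) * \prod_(j <- s | P j) F j x); last first.
  by apply/funext => y; rewrite big_cons; case: ifP => _; rewrite ?mul1r.
apply: cvgM; last exact: IH.
by case: (P i); [exact: cF|exact: cst_continuous].
Qed.

Lemma continuous_det k (A : X -> 'M[R]_k) :
  (forall i j, continuous (fun x => A x i j)) -> continuous (fun x => \det (A x)).
Proof.
move=> cA; apply: continuous_big_sum => s x; apply: cvgM; first exact: cvg_cst.
exact: continuous_big_prod.
Qed.

(** Cramer's rule: the entries of the inverse are cofactors divided by a determinant that never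
    vanishes. *)
Lemma continuous_solve k (d : X -> 'rV[R]_k) (A : X -> 'M[R]_k) :
  (forall j, continuous (fun x => d x 0 j)) ->
  (forall i j, continuous (fun x => A x i j)) -> (forall x, A x \in unitmx) ->
  forall j, continuous (fun x => (d x *m invmx (A x)) 0 j).
Proof.
move=> cd cA uA j.
rewrite (_ : (fun x => _) = fun x => \sum_i d x 0 i * ((\det (A x))^-1 * \adj (A x) i j)); last first.
  by apply/funext => x; rewrite mxE; apply: eq_bigr => i _; rewrite /invmx uA mxE.
apply: continuous_big_sum => i x; apply: cvgM; first exact: cd.
apply: cvgM.
  apply: cvgV; last exact: continuous_det.
  by have := uA x; rewrite unitmxE unitfE.
rewrite (_ : (fun x => _) = fun x => (-1) ^+ (j + i) * \det (row' j (col' i (A x)))); last first.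
  by apply/funext => y; rewrite mxE.
have -> : \adj (A x) i j = (-1) ^+ (j + i) * \det (row' j (col' i (A x))) by rewrite mxE.
apply: cvgM; first exact: cvg_cst.
apply: continuous_det => a b.
rewrite (_ : (fun x => _) = fun x => A x (lift j a) (lift i b)); first exact: cA.
by apply/funext => z; rewrite !mxE.
Qed.

End Solve.

Lemma row_unitmx (F : fieldType) k (A : 'M[F]_k) :
  (forall y : 'rV[F]_k, y *m A = 0 -> y = 0) -> A \in unitmx.
Proof.
move=> H; rewrite -row_free_unit -kermx_eq0; apply/eqP/row_matrixP => i.
by rewrite row0; apply: H; rewrite -row_mul mulmx_ker row0.
Qed.

Lemma lipschitz_bound (R : realType) (f : R -> R) : lipschitz f ->
  exists2 k, 0 <= k & forall x y, `|f x - f y| <= k * `|x - y|.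
Proof.
move=> [M [_ HM]]; exists (`|M| + 1); first by rewrite addr_ge0.
move=> x y; have := HM (`|M| + 1); rewrite ltr_pwDr ?ler_norm// => /(_ isT (x, y)).
by apply.
Qed.

Lemma lipschitz_continuous (R : realType) (V : normedModType R) (f : V -> R) (C : R) :
  0 <= C -> (forall x y, `|f x - f y| <= C * `|x - y|) -> continuous f.
Proof.
move=> C0 fC x; apply/cvgrPdist_le => d d0; have C1 : 0 < C + 1 by rewrite ltr_wpDl.
near=> y; apply: (le_trans (fC x y)); apply: (@le_trans _ _ ((C + 1) * `|x - y|)).
  by rewrite ler_wpM2r// lerDl.
rewrite mulrC -ler_pdivlMr//; near: y.
have dk : 0 < d / (C + 1) by rewrite divr_gt0.
by have /cvgrPdist_le/(_ _ dk) := @cvg_id _ (nbhs x).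
Unshelve. all: by end_near. Qed.

Lemma lipschitz_cont (R : realType) (h : R -> R) : lipschitz h -> continuous h.
Proof. by move=> /lipschitz_bound[k k0 hk]; exact: lipschitz_continuous k0 hk. Qed.

(** * Coefficient vectors and norms on V_h *)

Section NormEquiv.
Variables (R : realType) (Omega : set (R * R)) (T : seq {ffun 'I_3 -> R * R}).
Hypothesis oO : open Omega.
Hypothesis bO : bounded_set Omega.
Hypothesis cT : conforming_mesh Omega T.
Local Notation U := (mesh_interior Omega T).
Local Notation bm := (bm Omega T).
Variables (n : nat) (e : 'I_n -> R * R -> R).
Hypothesis Ve : forall i, Vh Omega T (e i).
Hypothesis e_free : forall x : 'rV[R]_n,
  (forall y, U y -> (\sum_i x 0 i *: e i) y = 0) -> x = 0.
Implicit Types (x y : 'rV[R]_n) (z : R * R).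

Definition comb x : R * R -> R := \sum_i x 0 i *: e i.

Lemma comb_Vh x : Vh Omega T (comb x).
Proof. exact: Vh_sum. Qed.

Lemma combE x z : comb x z = \sum_i x 0 i * e i z.
Proof. exact: sum_fctE. Qed.

Lemma grad_comb x z : U z -> grad (comb x) z = \sum_i x 0 i *: grad (e i) z.
Proof.
move=> Uz; have pe i : PA T (e i) by apply: Vh_PA.
rewrite /grad /comb !(pd_sum _ _ pe Uz).
rewrite [RHS]surjective_pairing; congr pair.
  by elim/big_rec2: _ => // i r a _ ->.
by elim/big_rec2: _ => // i r a _ ->.
Qed.

Lemma comb_lip : exists2 M, 0 <= M & forall x y z, U z -> `|comb x z - comb y z| <= M * `|x - y|.
Proof.
have /choice[M HM] : forall i, exists M, forall z, Omega z -> `|e i z| <= M.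
  by move=> i; exact: (Vh_bound bO cT (Ve i)).
exists (\sum_i `|M i|); first by rewrite sumr_ge0.
move=> x y z [Oz _]; rewrite !combE -sumrB mulr_suml (le_trans (ler_norm_sum _ _ _))// ler_sum// => i _.
rewrite -mulrBl normrM mulrC ler_pM//; first exact: le_trans (HM i z Oz) (ler_norm _).
by have := mx_norm_ge (x - y) 0 i; rewrite !mxE.
Qed.

(** The dependence on [x] is even Lipschitz: [h] is Lipschitz, [comb] is Lipschitz in its
    coefficients uniformly on [U], and [g] is integrable. *)
Lemma continuous_int_comb (h : R -> R) (g : R * R -> R) :
  lipschitz h -> (exists M, forall s, `|h s| <= M) -> bm g ->
  continuous (fun x => int2 Omega (fun z => h (comb x z) * g z)).
Proof.
move=> lh hb bg; have [k k0 hk] := lipschitz_bound lh; have [M M0 HM] := comb_lip.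
have ch := lipschitz_cont lh.
have bhg x : bm (fun z => h (comb x z) * g z).
  by apply: bmM => //; apply: bm_comp => //; apply: PA_bm => //; apply: Vh_PA; exact: comb_Vh.
have bng : bm (fun z => `|g z|) by exact: bm_norm.
pose G := int2 Omega (fun z => `|g z|).
have G0 : 0 <= G by apply: (int2_ge0 oO cT) => z _.
have lip x y : `|int2 Omega (fun z => h (comb x z) * g z) - int2 Omega (fun z => h (comb y z) * g z)|
    <= (k * M * G) * `|x - y|.
  rewrite -(int2B oO cT); [|exact: bm_integr|exact: bm_integr].
  have bd : bm (fun z => h (comb x z) * g z - h (comb y z) * g z).
    by apply: bmD => //; exact: bmN.
  apply: (le_trans (int2_norm oO cT (bm_integr oO bO bd))).
  have -> : k * M * G * `|x - y| = int2 Omega (fun z => (k * M * `|x - y|) * `|g z|).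
    by rewrite (int2Z oO cT); [rewrite /G; ring|exact: bm_integr].
  apply: (int2_le oO cT); [by apply: bm_integr => //; exact: bm_norm|
    by apply: bm_integr => //; exact: bmZ|].
  move=> z Uz; rewrite -mulrBl normrM ler_wpM2r// (le_trans (hk _ _))// -mulrA ler_wpM2l//.
  exact: HM.
by apply: lipschitz_continuous lip; rewrite !mulr_ge0.
Qed.

(** On a bounded domain every other L^s norm of the gradient controls this one, so a single
    comparison with the coefficients serves both exponents [p] and [p']. *)
Definition grad_norm1 x : R := int2 Omega (fun z => enorm (grad (comb x) z)).

Lemma Vh_grad_bm S : Vh Omega T S -> bm (fun z => enorm (grad S z)).
Proof.
move=> VS; have bpd i := PA_pd_bm oO i (Vh_PA VS).
by apply: bm_enorm; [exact: (bpd false)|exact: (bpd true)].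
Qed.

Lemma grad_norm1_lip : exists2 C, 0 <= C & forall x y, grad_norm1 x <= grad_norm1 y + C * `|x - y|.
Proof.
pose g z := \sum_i enorm (grad (e i) z).
have bg : bm g.
  rewrite /g; elim: (index_enum _) => [|i s IH].
    by rewrite (_ : (fun z => _) = fun=> 0); [exact: bm_cst|apply/funext => z; rewrite big_nil].
  rewrite (_ : (fun z => _) =
    fun z => enorm (grad (e i) z) + \sum_(j <- s) enorm (grad (e j) z)); last first.
    by apply/funext => z; rewrite big_cons.
  by apply: bmD => //; exact: Vh_grad_bm.
exists (int2 Omega g); first by apply: (int2_ge0 oO cT) => z _; apply: sumr_ge0 => *; exact: enorm_ge0.
move=> x y; have bgr w := Vh_grad_bm (comb_Vh w).
have -> : int2 Omega g * `|x - y| = int2 Omega (fun z => `|x - y| * g z).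
  by rewrite (int2Z oO cT) 1?mulrC//; exact: bm_integr.
rewrite /grad_norm1 -(int2D oO cT); [|exact: bm_integr|by apply: bm_integr => //; exact: bmZ].
apply: (int2_le oO cT); [exact: bm_integr|by apply: bm_integr => //; apply: bmD => //; exact: bmZ|].
move=> z Uz.
have -> : grad (comb x) z = grad (comb y) z + grad (comb (x - y)) z.
  rewrite !grad_comb// -big_split /=; apply: eq_bigr => i _.
  by rewrite -scalerDl; congr (_ *: _); rewrite !mxE; ring.
rewrite (le_trans (enormD _ _))// lerD2l grad_comb// /g mulr_sumr.
have : enorm (\sum_i (x - y) 0 i *: grad (e i) z) <= \sum_i enorm ((x - y) 0 i *: grad (e i) z).
  elim/big_rec2: _ => [|i r a _ h]; first by rewrite enorm0.
  by rewrite (le_trans (enormD _ _))// lerD2l.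
move=> h; apply: (le_trans h); apply: ler_sum => i _; rewrite enormZ ler_wpM2r ?enorm_ge0//.
exact: mx_norm_ge.
Qed.

Lemma grad_norm1_ge0 x : 0 <= grad_norm1 x.
Proof. by apply: (int2_ge0 oO cT) => z _; exact: enorm_ge0. Qed.

Lemma grad_norm1Z (k : R) x : grad_norm1 (k *: x) = `|k| * grad_norm1 x.
Proof.
rewrite /grad_norm1 -(int2Z oO cT); last by apply: bm_integr => //; apply: Vh_grad_bm; exact: comb_Vh.
apply: (eq_int2_U oO cT) => z Uz; rewrite -enormZ; congr enorm.
rewrite !grad_comb// scaler_sumr; apply: eq_bigr => i _.
by rewrite scalerA mxE.
Qed.

Lemma grad_norm1_eq0 x : grad_norm1 x = 0 -> x = 0.
Proof.
move=> n0; apply: e_free => z Uz; apply: (@Vh_nrmv_eq0 _ Omega T oO bO cT (comb x) 1) => //.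
- exact: comb_Vh.
- rewrite /nrmv (nrm_UE oO cT)// invr1 poweRe1; last
    by apply: integral_ge0 => y _; rewrite lee_fin powR_ge0.
  rewrite -[RHS]/(0%:E) -n0 /grad_norm1 (int2_EFin oO cT); last first.
    by apply: bm_integr => //; apply: Vh_grad_bm; exact: comb_Vh.
  by apply: eq_integral => y _; rewrite powRr1// normr_enorm.
- by case: Uz.
Qed.

(** The constant is the minimum of [grad_norm1] on the compact unit sphere, positive by
    definiteness; homogeneity does the rest. *)
Lemma grad_norm1_equiv : exists2 c, 0 < c & forall x, c * `|x| <= grad_norm1 x.
Proof.
(* In dimension 0 the sphere is empty and has no minimiser. *)
have [[x0 /eqP x0n]|N] := pselect (exists x0 : 'rV[R]_n, x0 <> 0); last first.
  exists 1 => // x; rewrite mul1r (_ : x = 0) ?normr0 ?grad_norm1_ge0//.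
  by apply: contrapT => x0; apply: N; exists x.
have [C C0 lip] := grad_norm1_lip.
have lip' x y : `|grad_norm1 x - grad_norm1 y| <= C * `|x - y|.
  have key (a b q : R) : a <= b + q -> b <= a + q -> `|a - b| <= q.
    by move=> h1 h2; rewrite ler_norml; apply/andP; split; lra.
  apply: key; first exact: lip.
  rewrite distrC; exact: lip.
have cN : continuous grad_norm1 := lipschitz_continuous C0 lip'.
pose S : set 'rV[R]_n := [set x | `|x| = 1].
have normalize x : x != 0 -> S (`|x|^-1 *: x).
  by move=> xn; rewrite /S /= normrZ normfV normr_id mulVf// normr_eq0.
have cS : compact S.
  apply: bounded_closed_compact.
    by exists 1; split; [exact: num_real|move=> M M1 x /= ->; exact: ltW].
  rewrite (_ : S = (fun x => `|x|) @^-1` [set t | t = 1])//.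
  by apply: closed_comp => [x _|]; [exact: norm_continuous|exact: closed_eq].
have [|x [/set_mem xS] xmin] := @EVT_min_rV R n grad_norm1 S _ cS (continuous_subspaceT cN).
  by exists (`|x0|^-1 *: x0); exact: normalize.
exists (grad_norm1 x).
  rewrite lt_neqAle grad_norm1_ge0 andbT eq_sym; apply/eqP => /grad_norm1_eq0 x00.
  by move: xS; rewrite /S /= x00 normr0 => /esym/eqP; rewrite oner_eq0.
move=> y; have [->|yn] := eqVneq y 0; first by rewrite normr0 mulr0 grad_norm1_ge0.
have := xmin (`|y|^-1 *: y) (mem_set (normalize y yn)).
rewrite grad_norm1Z normfV normr_id => h.
by rewrite -ler_pdivlMr ?normr_gt0// mulrC.
Qed.

End NormEquiv.

(** * Darcy flow and advected heat on a fixed mesh *)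

Section Velocity.
Variables (R : realType) (Omega : set (R * R)) (T : seq {ffun 'I_3 -> R * R}).
Local Notation T2 := (measurableTypeR R * measurableTypeR R)%type.
Hypothesis oO : open Omega.
Hypothesis bO : bounded_set Omega.
Hypothesis cT : conforming_mesh Omega T.
Implicit Types (v : R * R -> R * R) (theta : R * R -> R).
Local Notation U := (mesh_interior Omega T).
Local Notation bm := (bm Omega T).

Lemma int2_sum m (c : 'rV[R]_m) (F : 'I_m -> R * R -> R) :
  (forall i, integrU Omega T (F i)) ->
  int2 Omega (fun x => \sum_i c 0 i * F i x) = \sum_i c 0 i * int2 Omega (F i).
Proof.
move=> IF; suff [] : integrU Omega T (fun x => \sum_i c 0 i * F i x) /\
  int2 Omega (fun x => \sum_i c 0 i * F i x) = \sum_i c 0 i * int2 Omega (F i) by [].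
elim: (index_enum _) => [|i s [Is IH]].
  rewrite (_ : (fun x => _) = fun=> 0); last by apply/funext => x; rewrite big_nil.
  by rewrite big_nil (int2_0 oO cT); split=> //; apply: bm_integr => //; exact: bm_cst.
rewrite (_ : (fun x => _) = fun x => c 0 i * F i x + \sum_(j <- s) c 0 j * F j x); last first.
  by apply/funext => x; rewrite big_cons.
rewrite big_cons (int2_lin oO cT) // IH; split=> //.
by apply: integrUD => //; exact: integrUZ.
Qed.

Lemma dot_suml m (c : 'rV[R]_m) (a : 'I_m -> R * R) b :
  dot (\sum_i c 0 i *: a i) b = \sum_i c 0 i * dot (a i) b.
Proof.
elim/big_rec2: _ => [|i u r _ <-]; first by rewrite /dot !mul0r addr0.
by rewrite dotDl dotZl.
Qed.

Lemma PAv_dot_bm v v' : PAv T v -> PAv T v' -> bm (fun x => dot (v x) (v' x)).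
Proof.
by move=> [v1 v2] [w1 w2]; apply: bmD; apply: bmM; exact: PA_bm.
Qed.

Lemma PAv_enorm_bm v : PAv T v -> bm (fun x => enorm (v x)).
Proof. by move=> [v1 v2]; apply: bm_enorm; exact: PA_bm. Qed.

Lemma PA_continuous_at g x : PA T g -> U x -> {for x, continuous g}.
Proof.
move=> [l gl] Ux; have [K KT gK] := PA_near gl Ux.
rewrite /prop_for /continuous_at (nbhs_singleton gK).
have cl : (fun y => dot (l K).1 y + (l K).2) @ x --> dot (l K).1 x + (l K).2 by exact: continuous_aff.
apply: cvg_trans cl.
by apply: near_eq_cvg; apply: filterS gK => y ->.
Qed.

Lemma PAv_int2_sqr_eq0 v : PAv T v -> int2 Omega (fun x => dot (v x) (v x)) = 0 ->
  forall x, U x -> v x = 0.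
Proof.
move=> Pv v0 x Ux; apply: contrapT => vx.
have vsq y : 0 <= dot (v y) (v y) by exact: dot_ge0.
pose A := interior [set y | U y /\ 0 < dot (v y) (v y)].
have A0 : A = set0.
  apply: (int2_eq0 oO bO cT (PAv_dot_bm Pv Pv) _ v0) => //.
  - exact: open_interior.
  - by move=> y /interior_subset[].
  - by move=> y /interior_subset[].
suff : A x by rewrite A0.
have dx : 0 < dot (v x) (v x).
  rewrite lt_neqAle dot_ge0 andbT eq_sym -enorm_sqr sqrf_eq0.
  by apply/eqP => /enorm_eq0.
have cd : {for x, continuous (fun y => dot (v y) (v y))}.
  have [v1 v2] := Pv; have c1 := PA_continuous_at v1 Ux; have c2 := PA_continuous_at v2 Ux.
  exact: cvgD (cvgM c1 c1) (cvgM c2 c2).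
have nU : \forall y \near x, U y by apply: open_nbhs_nbhs; split=> //; exact: open_mesh_interior.
have n0 : \forall y \near x, 0 < dot (v y) (v y) by exact: (cvgr_gt _ cd).
by move: nU n0; exact: filterS2.
Qed.

Variables (nu : R -> R) (nu_min nu_max : R) (f : R * R -> R * R).
Hypothesis nu_lip : lipschitz nu.
Hypothesis nu_min_gt0 : 0 < nu_min.
Hypothesis nu_bd : forall s, nu_min <= nu s <= nu_max.
Hypothesis Lf : Lpv Omega 2 f.
Hypothesis f_fin : nrmv Omega 2 f \is a fin_num.

Lemma coef_bounded : exists M, forall s, `|nu s| <= M.
Proof.
exists nu_max => s; have /andP[h1 h2] := nu_bd s.
by rewrite ger0_norm// ltW// (lt_le_trans nu_min_gt0).
Qed.

Lemma coef_bm theta : bm theta -> bm (fun x => nu (theta x)).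
Proof. by move=> bt; apply: bm_comp => //; [exact: lipschitz_cont|exact: coef_bounded]. Qed.

Lemma weighted_dot_bm theta v v' : bm theta -> PAv T v -> PAv T v' ->
  bm (fun x => nu (theta x) * dot (v x) (v' x)).
Proof. by move=> bt Pv Pv'; apply: bmM; [exact: coef_bm|exact: PAv_dot_bm]. Qed.

Lemma force_integr v : PAv T v -> integrU Omega T (fun x => dot (f x) (v x)).
Proof.
move=> [v1 v2]; have [/(Lp2_L2U oO cT) f1 /(Lp2_L2U oO cT) f2] := Lf.
by apply: dot_integr => //; apply: bm_L2U => //; exact: PA_bm.
Qed.

(** Cauchy-Schwarz in extended-real form, as [f] is only square integrable and need not be
    bounded. *)
Lemma force_le v : PAv T v -> int2 Omega (fun x => dot (f x) (v x)) <=
  fine (nrmv Omega 2 f) * fine (nrmv Omega 2 v).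
Proof.
move=> Pv; have [[mf1 f1] [mf2 f2]] := Lf.
have mU (g : R * R -> R) : measurable_fun (Omega : set T2) g -> measurable_fun (U : set T2) g.
  by apply: measurable_funS; [exact: open_measurable2|move=> x []].
have mf : measurable_fun (U : set T2) (fun x => enorm (f x)).
  apply: (measurable_enorm (Omega := U)); [exact: mU|exact: mU].
have bv := PAv_enorm_bm Pv.
rewrite -lee_fin (int2_EFin oO cT); last exact: force_integr.
have -> : (fine (nrmv Omega 2 f) * fine (nrmv Omega 2 v))%:E = (nrmv Omega 2 f * nrmv Omega 2 v)%E.
  by rewrite EFinM !fineK// (bm_nrm_fin oO bO cT).
have h2 : (2 : R)^-1 + 2^-1 = 1 by field.
have t2 : 0 < 2 :> R by [].
apply: le_trans (hoelder_U oO cT t2 t2 h2 mf bv.1).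
have mI : measurable_fun (U : set T2) (fun x => (dot (f x) (v x))%:E).
  by case/integrableP: (force_integr Pv).
apply: (@le_trans _ _ (\int[leb2 R]_(x in U) `|(dot (f x) (v x))%:E|)%E).
  by apply: (le_trans (lee_abs _)); apply: le_abse_integral => //; exact: measurable_U.
apply: ge0_le_integral => //.
- exact: measurable_U.
- exact: measurableT_comp.
- by apply/measurable_EFinP; apply: measurableT_comp => //; apply: measurable_funM => //; case: bv.
- by move=> x _; rewrite lee_fin normrM !normr_enorm dot_le.
Qed.

Variables (k : nat) (w : 'I_k -> R * R -> R * R).
Hypothesis Pw : forall i, PAv T (w i).
Hypothesis w_free : forall y : 'rV[R]_k,
  (forall x, U x -> (\sum_i y 0 i *: w i) x = 0) -> y = 0.
Implicit Types y : 'rV[R]_k.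
Local Notation combw y := (\sum_i y 0 i *: w i).

Lemma combw_PAv y : PAv T (combw y).
Proof. exact: PAv_sum. Qed.

Lemma weighted_dot_suml theta y v : bm theta -> PAv T v ->
  int2 Omega (fun x => nu (theta x) * dot (combw y x) (v x)) =
  \sum_i y 0 i * int2 Omega (fun x => nu (theta x) * dot (w i x) (v x)).
Proof.
move=> bt Pv; rewrite -int2_sum; last by move=> i; apply: bm_integr => //; exact: weighted_dot_bm.
congr int2; apply/funext => x; rewrite sum_vfctE dot_suml mulr_sumr.
by apply: eq_bigr => i _; rewrite mulrCA.
Qed.

Lemma weighted_dot_sumr theta y v : bm theta -> PAv T v ->
  int2 Omega (fun x => nu (theta x) * dot (v x) (combw y x)) =
  \sum_i y 0 i * int2 Omega (fun x => nu (theta x) * dot (v x) (w i x)).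
Proof.
move=> bt Pv; rewrite (eq_int2_U oO cT (g := fun x => nu (theta x) * dot (combw y x) (v x))).
  rewrite weighted_dot_suml//; apply: eq_bigr => i _; congr (_ * int2 _ _).
  by apply/funext => x; rewrite dotC.
by move=> x _; rewrite dotC.
Qed.

Lemma force_sum y : int2 Omega (fun x => dot (f x) (combw y x)) =
  \sum_i y 0 i * int2 Omega (fun x => dot (f x) (w i x)).
Proof.
rewrite -int2_sum; last by move=> i; exact: force_integr.
congr int2; apply/funext => x; rewrite sum_vfctE dotC dot_suml.
by apply: eq_bigr => i _; rewrite dotC.
Qed.

(** Coefficients are row vectors, so the Galerkin system reads [y *m velA = velF], with rows for
    trial functions and columns for test functions. *)
Definition velA theta : 'M[R]_k :=
  \matrix_(i, j) int2 Omega (fun x => nu (theta x) * dot (w i x) (w j x)).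
Definition velF : 'rV[R]_k := \row_j int2 Omega (fun x => dot (f x) (w j x)).
Definition vel theta : 'rV[R]_k := velF *m invmx (velA theta).

Lemma coercive theta v : bm theta -> PAv T v ->
  nu_min * int2 Omega (fun x => dot (v x) (v x)) <=
  int2 Omega (fun x => nu (theta x) * dot (v x) (v x)).
Proof.
move=> bt Pv; have bvv := PAv_dot_bm Pv Pv.
rewrite -(int2Z oO cT); last exact: bm_integr.
apply: (int2_le oO cT); [by apply: bm_integr => //; exact: bmZ|
  by apply: bm_integr => //; exact: weighted_dot_bm|].
by move=> x _; rewrite ler_wpM2r ?dot_ge0//; case/andP: (nu_bd (theta x)).
Qed.

(** Testing a kernel vector against itself gives zero energy; coercivity and freeness of [w] then
    make it zero. *)
Lemma velA_unit theta : bm theta -> velA theta \in unitmx.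
Proof.
move=> bt; apply: row_unitmx => y yA; apply: w_free; apply: PAv_int2_sqr_eq0; first exact: combw_PAv.
have e0 : int2 Omega (fun x => nu (theta x) * dot (combw y x) (combw y x)) = 0.
  rewrite weighted_dot_sumr; [|exact: bt|exact: combw_PAv]; apply: big1 => j _.
  have := congr1 (fun M : 'rV[R]_k => M 0 j) yA; rewrite !mxE => yAj.
  rewrite weighted_dot_suml// -[RHS](mulr0 (y 0 j)); congr (_ * _).
  by rewrite -[RHS]yAj; apply: eq_bigr => i _; rewrite mxE.
have h := coercive bt (combw_PAv y); rewrite e0 in h.
apply/eqP; rewrite eq_le; apply/andP; split; last by apply: (int2_ge0 oO cT) => x _; exact: dot_ge0.
by rewrite -(pmulr_rle0 _ nu_min_gt0).
Qed.

Lemma velE theta y : bm theta ->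
  int2 Omega (fun x => nu (theta x) * dot (combw (vel theta) x) (combw y x)) =
  int2 Omega (fun x => dot (f x) (combw y x)).
Proof.
move=> bt; rewrite weighted_dot_sumr; [|exact: bt|exact: combw_PAv].
rewrite force_sum; apply: eq_bigr => j _; congr (_ * _); rewrite weighted_dot_suml//.
have := congr1 (fun M : 'rV[R]_k => M 0 j) (mulmxKV (velA_unit bt) velF).
rewrite -/(vel theta) !mxE => <-.
by apply: eq_bigr => i _; congr (_ * _); rewrite mxE.
Qed.

Lemma nrmv_sqr v : PAv T v -> fine (nrmv Omega 2 v) ^+ 2 = int2 Omega (fun x => dot (v x) (v x)).
Proof.
move=> Pv; rewrite /nrmv -(nrm_sqr oO cT)//; last exact: PAv_enorm_bm.
rewrite divff// (nrm_UE oO cT)// invr1 poweRe1; last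
  by apply: integral_ge0 => x _; rewrite lee_fin powR_ge0.
rewrite (int2_U oO cT) /int2 /Rintegral; congr fine; apply: eq_integral => x _.
by rewrite powRr1// -expr2 enorm_sqr ger0_norm ?dot_ge0.
Qed.

(** Testing with the solution bounds [nu_min] times the squared norm by the product of the norms of
    [f] and of the solution; one factor cancels unless it is 0. *)
Lemma vel_bound theta : bm theta ->
  nu_min * fine (nrmv Omega 2 (combw (vel theta))) <= fine (nrmv Omega 2 f).
Proof.
move=> bt; have Pu := combw_PAv (vel theta); set u := \sum_i _ in Pu *.
have h := coercive bt Pu; rewrite velE// -nrmv_sqr// in h.
have h2 := le_trans h (force_le Pu).
have [u0|u0] := eqVneq (fine (nrmv Omega 2 u)) 0; first by rewrite u0 mulr0 fine_ge0// nrm_ge0.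
have up : 0 < fine (nrmv Omega 2 u) by rewrite lt_neqAle eq_sym u0 fine_ge0// nrm_ge0.
by rewrite -(ler_pM2r up) -mulrA -expr2.
Qed.

End Velocity.

(** * A test function with nonzero gradient *)

Section Bump.
Variables (R : realType) (Omega : set (R * R)) (T : seq {ffun 'I_3 -> R * R}).
Local Notation T2 := (measurableTypeR R * measurableTypeR R)%type.
Hypothesis oO : open Omega.
Hypothesis bO : bounded_set Omega.
Hypothesis cT : conforming_mesh Omega T.
Local Notation U := (mesh_interior Omega T).
Local Notation bm := (bm Omega T).
Implicit Types (phi : R * R -> R) (p : R).

Lemma nrm0 p : 0 < p -> nrm Omega p (fun=> 0 : R) = 0%E.
Proof.
move=> p0; rewrite (nrm_UE oO cT)// integral0_eq; last first.
  by move=> x _; rewrite normr0 powR0// gt_eqF.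
by rewrite poweR0r// invr_eq0 gt_eqF.
Qed.

Lemma test_fun_W10 phi p : 0 < p -> test_fun Omega phi -> W10 Omega p phi (grad phi).
Proof.
move=> p0 tphi; have [bphi bpd] := test_fun_bm T oO bO tphi.
have [sphi _ _] := tphi.
have cm (h : R * R -> R) : continuous h -> measurable_fun (Omega : set T2) h.
  by move=> ch; apply: continuous_measurable2 => // x _; exact: ch.
have L (s : seq bool) : measurable_fun (Omega : set T2) (foldr pd phi s).
  by apply: cm => x; apply: differentiable_continuous; exact: sphi.
split.
- by split; [exact: (L [::])|exact: (bm_nrm_lty oO bO cT)].
- split; split.
  + exact: (L [:: false]).
  + exact: (bm_nrm_lty oO bO cT _ (bpd false)).
  + exact: (L [:: true]).
  + exact: (bm_nrm_lty oO bO cT _ (bpd true)).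
- exists (fun=> phi); split=> //.
  + rewrite (_ : (fun x => phi x - phi x) = fun=> 0); last by apply/funext => x; rewrite subrr.
    by rewrite nrm0//; exact: cvg_cst.
  + rewrite /nrmv (_ : (fun x => enorm (grad phi x - grad phi x)) = fun=> 0); last first.
      by apply/funext => x; rewrite subrr enorm0.
    by rewrite nrm0//; exact: cvg_cst.
Qed.

(** It shows that the supremum in [delta_norm] runs over a nonempty set and so is not [-oo]. The
    function is [ppos 1] of [d^2 - |x - z|^2]. *)
Lemma bump_exists p : 0 < p -> Omega !=set0 ->
  exists phi, test_fun Omega phi /\ (0 < nrmv Omega p (grad phi))%E.
Proof.
move=> p0 [z Oz].
have [d d0 dO] : exists2 d : R, 0 < d & forall x, enorm (x - z) <= d -> Omega x.
  have /nbhs_ballP[e /= e0 eO] : nbhs z Omega by exact: open_nbhs_nbhs.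
  exists (e / 2) => [|x xz]; first by rewrite divr_gt0.
  apply: eO; rewrite -ball_normE /= distrC.
  apply: (@le_lt_trans _ _ (e / 2)); last by rewrite ltr_pdivrMr// ltr_pMr// ltr1n.
  apply: le_trans xz; rewrite prod_normE ge_max; apply/andP.
  by split; [exact: fst_le_enorm|exact: snd_le_enorm].
pose f1 (x : R * R) := dot (1, 0) x + (- z.1); pose f2 (x : R * R) := dot (0, 1) x + (- z.2).
(* Constants are named as functions so that [Q] is built literally by the constructors of
   [smooth_expr]. *)
pose m (x : R * R) : R := - 1; pose c (x : R * R) := d ^+ 2.
pose Q x := c x + m x * (f1 x * f1 x + f2 x * f2 x).
have [s1 s2 s3 s4] : [/\ smooth_expr f1, smooth_expr f2, smooth_expr m & smooth_expr c].
  by split; [exact: smooth_aff|exact: smooth_aff|exact: smooth_cst|exact: smooth_cst].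
have s11 : smooth_expr (fun x => f1 x * f1 x) by exact: smooth_mul.
have s22 : smooth_expr (fun x => f2 x * f2 x) by exact: smooth_mul.
have s12 : smooth_expr (fun x => f1 x * f1 x + f2 x * f2 x) by exact: smooth_add.
have sm : smooth_expr (fun x => m x * (f1 x * f1 x + f2 x * f2 x)) by exact: smooth_mul.
have sQ : smooth_expr Q by exact: smooth_add.
have QE x : Q x = d ^+ 2 - enorm (x - z) ^+ 2.
  by rewrite enorm_sqr /Q /c /m /f1 /f2 /dot /=; ring.
have cQ : continuous Q by exact: smooth_expr_continuous.
have pdQ x : pd false Q x = - 2 * (x.1 - z.1).
  have paff a b : pd false (fun y => dot a y + b) x = a.1.
    by apply: (@pd_near_aff _ _ a b _ false); near=> y.
  have pcst (b : R) : pd false (fun=> b) x = 0.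
    by rewrite /pd derive_cst.
  have D g : smooth_expr g -> differentiable g x by move=> /smooth_expr_diff; exact.
  rewrite /Q (pdD _ (D _ s4) (D _ sm)) (pdM _ (D _ s3) (D _ s12)) (pdD _ (D _ s11) (D _ s22)).
  rewrite (pdM _ (D _ s1) (D _ s1)) (pdM _ (D _ s2) (D _ s2)).
  rewrite !paff !pcst /m /f1 /f2 /dot /=; ring.
pose phi x := ppos 1 (Q x).
have sphi : smooth_expr phi by exact: smooth_ppos.
have supp : closure [set x | phi x != 0] `<=` [set x | 0 <= Q x].
  have cl : closed [set x | 0 <= Q x].
    rewrite (_ : mkset _ = Q @^-1` [set y | 0 <= y])//.
    by apply: closed_comp => [x _|]; [exact: cQ|exact: closed_ge].
  rewrite [X in _ `<=` X](closure_id _).1//; apply: closure_subset => x /=.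
  by apply: contraNT; rewrite -ltNge => /ltW Q0; rewrite /phi ppos_le0.
have QO : [set x | 0 <= Q x] `<=` Omega.
  move=> x /=; rewrite QE subr_ge0 => h; apply: dO.
  by move: h; rewrite ler_pXn2r// nnegrE ?enorm_ge0// ltW.
have sO := subset_trans supp QO.
have tphi : test_fun Omega phi.
  split; [exact: smooth_exprP| |exact: sO].
  by apply: (closed_subset_compact bO) => //; exact: closed_closure.
exists phi; split=> //; rewrite lt_neqAle nrm_ge0 andbT; apply/eqP => /esym n0.
have [_ bpd] := test_fun_bm T oO bO tphi.
have bg : bm (fun x => enorm (grad phi x)) by apply: bm_enorm; [exact: (bpd false)|exact: (bpd true)].
(* Inside the disc [dppos] is positive, and off the line [x.1 = z.1] the first partial derivative of
   [Q] is nonzero. *)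
pose B : set (R * R) := [set x | 0 < Q x] `&` [set x | x.1 != z.1].
have oB : open B.
  apply: openI.
    rewrite (_ : mkset _ = Q @^-1` [set y | 0 < y])//.
    by apply: open_comp => [x _|]; [exact: cQ|exact: open_gt].
  rewrite (_ : mkset _ = fst @^-1` [set y | y != z.1])//.
  by apply: open_comp => [x _|]; [exact: cvg_fst|exact: open_neq].
have oA : open (U `&` B) by apply: openI => //; exact: open_mesh_interior.
have gA y : (U `&` B) y -> enorm (grad phi y) != 0.
  move=> [_ [/= Qy yz]]; have dp : dppos 1 (Q y) != 0.
    by rewrite /dppos Qy gt_eqF// mulr_gt0 ?expR_gt0// addr_gt0// divr_gt0.
  apply/eqP => /enorm_eq0; rewrite /phi grad_ppos// => /(congr1 fst) /= /eqP.
  by apply/negP; rewrite -[_ *: _]/(_ * _) pdQ !mulf_neq0// ?oppr_eq0 ?subr_eq0 ?pnatr_eq0.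
have A0 := bm_nrm_eq0 oO bO cT p0 bg n0 oA (fun x h => h.1) gA.
have [x Ax] : (U `&` B) !=set0.
  apply: (mesh_dense oO cT oB); exists (z + (d / 2, 0)).
  have e2 : enorm (z + (d / 2, 0) - z) ^+ 2 = (d / 2) ^+ 2.
    by rewrite enorm_sqr /dot /=; ring.
  have d22 : (d / 2) ^+ 2 < d ^+ 2.
    rewrite ltr_pXn2r// ?nnegrE ?divr_ge0// ?(ltW d0)//.
    by rewrite ltr_pdivrMr// ltr_pMr// ltr1n.
  have Q0 : 0 < Q (z + (d / 2, 0)) by rewrite QE e2 subr_gt0.
  split; first exact: QO (ltW Q0).
  split => //=; rewrite -subr_eq0 addrAC subrr add0r.
  by rewrite mulf_neq0// ?invr_neq0// ?gt_eqF.
by have : (set0 : set (R * R)) x by rewrite -A0.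
Unshelve. all: by end_near. Qed.

End Bump.

(** * The heat equation for frozen temperature and velocity *)

Section Temperature.
Variables (R : realType) (Omega : set (R * R)) (T : seq {ffun 'I_3 -> R * R}).
Hypothesis oO : open Omega.
Hypothesis bO : bounded_set Omega.
Hypothesis cT : conforming_mesh Omega T.
Implicit Types (u : R * R -> R * R) (S theta tau : R * R -> R).
Local Notation U := (mesh_interior Omega T).
Local Notation bm := (bm Omega T).

Lemma eq_grad_U S tau : (forall x, U x -> S x = tau x) -> forall x, U x -> grad S x = grad tau x.
Proof.
move=> e x Ux; have n : \near x, S x = tau x by apply: (eq_near_open _ Ux e); exact: open_mesh_interior.
by rewrite /grad /pd !(near_eq_derive _ n).
Qed.

Lemma Vh_grad_dot_bm S tau : Vh Omega T S -> Vh Omega T tau ->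
  bm (fun x => dot (grad S x) (grad tau x)).
Proof.
move=> VS Vt; have bS i := PA_pd_bm oO i (Vh_PA VS); have bt i := PA_pd_bm oO i (Vh_PA Vt).
exact: bmD (bmM (bS false) (bt false)) (bmM (bS true) (bt true)).
Qed.

Lemma Vh_dot_grad_bm u S : PAv T u -> Vh Omega T S -> bm (fun x => dot (u x) (grad S x)).
Proof.
move=> [u1 u2] VS; have bS i := PA_pd_bm oO i (Vh_PA VS).
exact: bmD (bmM (PA_bm oO bO u1) (bS false)) (bmM (PA_bm oO bO u2) (bS true)).
Qed.

Lemma conv_bm tau u S : Vh Omega T tau -> PAv T u -> Vh Omega T S ->
  bm (fun x => tau x * dot (u x) (grad S x)).
Proof.
by move=> Vt Pu VS; apply: bmM; [apply: PA_bm => //; exact: Vh_PA Vt|exact: Vh_dot_grad_bm].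
Qed.

Variable p : R.
Hypothesis p1 : 1 < p.
Hypothesis p2 : p < 2.
Local Notation q := (conj_exp p).
Local Notation N s S := (fine (nrmv Omega s (grad S))).

Lemma gt1_gt0 : 0 < p. Proof. exact: lt_trans ltr01 p1. Qed.

Lemma conj_exp_gt0 : 0 < q. Proof. by rewrite /conj_exp divr_gt0 ?gt1_gt0// subr_gt0. Qed.

Lemma conj_exp_invD : p^-1 + q^-1 = 1.
Proof.
have p0 := gt1_gt0; have h : p - 1 != 0 by rewrite subr_eq0 gt_eqF.
by rewrite /conj_exp; field; rewrite ?h ?gt_eqF.
Qed.

Lemma nrmv_grad_fin s S : 0 < s -> Vh Omega T S -> nrmv Omega s (grad S) \is a fin_num.
Proof. by move=> s0 VS; apply: (bm_nrm_fin oO bO cT) => //; exact: Vh_grad_bm VS. Qed.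

Lemma nrmv_grad_ge0 s S : 0 <= N s S.
Proof. by rewrite fine_ge0// nrm_ge0. Qed.

Lemma nrmv_grad_eq0 s S : 0 < s -> Vh Omega T S -> N s S <= 0 -> forall x, Omega x -> S x = 0.
Proof.
move=> s0 VS N0; apply: (Vh_nrmv_eq0 oO bO cT s0 VS).
have e : N s S = 0 by apply/eqP; rewrite eq_le N0 nrmv_grad_ge0.
by rewrite -(fineK (nrmv_grad_fin s0 VS)) e.
Qed.

Lemma nrmv_gradU s S : 0 < s -> nrmv Omega s (gradU Omega T S) = nrmv Omega s (grad S).
Proof.
move=> s0; apply: (eq_nrm_U oO cT); first by rewrite gt_eqF.
by move=> x Ux; rewrite /gradU mem_set.
Qed.

Local Notation r := (2 * p / (2 - p)).

Lemma sobolev_exp_gt0 : 0 < r.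
Proof. by rewrite divr_gt0 ?subr_gt0// mulr_gt0// gt1_gt0. Qed.

Lemma sobolev_exp_invD : r^-1 + 2^-1 + q^-1 = 1.
Proof.
have p0 := gt1_gt0; have h : p - 1 != 0 by rewrite subr_eq0 gt_eqF.
have h2 : 2 - p != 0 by rewrite subr_eq0 gt_eqF.
by rewrite /conj_exp; field; rewrite ?h ?h2 ?gt_eqF.
Qed.

(** The hypothesis on [Ce] excludes an empty set of admissible constants, whose infimum is 0 by
    convention. The bound by each admissible constant then passes to the infimum, after division by
    the gradient norm when this is positive. *)
Lemma sobolev S : Vh Omega T S -> Ce Omega p != 0 ->
  fine (nrm Omega r S) <= Ce Omega p * N p S.
Proof.
move=> VS C0; have p0 := gt1_gt0.
have bS : bm S by apply: PA_bm => //; exact: Vh_PA VS.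
have fS : nrm Omega r S \is a fin_num by apply: (bm_nrm_fin oO bO cT) => //; exact: sobolev_exp_gt0.
have fg := nrmv_grad_fin p0 VS.
pose E := [set C : R | 0 <= C /\ forall f g, W10 Omega p f g ->
  (nrm Omega r f <= C%:E * nrmv Omega p g)%E].
have E0 : E !=set0.
  by apply/set0P; apply: contra C0 => /eqP E0; rewrite /Ce -/E E0 inf0.
have SC C : E C -> fine (nrm Omega r S) <= C * N p S.
  move=> [_ /(_ _ _ (Vh_W10 oO bO cT p0 VS))]; rewrite nrmv_gradU//.
  by rewrite -(fineK fS) -(fineK fg) -EFinM lee_fin.
have [N0|N0] := leP (N p S) 0.
  have [C EC] := E0; have := SC C EC.
  have -> : N p S = 0 by apply/eqP; rewrite eq_le N0 nrmv_grad_ge0.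
  by rewrite !mulr0.
rewrite -ler_pdivrMr//; apply: lb_le_inf => // C EC.
by rewrite ler_pdivrMr//; exact: SC.
Qed.

Variables (kappa : R -> R) (Ck : R).
Hypothesis Ck0 : 0 < Ck.

Lemma conv_le tau u S : PAv T u -> Vh Omega T tau -> Vh Omega T S ->
  fine (nrmv Omega 2 u) <= (2 * Ce Omega p * Ck)^-1 ->
  int2 Omega (fun x => tau x * dot (u x) (grad S x)) <= (2 * Ck)^-1 * N p tau * N q S.
Proof.
move=> Pu Vt VS hu; have bt : bm tau by apply: PA_bm => //; exact: Vh_PA Vt.
have bu := PAv_enorm_bm oO bO Pu; have bg := Vh_grad_bm oO VS.
have bc := conv_bm Vt Pu VS.
apply: (@le_trans _ _ (fine (nrm Omega r tau) * fine (nrmv Omega 2 u) * N q S)).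
  apply: le_trans (hoelder3 oO bO cT sobolev_exp_gt0 conj_exp_gt0 sobolev_exp_invD bt bu bg).
  apply: (int2_le oO cT); [exact: bm_integr|
    by apply: bm_integr => //; apply: bm_norm; apply: bmM => //; exact: bmM|].
  move=> x _; rewrite (le_trans (ler_norm _))// -mulrA !normrM ler_wpM2l//.
  by rewrite !normr_enorm dot_le.
rewrite ler_wpM2r ?nrmv_grad_ge0//.
(* If [Ce] is 0, the bound on [u] reads [0^-1 = 0], so [u] has zero norm and so does the convection
   term. Otherwise [Ce] cancels. *)
have [C0|C0] := eqVneq (Ce Omega p) 0.
  have u0 : fine (nrmv Omega 2 u) = 0.
    apply/eqP; rewrite eq_le; apply/andP; split; last by rewrite fine_ge0// nrm_ge0.
    by move: hu; rewrite C0 mulr0 mul0r invr0.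
  by rewrite u0 mulr0 mulr_ge0 ?nrmv_grad_ge0// invr_ge0 mulr_ge0// ltW.
have -> : (2 * Ck)^-1 * N p tau = (Ce Omega p * N p tau) * (2 * Ce Omega p * Ck)^-1.
  by field; rewrite C0 gt_eqF.
by apply: ler_pM; rewrite ?fine_ge0 ?nrm_ge0//; exact: sobolev.
Qed.

Hypothesis hinfsup : discrete_infsup Omega T kappa p Ck.

(** Convection adds at most [(2 * Ck)^-1 * N p tau] to each quotient of the inf-sup inequality.
    Multiplied by [Ck], this is half of the left-hand side and is absorbed, whence the factor 2. The
    load [G] is left abstract: it is 0 for unique solvability and point evaluation for the bound on
    the temperature. *)
Lemma apriori theta tau u (G : (R * R -> R) -> R) (d : R) :
  Vh Omega T theta -> Vh Omega T tau -> PAv T u ->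
  fine (nrmv Omega 2 u) <= (2 * Ce Omega p * Ck)^-1 ->
  (forall S, Vh Omega T S -> G S <= d * N q S) ->
  (forall S, Vh Omega T S ->
     int2 Omega (fun x => kappa (theta x) * dot (grad tau x) (grad S x)) =
     G S + int2 Omega (fun x => tau x * dot (u x) (grad S x))) ->
  N p tau <= 2 * Ck * d.
Proof.
move=> Vth Vt Pu hu hG he; have fp := nrmv_grad_fin gt1_gt0 Vt.
have sle : (ereal_sup (infsup_quotients Omega T kappa p theta tau) <= (d + (2 * Ck)^-1 * N p tau)%:E)%E.
  apply: ge_ereal_sup => _ [S [VS [x Ox Sx]] <-]; rewrite lee_fin.
  have Nq : 0 < N q S.
    rewrite ltNge; apply/negP => h; move: Sx.
    by rewrite (nrmv_grad_eq0 conj_exp_gt0 VS h Ox) eqxx.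
  rewrite ler_pdivrMr// he// mulrDl lerD//; first exact: hG.
  exact: conv_le.
have C0 : (0 <= Ck%:E)%E by rewrite lee_fin ltW.
have := le_trans (hinfsup Vth Vt) (lee_wpmul2l C0 sle).
rewrite -(fineK fp) -EFinM lee_fin => h.
have e : Ck * (d + (2 * Ck)^-1 * N p tau) = Ck * d + N p tau / 2 by field; rewrite gt_eqF.
have aux (a b : R) : a <= b + a / 2 -> a <= 2 * b by move=> ?; lra.
by rewrite -mulrA; apply: aux; rewrite -e.
Qed.

Variables (kappa_min kappa_max : R).
Hypothesis kappa_lip : lipschitz kappa.
Hypothesis kappa_min_gt0 : 0 < kappa_min.
Hypothesis kappa_bd : forall s, kappa_min <= kappa s <= kappa_max.
Variables (n : nat) (e : 'I_n -> R * R -> R).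
Hypothesis Ve : forall i, Vh Omega T (e i).
Hypothesis e_free : forall c : 'rV[R]_n,
  (forall y, U y -> (\sum_i c 0 i *: e i) y = 0) -> c = 0.
Hypothesis e_span : forall S, Vh Omega T S -> exists c : 'rV[R]_n,
  forall y, U y -> S y = (\sum_i c 0 i *: e i) y.
Local Notation comb := (comb e).
Implicit Types c : 'rV[R]_n.

Definition transport theta u tau S : R := int2 Omega (fun x =>
  kappa (theta x) * dot (grad tau x) (grad S x) - tau x * dot (u x) (grad S x)).

Lemma diff_bm theta tau S : Vh Omega T theta -> Vh Omega T tau -> Vh Omega T S ->
  bm (fun x => kappa (theta x) * dot (grad tau x) (grad S x)).
Proof.
move=> Vth Vt VS; apply: bmM; last exact: Vh_grad_dot_bm.
apply: (coef_bm kappa_lip kappa_min_gt0 kappa_bd).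
by apply: PA_bm => //; exact: Vh_PA Vth.
Qed.

Lemma transport_bm theta u tau S : Vh Omega T theta -> PAv T u -> Vh Omega T tau -> Vh Omega T S ->
  bm (fun x => kappa (theta x) * dot (grad tau x) (grad S x) - tau x * dot (u x) (grad S x)).
Proof. by move=> *; apply: bmD; [exact: diff_bm|apply: bmN; exact: conv_bm]. Qed.

Lemma transport_suml theta u c S : Vh Omega T theta -> PAv T u -> Vh Omega T S ->
  transport theta u (comb c) S = \sum_i c 0 i * transport theta u (e i) S.
Proof.
move=> Vth Pu VS; rewrite -(int2_sum oO bO cT); last first.
  by move=> i; apply: bm_integr => //; exact: transport_bm.
apply: (eq_int2_U oO cT) => x Ux; rewrite (grad_comb Ve _ Ux) combE dot_suml.
rewrite mulr_sumr mulr_suml -sumrB; apply: eq_bigr => i _; ring.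
Qed.

Lemma transport_sumr theta u tau c : Vh Omega T theta -> PAv T u -> Vh Omega T tau ->
  transport theta u tau (comb c) = \sum_i c 0 i * transport theta u tau (e i).
Proof.
move=> Vth Pu Vt; rewrite -(int2_sum oO bO cT); last first.
  by move=> i; apply: bm_integr => //; exact: transport_bm.
apply: (eq_int2_U oO cT) => x Ux; rewrite (grad_comb Ve _ Ux) ![dot _ (\sum_i _)]dotC !dot_suml.
rewrite !mulr_sumr -sumrB; apply: eq_bigr => i _; rewrite ![dot (grad (e i) x) _]dotC; ring.
Qed.

Definition tempB theta u : 'M[R]_n := \matrix_(i, j) transport theta u (e i) (e j).

Lemma transport_span theta u tau S c : (forall x, U x -> S x = comb c x) ->
  transport theta u tau S = transport theta u tau (comb c).
Proof. by move=> h; apply: (eq_int2_U oO cT) => x Ux; rewrite (eq_grad_U h Ux). Qed.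

Lemma tempB_mulE theta u c j : Vh Omega T theta -> PAv T u ->
  (c *m tempB theta u) 0 j = transport theta u (comb c) (e j).
Proof. by move=> *; rewrite transport_suml// mxE; apply: eq_bigr => i _; rewrite mxE. Qed.

Lemma transport_split theta u tau S g : Vh Omega T theta -> PAv T u -> Vh Omega T tau -> Vh Omega T S ->
  transport theta u tau S = g ->
  int2 Omega (fun x => kappa (theta x) * dot (grad tau x) (grad S x)) =
  g + int2 Omega (fun x => tau x * dot (u x) (grad S x)).
Proof.
move=> Vth Pu Vt VS <-; rewrite /transport (int2B oO cT) ?subrK//; apply: bm_integr => //.
  exact: diff_bm.
exact: conv_bm.
Qed.

(** A kernel vector solves the equation with zero load, so [apriori] with [d = 0] makes its gradient
    norm vanish. *)
Lemma tempB_unit theta u : Vh Omega T theta -> PAv T u ->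
  fine (nrmv Omega 2 u) <= (2 * Ce Omega p * Ck)^-1 -> tempB theta u \in unitmx.
Proof.
move=> Vth Pu hu; apply: row_unitmx => c cB; apply: e_free => x [Ox _].
have Vc := comb_Vh Ve c.
apply: (nrmv_grad_eq0 gt1_gt0 Vc) => //.
rewrite -(mulr0 (2 * Ck)); apply: (apriori (G := fun=> 0) Vth Vc Pu hu) => S VS.
  by rewrite mul0r.
apply: transport_split => //; have [s hs] := e_span VS.
rewrite (transport_span _ _ _ hs) transport_sumr// big1// => j _.
by rewrite -tempB_mulE// cB mxE mulr0.
Qed.

Variable z : R * R.
Hypothesis Oz : Omega z.

Definition tempS theta u : 'rV[R]_n := (\row_j e j z) *m invmx (tempB theta u).

Lemma tempSE theta u S : Vh Omega T theta -> PAv T u ->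
  fine (nrmv Omega 2 u) <= (2 * Ce Omega p * Ck)^-1 -> Vh Omega T S ->
  transport theta u (comb (tempS theta u)) S = S z.
Proof.
move=> Vth Pu hu VS; have [s hs] := e_span VS.
rewrite (transport_span _ _ _ hs) transport_sumr//; last exact: comb_Vh.
rewrite (Vh_eq oO cT VS (comb_Vh Ve s) hs Oz) combE; apply: eq_bigr => j _; congr (_ * _).
by rewrite -tempB_mulE// /tempS mulmxKV ?tempB_unit// mxE.
Qed.

Lemma tempS_apriori theta u d : Vh Omega T theta -> PAv T u ->
  fine (nrmv Omega 2 u) <= (2 * Ce Omega p * Ck)^-1 ->
  (forall S, Vh Omega T S -> S z <= d * N q S) ->
  N p (comb (tempS theta u)) <= 2 * Ck * d.
Proof.
move=> Vth Pu hu hd; have Vc := comb_Vh Ve (tempS theta u).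
apply: (apriori (G := fun S => S z) Vth Vc Pu hu hd) => S VS.
by apply: transport_split => //; exact: tempSE.
Qed.

Lemma grad_norm1_hoelder s t c : 0 < s -> 0 < t -> s^-1 + t^-1 = 1 ->
  grad_norm1 Omega e c <= N s (comb c) * fine (nrm Omega t (fun=> 1)).
Proof.
move=> s0 t0 st; have bg := Vh_grad_bm oO (comb_Vh Ve c).
apply: le_trans (hoelder_int2 oO bO cT s0 t0 st bg (bm_cst _ _ 1)).
rewrite /grad_norm1 le_eqVlt; apply/orP; left; apply/eqP.
by congr int2; apply/funext => x; rewrite mulr1 normr_enorm.
Qed.

(** Point evaluation is bounded by finite dimension: a mesh-dependent constant comes from norm
    equivalence and Hoelder. It only serves to bound the range of the fixed-point map. *)
Lemma dirac_bound : exists d, forall S, Vh Omega T S -> S z <= d * N q S.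
Proof.
have [c0 c0_gt0 hc0] := grad_norm1_equiv oO bO cT Ve e_free.
pose M := \sum_i `|e i z|; have M0 : 0 <= M by apply: sumr_ge0.
exists (M * c0^-1 * fine (nrm Omega p (fun=> 1))) => S VS; have [s hs] := e_span VS.
have -> : N q S = N q (comb s).
  congr fine; apply: (eq_nrm_U oO cT); first by rewrite gt_eqF// conj_exp_gt0.
  by move=> x Ux; rewrite (eq_grad_U hs Ux).
rewrite (Vh_eq oO cT VS (comb_Vh Ve s) hs Oz) combE.
have h := le_trans (hc0 s) (grad_norm1_hoelder s conj_exp_gt0 gt1_gt0 (etrans (addrC _ _) conj_exp_invD)).
have -> : M * c0^-1 * fine (nrm Omega p (fun=> 1)) * N q (comb s) =
  M * (c0^-1 * (N q (comb s) * fine (nrm Omega p (fun=> 1)))) by ring.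
apply: (@le_trans _ _ (M * `|s|)).
  rewrite mulr_suml ler_sum// => i _; rewrite (le_trans (ler_norm _))// normrM mulrC ler_wpM2l//.
  exact: mx_norm_ge.
by rewrite ler_wpM2l// ler_pdivlMl.
Qed.

Lemma tempS_bounded : exists rr, forall theta u, Vh Omega T theta -> PAv T u ->
  fine (nrmv Omega 2 u) <= (2 * Ce Omega p * Ck)^-1 -> `|tempS theta u| <= rr.
Proof.
have [c0 c0_gt0 hc0] := grad_norm1_equiv oO bO cT Ve e_free.
have [d hd] := dirac_bound.
exists (c0^-1 * (2 * Ck * d * fine (nrm Omega q (fun=> 1)))) => theta u Vth Pu hu.
rewrite ler_pdivlMl//; apply: (le_trans (hc0 _)).
apply: (le_trans (grad_norm1_hoelder _ gt1_gt0 conj_exp_gt0 conj_exp_invD)).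
by rewrite ler_wpM2r ?fine_ge0 ?nrm_ge0//; exact: tempS_apriori.
Qed.

End Temperature.

(** * The discrete divergence and the pressure *)

Section Divergence.
Variables (R : realType) (Omega : set (R * R)) (T : seq {ffun 'I_3 -> R * R}).
Hypothesis oO : open Omega.
Hypothesis bO : bounded_set Omega.
Hypothesis cT : conforming_mesh Omega T.
Implicit Types (v w : R * R -> R * R) (q : R * R -> R).
Local Notation U := (mesh_interior Omega T).
Local Notation bm := (bm Omega T).

Lemma eq_div_U v w : (forall x, U x -> v x = w x) -> forall x, U x -> div v x = div w x.
Proof.
move=> e x Ux; have [n1 n2] : (\near x, (v x).1 = (w x).1) /\ (\near x, (v x).2 = (w x).2).
  by split; (apply: (eq_near_open _ Ux) => [|y Uy]; [exact: open_mesh_interior|rewrite e]).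
by rewrite /div /pd (near_eq_derive _ n1) (near_eq_derive _ n2).
Qed.

Lemma div_lin (k : R) v w x : PAv T v -> PAv T w -> U x -> div (k *: v + w) x = k * div v x + div w x.
Proof.
move=> [v1 v2] [w1 w2] Ux; rewrite /div.
have -> : pd false (fun y => ((k *: v + w) y).1) x = _ := pd_lin k false v1 w1 Ux.
have -> : pd true (fun y => ((k *: v + w) y).2) x = _ := pd_lin k true v2 w2 Ux.
ring.
Qed.

Lemma div0 x : U x -> div (0 : R * R -> R * R) x = 0.
Proof.
move=> Ux; have P0 : PAv T (0 : R * R -> R * R) by split; exact: PA0.
by have := div_lin (-1) P0 P0 Ux; rewrite scaler0 addr0 mulN1r addNr.
Qed.

Lemma div_sum m (c : 'rV[R]_m) (b : 'I_m -> R * R -> R * R) x : (forall i, PAv T (b i)) -> U x ->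
  div (\sum_i c 0 i *: b i) x = \sum_i c 0 i * div (b i) x.
Proof.
move=> Pb Ux; pose P (v : R * R -> R * R) (s : R) := PAv T v /\ div v x = s.
suff [] : P (\sum_i c 0 i *: b i) (\sum_i c 0 i * div (b i) x) by [].
elim/big_rec2: _ => [|i s v _ [Pv e]]; first by split; [split; exact: PA0|exact: div0].
by split; [exact: PAv_lin|rewrite div_lin// e].
Qed.

Lemma div_bm q v : PA T q -> PAv T v -> bm (fun x => q x * div v x).
Proof.
move=> Pq [v1 v2]; apply: bmM; first exact: PA_bm.
exact: bmD (PA_pd_bm oO false v1) (PA_pd_bm oO true v2).
Qed.

Lemma int2_div_suml m (c : 'rV[R]_m) (g : 'I_m -> R * R -> R) v : (forall j, PA T (g j)) -> PAv T v ->
  int2 Omega (fun x => (\sum_j c 0 j *: g j) x * div v x) =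
  \sum_j c 0 j * int2 Omega (fun x => g j x * div v x).
Proof.
move=> Pg Pv; rewrite -(int2_sum oO bO cT); last by move=> i; apply: bm_integr => //; exact: div_bm.
apply: (eq_int2_U oO cT) => x Ux; rewrite sum_fctE mulr_suml.
by apply: eq_bigr => i _; rewrite mulrA.
Qed.

Lemma int2_div_sumr m (c : 'rV[R]_m) (b : 'I_m -> R * R -> R * R) q : PA T q -> (forall i, PAv T (b i)) ->
  int2 Omega (fun x => q x * div (\sum_i c 0 i *: b i) x) =
  \sum_i c 0 i * int2 Omega (fun x => q x * div (b i) x).
Proof.
move=> Pq Pb; rewrite -(int2_sum oO bO cT); last by move=> i; apply: bm_integr => //; exact: div_bm.
apply: (eq_int2_U oO cT) => x Ux; rewrite div_sum// mulr_sumr.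
by apply: eq_bigr => i _; rewrite mulrCA.
Qed.

Definition Zh v := Xh Omega T v /\
  forall q, Qh Omega T q -> int2 Omega (fun x => q x * div v x) = 0.

Lemma Zh0 : Zh 0.
Proof.
split=> [|q _]; first exact: Xh0.
rewrite (eq_int2_U oO cT (g := fun=> 0)) ?(int2_0 oO cT)// => x Ux.
by rewrite div0// mulr0.
Qed.

Lemma Zh_lin (k : R) v w : Zh v -> Zh w -> Zh (k *: v + w).
Proof.
move=> [Xv zv] [Xw zw]; split=> [|q Qq]; first exact: Xh_lin.
have [Pv Pw Pq] := And3 (Xh_PAv Xv) (Xh_PAv Xw) (Qh_PA Qq).
rewrite (eq_int2_U oO cT (g := fun x => k * (q x * div v x) + q x * div w x)) => [|x Ux].
  by rewrite (int2_lin oO cT) ?zv ?zw ?mulr0 ?addr0//; apply: bm_integr => //; exact: div_bm.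
by rewrite div_lin//; ring.
Qed.

Lemma pressure (nu : R -> R) nu_min nu_max (f u : R * R -> R * R) (theta : R * R -> R) :
  lipschitz nu -> 0 < nu_min -> (forall s, nu_min <= nu s <= nu_max) -> Lpv Omega 2 f ->
  bm theta -> PAv T u ->
  (forall v, Zh v -> int2 Omega (fun x => nu (theta x) * dot (u x) (v x)) =
     int2 Omega (fun x => dot (f x) (v x))) ->
  exists2 ph, Qh Omega T ph & forall v, Xh Omega T v ->
    int2 Omega (fun x => nu (theta x) * dot (u x) (v x) - ph x * div v x) =
    int2 Omega (fun x => dot (f x) (v x)).
Proof.
move=> nl n0 nb Lf bt Pu hZ.
have [m [b [Xb _ b_span]]] := PAv_basis oO (Xh0 oO bO cT) (Xh_lin oO bO cT) (@Xh_PAv _ _ _).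
have [l [g [Qg _ g_span]]] := PA_basis oO (Qh0 oO bO cT) (Qh_lin oO bO cT) (@Qh_PA _ _ _).
have Pb i := Xh_PAv (Xb i); have Pg j := Qh_PA (Qg j).
(* The left kernel of [D] consists of the coefficients of members of Z_h, because [g] spans Q_h on
   [U]. The column [c] below is the momentum residual on the basis [b], so it vanishes on that
   kernel. *)
pose D : 'M[R]_(m, l) := \matrix_(i, j) int2 Omega (fun x => g j x * div (b i) x).
pose N v := int2 Omega (fun x => nu (theta x) * dot (u x) (v x)).
pose F v := int2 Omega (fun x => dot (f x) (v x)).
pose c : 'cV[R]_m := \col_i (N (b i) - F (b i)).
have NFsum (x : 'rV[R]_m) : N (\sum_i x 0 i *: b i) - F (\sum_i x 0 i *: b i) = (x *m c) 0 0.
  rewrite /N /F (weighted_dot_sumr oO bO cT nl n0 nb Pb)// (force_sum oO bO cT Lf Pb) -sumrB mxE.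
  by apply: eq_bigr => i _; rewrite mxE -mulrBr.
have [x xD|r cD] := dual_combination (D := D) (c := c).
  apply/matrixP => i0 j0; rewrite !ord1 -NFsum mxE; apply/eqP; rewrite subr_eq0; apply/eqP.
  apply: hZ; split; first by apply: subspace_sum => //; [exact: Xh0|exact: Xh_lin].
  move=> q Qq; have [s hs] := g_span q Qq.
  rewrite (eq_int2_U oO cT (g := fun y =>
    (\sum_j s 0 j *: g j) y * div (\sum_i x 0 i *: b i) y)); last first.
    by move=> y Uy; rewrite hs.
  rewrite int2_div_suml//; last exact: PAv_sum.
  apply: big1 => j _; rewrite int2_div_sumr//.
  have := congr1 (fun M : 'rV[R]_l => M 0 j) xD; rewrite !mxE => xDj.
  rewrite -[RHS](mulr0 (s 0 j)); congr (_ * _); rewrite -[RHS]xDj.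
  by apply: eq_bigr => i _; rewrite mxE.
pose ph := \sum_j r^T 0 j *: g j.
have Qp : Qh Omega T ph by apply: subspace_sum => //; [exact: Qh0|exact: Qh_lin].
exists ph => // v Xv; have [x hx] := b_span v Xv; have Pv := Xh_PAv Xv.
rewrite (int2B oO cT); first last.
- by apply: bm_integr => //; apply: div_bm => //; exact: Qh_PA Qp.
- by apply: bm_integr => //; exact: (weighted_dot_bm oO bO nl n0 nb).
have -> : int2 Omega (fun y => nu (theta y) * dot (u y) (v y)) = N (\sum_i x 0 i *: b i).
  by apply: (eq_int2_U oO cT) => y Uy; rewrite hx.
have -> : int2 Omega (fun y => dot (f y) (v y)) = F (\sum_i x 0 i *: b i).
  by apply: (eq_int2_U oO cT) => y Uy; rewrite hx.
have -> : int2 Omega (fun y => ph y * div v y) = (x *m (D *m r)) 0 0.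
  rewrite (eq_int2_U oO cT (g := fun y => ph y * div (\sum_i x 0 i *: b i) y)); last first.
    by move=> y Uy; rewrite (eq_div_U hx Uy).
  rewrite int2_div_sumr//; last exact: Qh_PA Qp.
  rewrite mxE; apply: eq_bigr => i _; congr (_ * _); rewrite int2_div_suml// mxE.
  by apply: eq_bigr => j _; rewrite !mxE mulrC.
by rewrite -cD -NFsum subKr.
Qed.

End Divergence.

Lemma continuous_mx (X K : topologicalType) m n (f : X -> 'M[K]_(m, n)) :
  (forall i j, continuous (fun x => f x i j)) -> continuous f.
Proof. by move=> cf x; apply: cvg_mx => i j; exact: cf. Qed.

Lemma continuous_sub (R : realType) (X : topologicalType) (f g : X -> R) :
  continuous f -> continuous g -> continuous (fun x => f x - g x).
Proof. by move=> cf cg x; apply: cvgB; [exact: cf|exact: cg]. Qed.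

Lemma continuous_lincomb (R : realType) (X : topologicalType) k (f : 'I_k -> X -> R) (c : 'I_k -> R) :
  (forall l, continuous (f l)) -> continuous (fun x => \sum_l f l x * c l).
Proof.
move=> cf; apply: continuous_big_sum => l x.
by apply: cvgM; [exact: cf|exact: cvg_cst].
Qed.

(** * Continuity and fixed point of the temperature map *)

Section FixedPoint.
Variables (R : realType) (Omega : set (R * R)) (T : seq {ffun 'I_3 -> R * R}).
Hypothesis oO : open Omega.
Hypothesis bO : bounded_set Omega.
Hypothesis cT : conforming_mesh Omega T.
Local Notation U := (mesh_interior Omega T).
Local Notation bm := (bm Omega T).
Variables (nu : R -> R) (nu_min nu_max : R) (f : R * R -> R * R).
Hypothesis nu_lip : lipschitz nu.
Hypothesis nu_min_gt0 : 0 < nu_min.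
Hypothesis nu_bd : forall s, nu_min <= nu s <= nu_max.
Hypothesis Lf : Lpv Omega 2 f.
Variables (p : R) (kappa : R -> R) (Ck kappa_min kappa_max : R).
Hypothesis p1 : 1 < p.
Hypothesis p2 : p < 2.
Hypothesis Ck0 : 0 < Ck.
Hypothesis hinfsup : discrete_infsup Omega T kappa p Ck.
Hypothesis kappa_lip : lipschitz kappa.
Hypothesis kappa_min_gt0 : 0 < kappa_min.
Hypothesis kappa_bd : forall s, kappa_min <= kappa s <= kappa_max.
Hypothesis f_small : (nrmv Omega 2 f <= ((2 * Ce Omega p * Ck)^-1 * nu_min)%:E)%E.
Variables (n k : nat) (e : 'I_n -> R * R -> R) (w : 'I_k -> R * R -> R * R).
Hypothesis Ve : forall i, Vh Omega T (e i).
Hypothesis e_free : forall c : 'rV[R]_n,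
  (forall y, U y -> (\sum_i c 0 i *: e i) y = 0) -> c = 0.
Hypothesis e_span : forall S, Vh Omega T S -> exists c : 'rV[R]_n,
  forall y, U y -> S y = (\sum_i c 0 i *: e i) y.
Hypothesis Pw : forall i, PAv T (w i).
Hypothesis w_free : forall y : 'rV[R]_k,
  (forall x, U x -> (\sum_i y 0 i *: w i) x = 0) -> y = 0.
Variable z : R * R.
Hypothesis Oz : Omega z.
Local Notation comb := (comb e).
Implicit Types x : 'rV[R]_n.

Definition uvel x : R * R -> R * R := \sum_i vel Omega nu f w (comb x) 0 i *: w i.

Definition temp_map x : 'rV[R]_n := tempS Omega kappa e z (comb x) (uvel x).

Lemma force_fin : nrmv Omega 2 f \is a fin_num.
Proof. by rewrite ge0_fin_numE ?nrm_ge0// (le_lt_trans f_small)// ltry. Qed.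

Lemma comb_bm x : bm (comb x).
Proof. by apply: PA_bm => //; exact: Vh_PA (comb_Vh Ve x). Qed.

Lemma uvel_PAv x : PAv T (uvel x).
Proof. exact: PAv_sum. Qed.

Lemma uvel_small x : fine (nrmv Omega 2 (uvel x)) <= (2 * Ce Omega p * Ck)^-1.
Proof.
have := vel_bound oO bO cT nu_lip nu_min_gt0 nu_bd Lf force_fin Pw w_free (comb_bm x).
rewrite -/(uvel x) => h; rewrite -(ler_pM2r nu_min_gt0) mulrC; apply: (le_trans h).
by rewrite -lee_fin fineK// force_fin.
Qed.

Lemma vel_continuous i : continuous (fun x => vel Omega nu f w (comb x) 0 i).
Proof.
apply: (continuous_solve (d := fun=> velF Omega f w) (A := fun x => velA Omega nu w (comb x))).
- by move=> j x; exact: cst_continuous.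
- move=> a b; rewrite (_ : (fun x => _) =
    fun x => int2 Omega (fun y => nu (comb x y) * dot (w a y) (w b y))).
    apply: (continuous_int_comb oO bO cT Ve nu_lip); first exact: coef_bounded nu_min_gt0 nu_bd.
    exact: PAv_dot_bm.
  by apply/funext => x; rewrite mxE.
- by move=> x; apply: (velA_unit oO bO cT nu_lip nu_min_gt0 nu_bd Pw w_free); exact: comb_bm.
Qed.

(** It isolates the dependence on [x]: the diffusion entry depends on it only through [kappa], and
    the convection entry is linear in the velocity coefficients with fixed weights. Continuity of
    the matrix entries follows from this form. *)
Lemma transport_uvel x i j : transport Omega kappa (comb x) (uvel x) (e i) (e j) =
  int2 Omega (fun y => kappa (comb x y) * dot (grad (e i) y) (grad (e j) y)) -
  \sum_l vel Omega nu f w (comb x) 0 l * int2 Omega (fun y => e i y * dot (w l y) (grad (e j) y)).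
Proof.
have bw l := conv_bm oO bO (Ve i) (Pw l) (Ve j).
have bd := diff_bm oO bO kappa_lip kappa_min_gt0 kappa_bd (comb_Vh Ve x) (Ve i) (Ve j).
have bc := conv_bm oO bO (Ve i) (uvel_PAv x) (Ve j).
rewrite /transport (int2B oO cT) //; [|exact: bm_integr|exact: bm_integr].
congr (_ - _); rewrite -(int2_sum oO bO cT); last by move=> l; exact: bm_integr.
congr int2; apply/funext => y; rewrite /uvel sum_vfctE dot_suml mulr_sumr.
by apply: eq_bigr => l _; rewrite mulrCA.
Qed.

Lemma temp_map_continuous : continuous temp_map.
Proof.
apply: continuous_mx => i0 j0; rewrite ord1.
apply: (continuous_solve (d := fun=> \row_j e j z)
  (A := fun x => tempB Omega kappa e (comb x) (uvel x))).
- by move=> j x; exact: cst_continuous.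
- move=> a b; rewrite (_ : (fun x => _) = fun x =>
    int2 Omega (fun y => kappa (comb x y) * dot (grad (e a) y) (grad (e b) y)) -
    \sum_l vel Omega nu f w (comb x) 0 l * int2 Omega (fun y => e a y * dot (w l y) (grad (e b) y))).
    have bg := Vh_grad_dot_bm oO (Ve a) (Ve b).
    have c1 := continuous_int_comb oO bO cT Ve kappa_lip (coef_bounded kappa_min_gt0 kappa_bd) bg.
    have c2 : continuous (fun x => \sum_l vel Omega nu f w (comb x) 0 l *
        int2 Omega (fun y => e a y * dot (w l y) (grad (e b) y))).
      by apply: continuous_lincomb; exact: vel_continuous.
    exact: continuous_sub c1 c2.
  by apply/funext => x; rewrite mxE transport_uvel.
- move=> x; apply: (tempB_unit oO bO cT p1 p2 Ck0 hinfsup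
    kappa_lip kappa_min_gt0 kappa_bd Ve e_free e_span).
  + exact: comb_Vh.
  + exact: uvel_PAv.
  + exact: uvel_small.
Qed.

Lemma temp_fixed_point : exists x, temp_map x = x.
Proof.
have [rr hr] := tempS_bounded oO bO cT p1 p2 Ck0 hinfsup
  kappa_lip kappa_min_gt0 kappa_bd Ve e_free e_span Oz.
apply: (brouwer (r := rr)); first exact: temp_map_continuous.
by move=> x; apply: hr; [exact: comb_Vh|exact: uvel_PAv|exact: uvel_small].
Qed.

End FixedPoint.

(** * Point evaluation and its dual norm *)

Section DeltaNorm.
Variables (R : realType) (Omega : set (R * R)) (T : seq {ffun 'I_3 -> R * R}).
Hypothesis oO : open Omega.
Hypothesis bO : bounded_set Omega.
Hypothesis cT : conforming_mesh Omega T.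
Variables (p : R) (z : R * R).
Hypothesis p1 : 1 < p.
Hypothesis Oz : Omega z.
Local Notation q := (conj_exp p).

(** Each quotient is nonnegative, and the bump function provides at least one. *)
Lemma delta_norm_ge0 : (0 <= delta_norm Omega p z)%E.
Proof.
have [phi [tphi g0]] := bump_exists oO bO cT (conj_exp_gt0 p1) (ex_intro _ z Oz).
apply: (@le_trans _ _ (`|delta z phi| / fine (nrmv Omega q (grad phi)))%:E).
  by rewrite lee_fin divr_ge0// fine_ge0// nrm_ge0.
apply: ereal_sup_ubound; exists phi, (grad phi); split=> //.
  by apply: (test_fun_W10 oO bO cT) => //; exact: conj_exp_gt0.
by move=> x _; have [s _ _] := tphi; apply: differentiable_continuous; exact: (s [::]).
Qed.

(** The pair [S], [gradU S] competes in the supremum. If its gradient norm is 0, then [S] vanishes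
    at [z], and the sign of [d] concludes. *)
Lemma delta_norm_Vh d S : delta_norm Omega p z = d%:E -> Vh Omega T S ->
  S z <= d * fine (nrmv Omega q (grad S)).
Proof.
move=> dE VS; have q0 := conj_exp_gt0 p1; have fS := nrmv_grad_fin oO bO cT q0 VS.
have [N0|N0] := leP (fine (nrmv Omega q (grad S))) 0.
  rewrite (nrmv_grad_eq0 oO bO cT q0 VS N0 Oz) mulr_ge0 ?fine_ge0 ?nrm_ge0//.
  by rewrite -lee_fin -dE delta_norm_ge0.
apply: le_trans (ler_norm _) _; rewrite -ler_pdivrMr// -lee_fin -dE.
apply: ereal_sup_ubound; exists S, (gradU Omega T S); rewrite (nrmv_gradU oO cT S q0); split=> //.
- exact: Vh_W10.
- by move=> x Ox; apply: (Vh_continuous oO VS).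
- by rewrite -(fineK fS) lte_fin.
Qed.

End DeltaNorm.

Theorem theorem4p4 (R : realType) (Omega : set (R * R))
  (hOmega : polygonal_domain Omega)
  (nu : R -> R) (nu_min nu_max : R)
  (hnu_lip : lipschitz nu) (hnu_min : 0 < nu_min)
  (hnu : forall s, nu_min <= nu s <= nu_max)
  (kappa : R -> R) (kappa_min kappa_max : R)
  (hkappa_lip : lipschitz kappa) (hkappa_min : 0 < kappa_min)
  (hkappa : forall s, kappa_min <= kappa s <= kappa_max)
  (H : set R) (Th : R -> seq {ffun 'I_3 -> R * R})
  (hTh : mesh_family Omega H Th)
  (Ckappa : R) (hCkappa : 0 < Ckappa)
  (hinfsup : exists h0 eps0 : R, [/\ 0 < h0, 0 < eps0 &
     forall p h : R, 2 - eps0 <= p < 2 -> H h -> h <= h0 ->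
       discrete_infsup Omega (Th h) kappa p Ckappa]) :
  exists hstar eps : R, [/\ 0 < hstar, 0 < eps &
    forall p h : R, 2 - eps <= p < 2 -> H h -> 0 < h <= hstar ->
    forall (z : R * R) (f : R * R -> R * R),
      Omega z -> Lpv Omega 2 f ->
      (nrmv Omega 2 f <= ((2 * Ce Omega p * Ckappa)^-1 * nu_min)%:E)%E ->
      exists (uh : R * R -> R * R) (ph Temp : R * R -> R),
        [/\ Xh Omega (Th h) uh, Qh Omega (Th h) ph & Vh Omega (Th h) Temp] /\
        [/\ forall v, Xh Omega (Th h) v ->
              int2 Omega (fun x =>
                nu (Temp x) * dot (uh x) (v x) - ph x * div v x) =
              int2 Omega (fun x => dot (f x) (v x)),
            forall q, Qh Omega (Th h) q ->
              int2 Omega (fun x => q x * div uh x) = 0,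
            forall S, Vh Omega (Th h) S ->
              int2 Omega (fun x =>
                kappa (Temp x) * dot (grad Temp x) (grad S x)
                - Temp x * dot (uh x) (grad S x)) = delta z S &
            B_T Omega (Th h) p Ckappa z Temp]].
Proof.
have [oO [_ _] bO _ _] := hOmega.
have [h0 [eps0 [h0_gt0 eps0_gt0 infsup]]] := hinfsup.
(* The cap at one half keeps [p >= 3/2], so that [p > 1] and the conjugate exponent is finite and
   positive. *)
exists h0, (Num.min eps0 2^-1); split=> //; first by rewrite lt_min eps0_gt0 /= invr_gt0 ltr0n.
move=> p h /andP[pl p2] Hh /andP[_ hh0] z f Oz Lf fsmall.
have [pl0 p1] : 2 - eps0 <= p /\ 1 < p.
  have h1 : Num.min eps0 2^-1 <= eps0 by rewrite ge_min lexx.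
  have h2 : Num.min eps0 2^-1 <= 2^-1 by rewrite ge_min lexx orbT.
  by move: (Num.min eps0 2^-1) pl h1 h2 => m pl h1 h2; split; lra.
have his : discrete_infsup Omega (Th h) kappa p Ckappa by apply: infsup => //; rewrite pl0.
have [_ cT _] := hTh.1 h Hh.
have [n [e [Ve e_free e_span]]] := PA_basis oO (Vh0 Omega (Th h)) (@Vh_lin _ _ _) (@Vh_PA _ _ _).
have [k [w [Zw w_free w_span]]] := PAv_basis oO (Zh0 oO bO cT) (Zh_lin oO bO cT)
  (fun v Zv => Xh_PAv Zv.1).
have Pw i := Xh_PAv (Zw i).1.
have [x hx] := temp_fixed_point oO bO cT hnu_lip hnu_min hnu Lf p1 p2 hCkappa his
  hkappa_lip hkappa_min hkappa fsmall Ve e_free e_span Pw w_free Oz.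
set u := uvel Omega nu f e w x.
have Pu : PAv (Th h) u by exact: uvel_PAv.
have usmall : fine (nrmv Omega 2 u) <= (2 * Ce Omega p * Ckappa)^-1.
  exact: (uvel_small oO bO cT hnu_lip hnu_min hnu Lf fsmall Ve Pw w_free).
have VT := comb_Vh Ve x.
have Zu : Zh Omega (Th h) u.
  exact: (subspace_sum (Zh0 oO bO cT) (Zh_lin oO bO cT) _ Zw).
have bT := comb_bm oO bO Ve x.
have [|ph Qp hp] := pressure oO bO cT hnu_lip hnu_min hnu Lf bT Pu.
  move=> v Zv; have [y hy] := w_span v Zv.
  rewrite (eq_int2_U oO cT (g := fun s =>
    nu (comb e x s) * dot (u s) ((\sum_i y 0 i *: w i) s))); last first.
    by move=> s Us; rewrite hy.
  rewrite (velE oO bO cT hnu_lip hnu_min hnu Lf Pw w_free y bT).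
  by apply: (eq_int2_U oO cT) => s Us; rewrite hy.
have hx' : tempS Omega kappa e z (comb e x) u = x := hx.
exists u, ph, (comb e x); split; first by split=> //; exact: Zu.1.
split=> //.
- exact: Zu.2.
- move=> S VS; have := tempSE oO bO cT p1 p2 hCkappa his hkappa_lip hkappa_min hkappa
    Ve e_free e_span Oz VT Pu usmall VS.
  by rewrite hx'.
split=> //; have fT := nrmv_grad_fin oO bO cT (gt1_gt0 p1) VT.
have C2 : C_tilde Ckappa 2^-1 = 2 * Ckappa by rewrite /C_tilde; field.
have d0 := delta_norm_ge0 oO bO cT p1 Oz; rewrite C2.
(* For an infinite dual norm the right-hand side is [+oo], because [Ckappa] is positive; [-oo] is
   ruled out by nonnegativity. *)
case dE : (delta_norm Omega p z) d0 => [d| |]// d0; last first.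
  by rewrite gt0_muley ?leey// lte_fin mulr_gt0.
rewrite -(fineK fT) -EFinM lee_fin.
have := tempS_apriori oO bO cT p1 p2 hCkappa his hkappa_lip hkappa_min hkappa
  Ve e_free e_span Oz VT Pu usmall (fun S VS => delta_norm_Vh oO bO cT p1 Oz dE VS).
by rewrite hx'.
Qed.
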